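(* Let $r\ge 3$ and let constants satisfy $1/n\ll \alpha\ll \gamma\ll 1/r$, where $n$ is divisible by $r$. Let $G$ be an $n$-vertex graph with $\delta(G)\ge (1-1/r-\alpha)n$. If $G$ has no $\gamma$-sparse $\frac{n}{r}$-set, then there is an algorithm running in time $O(n^{4r^2})$ that finds a $K_r$-factor in $G$.
   Context: A vertex subset $U$ of an $n$-vertex graph $G$ is a $\gamma$-sparse $k$-set if $|U|=k$ and $e(G[U])<\gamma n^2$. A $K_r$-factor is a collection of vertex-disjoint copies of $K_r$ covering all vertices. The hierarchy notation $x\ll y$ means that for every $y>0$ there exists $x_0>0$ such that for all $x<x_0$ the statement holds; longer hierarchies are read from right to left. *)

(* Defs.v *)
From mathcomp Require Import all_boot all_order all_algebra.
From mathcomp Require Import reals.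

Set Implicit Arguments.
Unset Strict Implicit.
Unset Printing Implicit Defensive.

Import Order.TTheory GRing.Theory Num.Theory.

(* Finite simple graphs are given by a symmetric irreflexive relation. *)
Section Graphs.
Variable T : finType.
Implicit Types (e : rel T) (U S : {set T}).

Definition degree e (v : T) : nat := #|[set u | e v u]|.

(* The default value #|T| is never attained by a vertex of a simple graph, so
   this is the true minimum as soon as T is inhabited. *)
Definition min_degree e : nat := \big[minn/#|T|]_(v : T) degree e v.

Definition edges e : {set {set T}} :=
  [set [set p.1; p.2] | p in [set p : T * T | e p.1 p.2]].

Definition induced_edges e U : {set {set T}} :=
  [set E in edges e | E \subset U].

Definition sparse_set (R : realType) e (gamma : R) (k : nat) U : Prop :=
  #|U| = k /\ (#|induced_edges e U|%:R < gamma * #|T|%:R ^+ 2)%R.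

Definition is_clique e (r : nat) S : Prop :=
  #|S| = r /\ {in S &, forall x y, x != y -> e x y}.

(* A copy of K_r is identified with its vertex set. *)
Definition is_Kr_factor e (r : nat) (F : {set {set T}}) : Prop :=
  [/\ forall S, S \in F -> is_clique e r S, trivIset F & cover F = [set: T]].

End Graphs.

(* Algorithms are programs for a deterministic word RAM with w-bit words:
   finitely many registers, a random access memory, and unit-cost arithmetic,
   comparison and addressing on words.  Programs are structured (if/while)
   rather than made of jumps. *)
Inductive binop := Add | Sub | Mul | Div | Mod | Eq | Lt.

Inductive expr :=
  | Const of nat
  | Reg of nat
  | Read of expr
  | Bin of binop & expr & expr.

Inductive cmd :=
  | Skip
  | Assign of nat & expr
  | Write of expr & expr
  | Seq of cmd & cmd
  | If of expr & cmd & cmd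
  | While of expr & cmd.

Record state := State { regs : nat -> nat; mem : nat -> nat }.

Definition upd (f : nat -> nat) (a v : nat) : nat -> nat :=
  fun b => if b == a then v else f b.

Definition set_reg (s : state) x v := State (upd (regs s) x v) (mem s).
Definition set_mem (s : state) a v := State (regs s) (upd (mem s) a v).

(* Subtraction is truncated at 0; division and remainder by 0 follow ssrnat. *)
Definition binop_fun (o : binop) (a b : nat) : nat :=
  match o with
  | Add => a + b
  | Sub => a - b
  | Mul => a * b
  | Div => a %/ b
  | Mod => a %% b
  | Eq => a == b
  | Lt => a < b
  end.

(* Words overflow silently: arithmetic is modulo 2 ^ w. *)
Fixpoint eval (w : nat) (s : state) (a : expr) : nat :=
  match a with
  | Const k => k %% 2 ^ w
  | Reg x => regs s x
  | Read a1 => mem s (eval w s a1)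
  | Bin o a1 a2 => binop_fun o (eval w s a1) (eval w s a2) %% 2 ^ w
  end.

(* One time unit for each constant, register access, memory access and
   operation in the expression. *)
Fixpoint cost (a : expr) : nat :=
  match a with
  | Const _ | Reg _ => 1
  | Read a1 => (cost a1).+1
  | Bin _ a1 a2 => (cost a1 + cost a2).+1
  end.

(* exec w c s t s' : started in s, the program c halts after exactly t time
   units, in state s'. *)
Inductive exec (w : nat) : cmd -> state -> nat -> state -> Prop :=
  | ExecSkip s : exec w Skip s 1 s
  | ExecAssign s x a :
      exec w (Assign x a) s (cost a).+1 (set_reg s x (eval w s a))
  | ExecWrite s a b :
      exec w (Write a b) s (cost a + cost b).+1
        (set_mem s (eval w s a) (eval w s b))
  | ExecSeq s1 s2 s3 c1 c2 t1 t2 :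
      exec w c1 s1 t1 s2 -> exec w c2 s2 t2 s3 ->
      exec w (Seq c1 c2) s1 (t1 + t2) s3
  | ExecIfTrue s s' b c1 c2 t :
      eval w s b != 0 -> exec w c1 s t s' ->
      exec w (If b c1 c2) s (cost b + t).+1 s'
  | ExecIfFalse s s' b c1 c2 t :
      eval w s b = 0 -> exec w c2 s t s' ->
      exec w (If b c1 c2) s (cost b + t).+1 s'
  | ExecWhileTrue s1 s2 s3 b c t1 t2 :
      eval w s1 b != 0 -> exec w c s1 t1 s2 -> exec w (While b c) s2 t2 s3 ->
      exec w (While b c) s1 (cost b + t1 + t2).+1 s3
  | ExecWhileFalse s b c :
      eval w s b = 0 -> exec w (While b c) s (cost b).+1 s.

(* The usual word length of order log n. With 1 < c, the number n and all
   addresses below n ^ 2 fit in a word when n > 1. *)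
Definition word_length (c n : nat) : nat := c * up_log 2 n.

(* Input: n in register 0, and the adjacency matrix of the graph, row by row,
   in memory cells 0, ..., n ^ 2 - 1; everything else is 0. *)
Definition input_regs (n : nat) : nat -> nat :=
  fun x => if x == 0 then n else 0.

Definition input_mem (n : nat) (e : rel 'I_n) : nat -> nat :=
  fun a => [exists i : 'I_n, exists j : 'I_n, (a == i * n + j) && e i j].

Definition input_state (n : nat) (e : rel 'I_n) : state :=
  State (input_regs n) (input_mem e).

(* Output: memory cells i * r, ..., i * r + r - 1 list the vertices of the
   i-th copy of K_r, for i < n / r. *)
Definition output_block (n r : nat) (s : state) (i : nat) : {set 'I_n} :=
  [set v : 'I_n | [exists j : 'I_r, mem s (i * r + j) == v]].

Definition output_family (n r : nat) (s : state) : {set {set 'I_n}} :=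
  [set output_block n r s i | i : 'I_(n %/ r)].

Definition finds_Kr_factor_within (w : nat) (p : cmd) (n : nat) (e : rel 'I_n)
    (r bound : nat) : Prop :=
  exists (t : nat) (s : state),
    [/\ exec w p (input_state e) t s, t <= bound
      & is_Kr_factor e r (output_family n r s)].

(* Main.v *)
(* The algorithm is a local search.  An ordering of the vertices is cut into k = n / r
   blocks of r vertices, and as long as at most r ^ 2 transpositions can increase
   the score of the ordering, they are applied.  Trying all n ^ (2 r ^ 2) sequences
   of transpositions takes time O(n ^ (2 r ^ 2 + r)), and the score is O(n ^ (r + 1)).

   A constant number m of slots, of r blocks each, is reserved for absorbers: r
   disjoint copies of K_r whose first vertices form a copy of K_r.  The score first
   counts the absorbers and how often each r-tuple of vertices is absorbed, then
   the sum of (r + 1) ^ (length of the longest prefix which is a clique) over the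
   other, outer, blocks.  Once most r-tuples are absorbed at least as often as
   there are blocks which are not cliques, only the number of those blocks counts.

   Every local maximum consists of cliques only:
   - If a positive fraction of the tuples lacked absorbers, then by averaging over
     the copies of K_r (which exist since large sets are not sparse) some absorber
     serves a positive fraction of these tuples, more than the least useful slot.
   - If many outer blocks were not cliques, let j < r be the largest length of a
     clique prefix K that occurs many times. No vertex of a block whose clique
     prefix is not longer is adjacent to all of K, so by the minimum degree almost
     all clique blocks have exactly j vertices which are not adjacent to all of K,
     and these can be exchanged with K. The vertices that are exchangeable for many
     such K form a set of size about j n / r, which contains a copy of K_(j+1) as
     there are no sparse sets. After j + 1 exchanges this copy becomes a longer
     prefix.
   - So few blocks are not cliques.  The vertices of such a block can replace
     vertices in r distinct clique blocks in many ways, and some absorber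
     then absorbs the tuple of replaced vertices, which increases the
     number of cliques. *)

Require Import Defs.
From mathcomp Require Import all_boot all_order all_algebra.
From mathcomp Require Import reals boolp.
From mathcomp Require Import zify lra.

Set Implicit Arguments.
Unset Strict Implicit.
Unset Printing Implicit Defensive.

(** * Counting cliques *)

(** The real hypotheses are replaced by statements about naturals, with k = n / r: every vertex has
    at most k + a non-neighbours, and every set of at least k - b vertices has degree sum at least
    |T|^2 / g. Here g is of order 1 / gamma + r, b is about n / (2 g), and a is a much smaller
    multiple of n governed by alpha. The constants are fixed in the order g, M, d, m, and only then
    is k required to be large. The delicate point is when the score may turn to the number of blocks
    that are not cliques. Using an absorber destroys it, so a demand for a constant number of
    absorbers per tuple could fail after the very move that it should justify. Comparing the
    absorbers of a tuple with the current number of non-cliques is stable: one move lowers the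
    former by at most one and the latter by at least one. The budget of r^2 transpositions is set by
    the replacement of a whole absorber, which has r^2 vertices. Lengthening a prefix of length j
    takes at most j (j + 2) < r^2 transpositions, and using an absorber takes 2 r. *)

Lemma sum_max_exists (I : finType) (F : I -> nat) :
  0 < \sum_i F i -> exists2 i, \sum_i F i <= #|I| * F i & 0 < F i.
Proof.
move=> S0; have [i0 _] : exists i0 : I, true.
  case: (pickP I) => [i _|I0]; first by exists i.
  by move: S0; rewrite big_pred0.
pose i := [arg max_(i > i0) F i].
have le_F j : F j <= F i by rewrite /i; case: arg_maxnP => // i' _; apply.
have le_S : \sum_i F i <= #|I| * F i.
  by rewrite mulnC -iter_addn_0 -big_const leq_sum.
by exists i => //; case: (posnP (F i)) le_S => // ->; rewrite muln0 leqNgt S0.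
Qed.

Section Cliques.
Variables (T : finType) (e : rel T).

Definition nbh (v : T) : {set T} := [set u | e v u].

(** Ordered cliques: in a simple graph this is i! times the number of i-cliques inside [Y]. Choosing
    the later vertices inside the neighbourhood of the first suits both greedy lower bounds and
    averaging. *)
Fixpoint num_cliques (i : nat) (Y : {set T}) : nat :=
  if i is i'.+1 then \sum_(v in Y) num_cliques i' (Y :&: nbh v) else 1.

(** The sum counts pairs of an index and an ordered clique in its set, so one of the at most |T|^i
    tuples is shared by at least the average number of indices. It is found vertex by vertex: take
    the first vertex [v] with the largest share of the sum and keep only the indices whose set
    contains [v]. *)
Lemma num_cliques_averaging (I : finType) (i : nat) (U : {set I}) (Y : I -> {set T}) :
  0 < \sum_(u in U) num_cliques i (Y u) ->
  exists S : seq T, [/\ size S = i, pairwise e S &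
    \sum_(u in U) num_cliques i (Y u) <=
      #|T| ^ i * #|[set u in U | all (mem (Y u)) S]|].
Proof.
elim: i U Y => [|i IHi] U Y /= pos.
  exists [::]; split=> //=; rewrite sum1_card mul1n.
  by rewrite subset_leq_card //; apply/subsetP => u uU; rewrite inE uU.
have E : \sum_(u in U) \sum_(v in Y u) num_cliques i (Y u :&: nbh v) =
    \sum_v \sum_(u in [set u in U | v \in Y u]) num_cliques i (Y u :&: nbh v).
  rewrite (exchange_big_dep predT) //=; apply: eq_bigr => v _.
  by apply: eq_bigl => u; rewrite inE.
have [|v le_v pos_v] := @sum_max_exists T (fun v =>
  \sum_(u in [set u in U | v \in Y u]) num_cliques i (Y u :&: nbh v)).
  by rewrite -E.
have [S [sS cS le_S]] := IHi _ _ pos_v; exists (v :: S).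
have /card_gt0P[u0] : 0 < #|[set u in [set u in U | v \in Y u]
    | all (mem (Y u :&: nbh v)) S]|.
  by move: (leq_trans pos_v le_S); rewrite muln_gt0 => /andP[].
rewrite !inE => /andP[_ /allP Su0].
split=> /=; first by rewrite sS.
  by rewrite cS andbT; apply/allP => w /Su0 /=; rewrite !inE => /andP[].
rewrite E (leq_trans le_v) // expnS -mulnA leq_mul2l; apply/orP; right.
rewrite (leq_trans le_S) // leq_mul2l; apply/orP; right.
apply: subset_leq_card; apply/subsetP => u; rewrite !inE /=.
move=> /andP[/andP[-> ->] /allP Su] /=.
by apply/allP => w /Su /=; rewrite inE => /andP[].
Qed.

(* a is the slack in the minimum degree; dense says that the graph has no sparse
   k-set, and tolerates sets which miss b vertices. *)
Variables (r k g a b : nat).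
Hypothesis cardT : #|T| = k * r.
Hypothesis nonnbh : forall v, #|~: nbh v| <= k + a.
Hypothesis dense : forall Y : {set T}, k <= #|Y| + b ->
  #|T| ^ 2 <= g * \sum_(v in Y) #|Y :&: nbh v|.
Hypothesis b_small : b.*2 <= k.

Lemma card_setI_nbh (Y : {set T}) v : #|Y| <= #|Y :&: nbh v| + (k + a).
Proof.
rewrite -(cardsID (nbh v) Y) leq_add2l (leq_trans _ (nonnbh v)) //.
by apply: subset_leq_card; rewrite setDE subsetIr.
Qed.

(** Greedy count: each chosen vertex costs at most k + a candidates, so at least k - b remain after
    i choices, and there [dense] supplies the last two vertices. *)
Lemma num_cliques_lower_bound i (Y : {set T}) :
  i.+1 * k + i * a <= #|Y| + b ->
  #|T| ^ i.+2 <= g * (r.*2) ^ i * num_cliques i.+2 Y.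
Proof.
elim: i Y => [|i IHi] Y le_Y.
  rewrite muln1 -[num_cliques 2 Y]/(\sum_(v in Y) \sum_(w in Y :&: nbh v) 1).
  under eq_bigr do rewrite sum1_card.
  by apply: dense; lia.
rewrite -[num_cliques i.+3 Y]/(\sum_(v in Y) num_cliques i.+2 (Y :&: nbh v)).
have le1 : #|Y| * #|T| ^ i.+2 <=
    g * r.*2 ^ i * \sum_(v in Y) num_cliques i.+2 (Y :&: nbh v).
  rewrite big_distrr /= -sum_nat_const; apply: leq_sum => v vY.
  apply: IHi; have := card_setI_nbh Y v; nia.
(* As b <= k / 2, the set [Y] has at least k / 2 = |T| / (2 r) vertices; this is the factor [r.*2]
   paid for each greedy choice. *)
have le2 : #|T| <= r.*2 * #|Y| by rewrite cardT; nia.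
rewrite expnS (leq_trans (leq_mul le2 (leqnn _))) //.
rewrite -mulnA (leq_trans (leq_mul (leqnn _) le1)) //.
by rewrite expnS; apply: eq_leq; lia.
Qed.

End Cliques.

(** * Swaps and blocks *)

Ltac arith :=
  repeat match goal with
  | H : ?P |- _ =>
      lazymatch type of P with Prop => idtac end;
      lazymatch P with
      | is_true (leq _ _) => fail
      | is_true (andb (leq _ _) (leq _ _)) => fail
      | @eq nat _ _ => fail
      | False => fail
      | _ => clear H
      end
  | x := _ |- _ => clearbody x
  end; lia.

Section Swaps.
Variable T : Type.
Implicit Type pi : nat -> T.

Definition swap pi (p q : nat) : nat -> T :=
  fun x => if x == p then pi q else if x == q then pi p else pi x.

Definition swaps pi (ps : seq (nat * nat)) : nat -> T :=
  foldl (fun pi pq => swap pi pq.1 pq.2) pi ps.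

Lemma swaps_cat pi ps qs : swaps pi (ps ++ qs) = swaps (swaps pi ps) qs.
Proof. exact: foldl_cat. Qed.

Lemma swaps_out pi ps x :
  x \notin unzip1 ps -> x \notin unzip2 ps -> swaps pi ps x = pi x.
Proof.
elim: ps pi => //= -[p q] ps IH pi /=; rewrite !inE !negb_or.
move=> /andP[xp xps] /andP[xq xqs].
by rewrite IH // /swap (negPf xp) (negPf xq).
Qed.

(** All positions are distinct, so the transpositions act independently of each other. *)
Lemma swaps_in pi ps p q : uniq (unzip1 ps ++ unzip2 ps) -> (p, q) \in ps ->
  swaps pi ps p = pi q /\ swaps pi ps q = pi p.
Proof.
elim: ps pi => //= -[p' q'] ps IH pi /=.
rewrite mem_cat inE !negb_or cat_uniq /= !negb_or.
move=> /andP[/and3P[p1 pq p2] /and3P[u1 /andP[q1 qs] /andP[q2 u2]]].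
rewrite inE xpair_eqE => /orP[/andP[/eqP-> /eqP->]|pq_in].
  by rewrite !swaps_out // /swap !eqxx eq_sym (negPf pq).
have [|-> ->] := IH (swap pi p' q') _ pq_in; first by rewrite cat_uniq u1 qs.
have pin1 : p \in unzip1 ps by apply/mapP; exists (p, q).
have pin2 : q \in unzip2 ps by apply/mapP; exists (p, q).
have ne x y (s : seq nat) : x \in s -> y \notin s -> (x == y) = false.
  by move=> xs; apply: contraNF => /eqP <-.
by rewrite /swap !(ne _ _ _ pin1 p1, ne _ _ _ pin1 q1, ne _ _ _ pin2 p2,
  ne _ _ _ pin2 q2).
Qed.

Lemma swaps_zip_l pi (A B : seq nat) i :
  size A = size B -> uniq (A ++ B) -> i < size A ->
  swaps pi (zip A B) (nth 0 A i) = pi (nth 0 B i).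
Proof.
move=> sAB uAB iA; apply: (proj1 (swaps_in _ _ _)).
  by rewrite unzip1_zip ?unzip2_zip ?sAB.
by rewrite -(nth_zip 0 0) // mem_nth // size_zip -sAB minnn.
Qed.

Lemma swaps_zip_r pi (A B : seq nat) i :
  size A = size B -> uniq (A ++ B) -> i < size A ->
  swaps pi (zip A B) (nth 0 B i) = pi (nth 0 A i).
Proof.
move=> sAB uAB iA; apply: (proj2 (swaps_in _ _ _)).
  by rewrite unzip1_zip ?unzip2_zip ?sAB.
by rewrite -(nth_zip 0 0) // mem_nth // size_zip -sAB minnn.
Qed.

Lemma swaps_zip_out pi (A B : seq nat) x :
  size A = size B -> x \notin A -> x \notin B -> swaps pi (zip A B) x = pi x.
Proof.
by move=> sAB xA xB; rewrite swaps_out // ?unzip1_zip ?unzip2_zip ?sAB.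
Qed.

Lemma swap_inj n pi p q : p < n -> q < n ->
  {in [pred x | x < n] &, injective pi} ->
  {in [pred x | x < n] &, injective (swap pi p q)}.
Proof.
move=> pn qn inj x y; rewrite !inE /swap => xn yn.
by do !case: eqP => [->|?]; move/inj => // /(_ _ _); rewrite ?inE; intuition congruence.
Qed.

Lemma swaps_inj n pi ps : all (fun pq => (pq.1 < n) && (pq.2 < n)) ps ->
  {in [pred x | x < n] &, injective pi} ->
  {in [pred x | x < n] &, injective (swaps pi ps)}.
Proof.
elim: ps pi => //= -[p q] ps IH pi /= /andP[/andP[pn qn] /IH] H inj.
exact/H/swap_inj.
Qed.

End Swaps.

Section Blocks.
Variables (T : finType) (e : rel T) (r : nat).
Hypotheses (esym : symmetric e) (eirr : irreflexive e).
Implicit Type pi : nat -> T.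

Definition prefix_clique pi b i := pairwise e [seq pi p | p <- iota (b * r) i].
Definition full pi b := prefix_clique pi b r.
(** Clique prefixes are closed under shortening, so this count is the length of the longest one
    ([leq_rank]). As a count, it turns (r + 1) ^ rank into a product over prefix lengths, which is
    how [weight_expr] computes it. *)
Definition rank pi b := count (prefix_clique pi b) (iota 1 r).

Lemma prefix_cliqueP pi b i :
  reflect (forall x y, x < i -> y < i -> x != y ->
             e (pi (b * r + x)) (pi (b * r + y)))
          (prefix_clique pi b i).
Proof.
have D x : x < i ->
    nth (pi 0) [seq pi p | p <- iota (b * r) i] x = pi (b * r + x).
  by move=> xi; rewrite (nth_map 0) ?size_iota // nth_iota.
apply: (iffP (pairwiseP (pi 0))); rewrite size_map size_iota => H.
  move=> x y xi yi; rewrite neq_ltn => /orP[xy|yx].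
    by rewrite -!D // H.
  by rewrite esym -!D // H.
by move=> x y xi yi xy; rewrite !D // H // neq_ltn xy.
Qed.

Lemma prefix_clique_le pi b i j :
  i <= j -> prefix_clique pi b j -> prefix_clique pi b i.
Proof.
move=> ij /prefix_cliqueP H; apply/prefix_cliqueP => x y xi yi.
by apply: H; exact: leq_trans ij.
Qed.

Lemma prefix_clique1 pi b : prefix_clique pi b 1.
Proof. by []. Qed.

Lemma leq_rank pi b i : i <= r -> (i <= rank pi b) = prefix_clique pi b i.
Proof.
rewrite /rank; elim: r i => [|s IH] i ir.
  by move: ir; rewrite leqn0 => /eqP->.
rewrite -[s.+1]addn1 iotaD count_cat /= addn0 add1n.
have le_s : count (prefix_clique pi b) (iota 1 s) <= s.
  by rewrite -[leqRHS](size_iota 1) count_size.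
case: (boolP (prefix_clique pi b s.+1)) => P /=.
  have -> : count (prefix_clique pi b) (iota 1 s) = s.
    rewrite -[RHS](size_iota 1); apply/eqP; rewrite -all_count.
    apply/allP => x; rewrite mem_iota => xs.
    by apply: prefix_clique_le P; lia.
  by rewrite addn1 ir (prefix_clique_le ir P).
rewrite addn0; case: (ltngtP i s.+1) ir => // [is_|->] _; first exact: IH.
by rewrite (negPf P); lia.
Qed.

Lemma rank_le pi b : rank pi b <= r.
Proof. by rewrite -[leqRHS](size_iota 1) count_size. Qed.

Lemma full_rank pi b : full pi b = (rank pi b == r).
Proof. by rewrite /full -leq_rank // eqn_leq rank_le. Qed.

Lemma eq_prefix_clique pi pi' b i :
  (forall x, x < i -> pi (b * r + x) = pi' (b * r + x)) ->
  prefix_clique pi b i = prefix_clique pi' b i.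
Proof.
move=> E; rewrite /prefix_clique; congr pairwise.
apply/eq_in_map => p; rewrite mem_iota => /andP[bp pi_].
by rewrite -(subnKC bp) E //; lia.
Qed.

Lemma eq_rank pi pi' b :
  (forall x, x < r -> pi (b * r + x) = pi' (b * r + x)) ->
  rank pi b = rank pi' b.
Proof.
move=> E; apply/eq_in_count => i; rewrite mem_iota => ir.
by apply: eq_prefix_clique => x xi; apply: E; lia.
Qed.

Lemma eq_full pi pi' b :
  (forall x, x < r -> pi (b * r + x) = pi' (b * r + x)) ->
  full pi b = full pi' b.
Proof. exact: eq_prefix_clique. Qed.

End Blocks.

Arguments prefix_cliqueP {T e} {r} esym { pi b i}.

Lemma mem_zip (I J : eqType) (A : seq I) (B : seq J) x y :
  (x, y) \in zip A B -> x \in A /\ y \in B.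
Proof.
elim: A B => [|a A IH] [|b B] //=; rewrite !inE xpair_eqE.
case/orP => [/andP[/eqP-> /eqP->]|/IH[-> ->]]; first by rewrite !eqxx.
by rewrite !orbT.
Qed.

(** Meant for the positions of a full block: [P] marks the vertices that have to leave, [x] is the
    one that should arrive first in the other block, and arbitrary positions fill up to [j]. The
    summand [~~ P x] reserves room for [x] when it is not forced to leave anyway. *)
Lemma exists_sublist (I : eqType) (x : I) (P : pred I) (s : seq I) j :
  uniq s -> x \in s -> count P s + ~~ P x <= j -> 0 < j <= size s ->
  exists q : seq I, [/\ size q = j, uniq q, head x q = x /\ x \in q,
    {subset q <= s} & forall y, y \in s -> P y -> y \in q].
Proof.
move=> us xs cj /andP[j0 js].
pose L := x :: filter P (rem x s) ++ filter (predC P) (rem x s).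
have pL : perm_eq L s.
  rewrite (perm_trans _ (_ : perm_eq (x :: rem x s) s)) //.
    by rewrite perm_cons perm_filterC.
  by rewrite perm_sym perm_to_rem.
have sL : size L = size s by exact: perm_size.
exists (take j L); split.
- by rewrite size_take sL; case: ltngtP js.
- by rewrite take_uniq // (perm_uniq pL).
- by case: j j0 {cj js} => // j _; rewrite /= inE eqxx.
- by move=> y /mem_take; rewrite (perm_mem pL).
- move=> y ys Py; rewrite -(perm_mem pL) in ys.
  have cs : count P s = P x + count P (rem x s).
    exact: (permP (perm_to_rem xs)).
  have -> : take j L = x :: filter P (rem x s) ++
      take (j - (size (filter P (rem x s))).+1) (filter (predC P) (rem x s)).
    rewrite -[L]/((x :: filter P (rem x s)) ++ filter (predC P) (rem x s)).
    rewrite take_cat /= size_filter.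
    by case: ifP => //; case: (P x) cj cs => /=; lia.
  move: ys; rewrite !inE !mem_cat !mem_filter /= Py /= orbF.
  by case/orP => ->; rewrite ?orbT.
Qed.

Lemma exists_representatives (I : finType) (X : eqType) (D : X -> {set I})
    (s : seq X) N : {in s, forall x, N <= #|D x|} -> size s <= N ->
  exists c : seq I, [/\ size c = size s, uniq c &
    forall x0 i0 i, i < size s -> nth i0 c i \in D (nth x0 s i)].
Proof.
elim: s => [|x s IH] DN sN; first by exists [::].
have [||c [sc uc Dc]] := IH; [by move=> y ys; apply: DN; rewrite inE ys orbT|exact: ltnW|].
have : ~~ (D x \subset [set i in c]).
  apply: contraTN sN => /subset_leq_card; rewrite cardsE -ltnNge.
  move/leq_trans/(_ (card_size c)); rewrite sc /= => H.
  by rewrite ltnS (leq_trans _ H) // DN // mem_head.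
case/subsetPn => i iD; rewrite inE => ic; exists (i :: c); split=> /=.
- by rewrite sc.
- by rewrite ic.
- by move=> x0 i0 [|l] //= ls; apply: Dc.
Qed.

Lemma block_index_inj r b b' i i' : i < r -> i' < r ->
  b * r + i = b' * r + i' -> b = b' /\ i = i'.
Proof.
move=> ir ir' E; have r0 : 0 < r by lia.
have Eb : b = b'.
  by rewrite -[b]addn0 -(divn_small ir) -divnMDl // E divnMDl // divn_small // addn0.
by split=> //; move: E; rewrite Eb => /addnI.
Qed.

Lemma block_div r b i : i < r -> (b * r + i) %/ r = b.
Proof. by move=> ir; rewrite divnMDl ?divn_small ?addn0 // (leq_ltn_trans _ ir). Qed.

(** * Exchanging clique prefixes with vertices of full blocks *)

Section Exchange.
Variables (T : finType) (e : rel T) (r : nat).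
Hypotheses (esym : symmetric e) (eirr : irreflexive e).
Implicit Type pi : nat -> T.

Definition same_block pi pi' b :=
  forall x, x < r -> pi' (b * r + x) = pi (b * r + x).

Definition complete pi j c v := all (e v) [seq pi p | p <- iota (c * r) j].

Lemma completeP pi j c v :
  reflect (forall x, x < j -> e v (pi (c * r + x))) (complete pi j c v).
Proof.
apply: (iffP allP) => [H x xj|H w /mapP[p]].
  by apply/H/map_f; rewrite mem_iota; lia.
rewrite mem_iota => /andP[cp pj] ->; rewrite -(subnKC cp); apply: H; lia.
Qed.

Lemma prefix_cliqueS pi c j :
  prefix_clique e r pi c j -> complete pi j c (pi (c * r + j)) ->
  prefix_clique e r pi c j.+1.
Proof.
move=> /(prefix_cliqueP esym) H /completeP C.
apply/(prefix_cliqueP esym) => x y xj yj xy.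
have [Ex|xj'] : x = j \/ x < j by lia.
  by rewrite Ex; apply: C; lia.
have [Ey|yj'] : y = j \/ y < j by lia.
  by rewrite esym Ey; apply: C; lia.
exact: H.
Qed.

(* c = (K, t, q): the j vertices at the positions q of the full block t are to
   be exchanged with the first j vertices of block K. *)
Definition exchangeable pi j (c : nat * nat * seq nat) :=
  [/\ full e r pi c.1.2, prefix_clique e r pi c.1.1 j,
      [/\ size c.2 = j, uniq c.2 & all (gtn r) c.2] &
      forall i, i < r -> i \notin c.2 ->
        complete pi j c.1.1 (pi (c.1.2 * r + i))].

Definition exchange_pairs j (c : nat * nat * seq nat) :=
  zip (iota (c.1.1 * r) j) [seq c.1.2 * r + i | i <- c.2].

Section One.
Variables (pi : nat -> T) (j K t : nat) (q : seq nat).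
Hypotheses (jr : j <= r) (Kt : K != t) (H : exchangeable pi j (K, t, q)).
Let pi' := swaps pi (exchange_pairs j (K, t, q)).

Lemma exchange_sizes : size (iota (K * r) j) = size [seq t * r + i | i <- q].
Proof. by case: H => _ _ [sq _ _] _; rewrite size_iota size_map. Qed.

Lemma exchange_uniq : uniq (iota (K * r) j ++ [seq t * r + i | i <- q]).
Proof.
case: H => _ _ /= [_ uq /allP qr] _.
rewrite cat_uniq iota_uniq map_inj_uniq ?uq ?andbT; last by move=> x y /addnI.
apply/hasPn => _ /mapP[i /qr /= ir ->]; apply/negP; rewrite /= mem_iota.
move=> /andP[le1 le2]; have := @block_index_inj r t K i (t * r + i - K * r).
case; [exact: ir|lia|lia|]; move=> Et; by move: Kt; rewrite Et eqxx.
Qed.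

Lemma exchange_prefix i : i < j -> pi' (K * r + i) = pi (t * r + nth 0 q i).
Proof.
move=> ij; case: (H) => _ _ /= [sq _ _] _.
have := swaps_zip_l pi (i := i) exchange_sizes exchange_uniq.
rewrite size_iota nth_iota // (nth_map 0) ?sq //; exact.
Qed.

Lemma exchange_back i : i < j -> pi' (t * r + nth 0 q i) = pi (K * r + i).
Proof.
move=> ij; case: (H) => _ _ /= [sq _ _] _.
have := swaps_zip_r pi (i := i) exchange_sizes exchange_uniq.
rewrite size_iota nth_iota // (nth_map 0) ?sq //; exact.
Qed.

Lemma exchange_tail i : j <= i < r -> pi' (K * r + i) = pi (K * r + i).
Proof.
move=> /andP[ji ir]; apply: swaps_zip_out; first exact: exchange_sizes.
  by rewrite mem_iota /= ltn_add2l [i < j]ltnNge ji andbF.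
case: (H) => _ _ /= [_ _ /allP qr] _.
apply/mapP => -[x /qr /= xr /block_index_inj E]; case: E => // E.
by move: Kt; rewrite E eqxx.
Qed.

Lemma exchange_rest i : i < r -> i \notin q -> pi' (t * r + i) = pi (t * r + i).
Proof.
move=> ir iq; apply: swaps_zip_out; first exact: exchange_sizes.
  rewrite mem_iota; apply/negP => /= /andP[le1 le2].
  case: (@block_index_inj r t K i (t * r + i - K * r)); [exact: ir|lia|lia|].
  by move=> E; move: Kt; rewrite E eqxx.
by rewrite mem_map // => x y /addnI.
Qed.

Lemma exchange_same b : b != K -> b != t -> same_block pi pi' b.
Proof.
move=> bK bt x xr; apply: swaps_zip_out; first exact: exchange_sizes.
  rewrite mem_iota; apply/negP => /= /andP[le1 le2].
  case: (@block_index_inj r b K x (b * r + x - K * r)); [exact: xr|lia|lia|].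
  by move=> E; move: bK; rewrite E eqxx.
case: (H) => _ _ /= [_ _ /allP qr] _.
apply/mapP => -[y /qr /= yr /block_index_inj E]; case: E => // E.
by move: bt; rewrite E eqxx.
Qed.

(** The incoming vertices form the clique prefix of [K], the remaining ones belong to the old clique
    [t], and [exchangeable] makes the two parts completely adjacent. *)
Lemma exchange_full : full e r pi' t.
Proof.
case: (H) => /= /(prefix_cliqueP esym) ft /(prefix_cliqueP esym) fK [sq uq qr] cK.
have in_q y : y \in q -> exists2 i, i < j & y = nth 0 q i.
  by move=> yq; exists (index y q); rewrite ?nth_index // -sq index_mem.
apply/(prefix_cliqueP esym) => x y xr yr xy.
case: (boolP (x \in q)) => [/in_q[i ij Ex]|xq].
  rewrite Ex exchange_back //.
  case: (boolP (y \in q)) => [/in_q[i' ij' Ey]|yq].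
    rewrite Ey exchange_back //; apply: fK => //.
    by apply: contraNneq xy => Ei; rewrite Ex Ey Ei.
  by rewrite exchange_rest // esym; move/completeP: (cK _ yr yq); apply.
rewrite exchange_rest //.
case: (boolP (y \in q)) => [/in_q[i' ij' Ey]|yq].
  by rewrite Ey exchange_back //; move/completeP: (cK _ xr xq); apply.
by rewrite exchange_rest //; apply: ft.
Qed.

End One.

Lemma exchangeable_same pi pi' j K t q : j <= r ->
  same_block pi pi' K -> same_block pi pi' t ->
  exchangeable pi j (K, t, q) -> exchangeable pi' j (K, t, q).
Proof.
move=> jr sK st [/= ft fK Q cK]; split=> //=.
- by rewrite (@eq_full _ _ _ _ pi).
- by rewrite (@eq_prefix_clique _ _ _ _ pi) // => x xj; apply: sK; lia.
- move=> i ir iq; apply/completeP => x xj.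
  by rewrite st // sK; [by move/completeP: (cK _ ir iq); apply|lia].
Qed.

(** The blocks involved are distinct, so one exchange leaves the others exchangeable. [B] carries
    along a property of all touched blocks, later that of being outer, which the assumption on local
    maxima asks for. *)
Lemma exchange_many pi j (L : seq (nat * nat * seq nat)) (B : pred nat) :
  j <= r ->
  uniq ([seq c.1.1 | c <- L] ++ [seq c.1.2 | c <- L]) ->
  {in L, forall c, exchangeable pi j c /\ B c.1.1 && B c.1.2} ->
  exists ps : seq (nat * nat),
  let pi' := swaps pi ps in
  [/\ size ps = size L * j,
      all (fun pq => B (pq.1 %/ r) && B (pq.2 %/ r)) ps,
      forall b, b \notin [seq c.1.1 | c <- L] -> b \notin [seq c.1.2 | c <- L] ->
        same_block pi pi' b &
      {in L, forall c, full e r pi' c.1.2 /\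
        (forall i, i < j -> pi' (c.1.1 * r + i) = pi (c.1.2 * r + nth 0 c.2 i))
       /\ (forall i, j <= i < r -> pi' (c.1.1 * r + i) = pi (c.1.1 * r + i))}].
Proof.
move=> jr; elim: L pi => [|[[K t] q] L IH] pi; first by exists [::].
rewrite /= mem_cat inE !negb_or => /andP[/and3P[KK Kt Kt']].
rewrite uniq_catC /= mem_cat negb_or => /andP[/andP[tt tK]].
rewrite uniq_catC => uL HL.
have [H0 /andP[/= BK Bt]] := HL _ (mem_head _ _).
pose pi1 := swaps pi (exchange_pairs j (K, t, q)).
have same1 b : b != K -> b != t -> same_block pi pi1 b.
  exact: exchange_same.
have full1 : full e r pi1 t by exact: exchange_full.
have prefix1 i : i < j -> pi1 (K * r + i) = pi (t * r + nth 0 q i).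
  exact: exchange_prefix.
have tail1 i : j <= i < r -> pi1 (K * r + i) = pi (K * r + i).
  exact: exchange_tail.
have notL c : c \in L ->
    [/\ c.1.1 != K, c.1.1 != t, c.1.2 != K & c.1.2 != t].
  move=> cL; have m1 := map_f (fun c => c.1.1) cL.
  have m2 := map_f (fun c => c.1.2) cL.
  by split; [apply: contraNneq KK => <-|apply: contraNneq tK => <-
            |apply: contraNneq Kt' => <-|apply: contraNneq tt => <-].
have [||ps /= [sps Bps sameps Lps]] := IH pi1 => //.
  move=> [[K' t'] q'] cL; have [/= n1 n2 n3 n4] := notL _ cL.
  have [|Hc Bc] := HL (K', t', q'); first by rewrite inE cL orbT.
  by split=> //; apply: exchangeable_same Hc => //; apply: same1.
have rj i : i < j -> i < r by move=> ij; lia.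
exists (exchange_pairs j (K, t, q) ++ ps); rewrite swaps_cat.
have [_ _ /= [sq _ /allP qr] _] := H0.
split=> /=.
- by rewrite size_cat size_zip size_map size_iota sq minnn sps mulSn.
- rewrite all_cat Bps andbT; apply/allP => -[p p'] /mem_zip[].
  rewrite mem_iota /= => /andP[le1 le2] /mapP[i /qr /= ir ->].
  rewrite divnMDl ?(divn_small ir) ?addn0 ?Bt ?andbT; last by lia.
  by rewrite -(subnKC le1) divnMDl ?divn_small ?addn0 //; lia.
- move=> b; rewrite !inE !negb_or => /andP[bK bKL] /andP[bt btL] x xr.
  by rewrite sameps // same1.
- move=> c; rewrite inE => /orP[/eqP->/=|cL].
    have sK := sameps K KK Kt'; have st := sameps t tK tt.
    split; [|split].
    + by rewrite (@eq_full _ _ _ _ pi1).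
    + by move=> i ij; rewrite sK ?prefix1 // rj.
    + by move=> i ij; rewrite sK ?tail1 //; case/andP: ij.
  have [n1 n2 n3 n4] := notL _ cL.
  have [fc [pc tc]] := Lps _ cL; split=> //; split.
    move=> i ij; rewrite pc // same1 //.
    have [|[_ _ [sc _ /allP cr] _] _] := HL c; first by rewrite inE cL orbT.
    by apply: cr; rewrite mem_nth // sc.
  by move=> i /[dup] /andP[_ ir] ij; rewrite tc // same1.
Qed.

End Exchange.

(** * Local maxima of the outer potential *)

Section Positions.
Variables (T : finType) (r k : nat) (pi : nat -> T).
Hypotheses (cardT : #|T| = k * r)
  (inj : {in [pred x | x < k * r] &, injective pi}).

Definition position (v : T) := index v [seq pi p | p <- iota 0 (k * r)].

Lemma config_uniq : uniq [seq pi p | p <- iota 0 (k * r)].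
Proof.
rewrite map_inj_in_uniq ?iota_uniq // => x y; rewrite !mem_iota => xk yk.
by apply: inj; rewrite inE.
Qed.

Lemma mem_config v : v \in [seq pi p | p <- iota 0 (k * r)].
Proof.
have : [set x in [seq pi p | p <- iota 0 (k * r)]] == [set: T].
  rewrite eqEcard subsetT cardsT cardT cardsE (card_uniqP config_uniq).
  by rewrite size_map size_iota leqnn.
by move/eqP/setP/(_ v); rewrite !inE.
Qed.

Lemma position_lt v : position v < k * r.
Proof. by have := mem_config v; rewrite -index_mem size_map size_iota. Qed.

Lemma positionK v : pi (position v) = v.
Proof.
have lt := position_lt v; rewrite -[RHS](nth_index (pi 0) (mem_config v)).
by rewrite (nth_map 0) ?size_iota // nth_iota.
Qed.

Lemma configK p : p < k * r -> position (pi p) = p.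
Proof. by move=> pk; apply: inj; rewrite ?inE ?position_lt // positionK. Qed.

Lemma sum_blocks (P : pred T) :
  \sum_(b < k) count (fun i => P (pi (b * r + i))) (iota 0 r) = #|P|.
Proof.
rewrite cardE /enum_mem size_filter -enumT.
have /permP-> : perm_eq (enum T) [seq pi p | p <- iota 0 (k * r)].
  apply: uniq_perm; rewrite ?enum_uniq ?config_uniq // => v.
  by rewrite mem_enum mem_config.
rewrite count_map; elim: k => [|k' IH]; first by rewrite big_ord0 mul0n.
rewrite big_ord_recr /= IH mulSn [r + _]addnC iotaD count_cat add0n.
congr addn; have := iotaDl (k' * r) 0 r; rewrite addn0 => ->.
by rewrite count_map.
Qed.

End Positions.

(** * Moves excluded by local maximality of the outer potential *)

Section Augment.
Variables (T : finType) (e : rel T) (r k m : nat) (pi : nat -> T).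
Hypotheses (esym : symmetric e) (eirr : irreflexive e) (r_gt2 : 2 < r).
Hypothesis cardT : #|T| = k * r.
Hypothesis inj : {in [pred x | x < k * r] &, injective pi}.

Definition outer_potential (pi : nat -> T) :=
  \sum_(b < k | m <= b) r.+1 ^ rank e r pi b.

Definition outer_pairs (ps : seq (nat * nat)) :=
  all (fun pq => (m <= pq.1 %/ r < k) && (m <= pq.2 %/ r < k)) ps.

Hypothesis no_gain : forall ps, size ps <= r * r -> outer_pairs ps ->
  outer_potential (swaps pi ps) <= outer_potential pi.

Let r0 : 0 < r. Proof. lia. Qed.

(** Since r (r + 1)^j < (r + 1)^(j+1), one block rising above rank [j] outweighs the complete ruin
    of up to [r] blocks of rank at most [j]. This is the reason for the base r + 1. *)
Lemma outer_gain pi' (L : {set 'I_k}) c j : c \in L -> #|L| <= r ->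
  {in L, forall b : 'I_k, m <= b /\ rank e r pi b <= j} ->
  j < rank e r pi' c ->
  (forall b : 'I_k, m <= b -> b \notin L -> rank e r pi b <= rank e r pi' b) ->
  outer_potential pi < outer_potential pi'.
Proof.
move=> cL cardL HL jc HN; rewrite /outer_potential.
rewrite (bigID (mem L)) [ltnRHS](bigID (mem L)) /=.
rewrite -addSn leq_add //; last first.
  by apply: leq_sum => b /andP[mb bL]; rewrite leq_exp2l // HN.
rewrite [leqRHS](bigD1 c) /=; last by rewrite cL andbT; case: (HL _ cL).
apply: leq_trans (leq_addr _ _).
apply: (@leq_ltn_trans (\sum_(b in L) r.+1 ^ j)).
  rewrite (_ : \sum_(i < k | _) _ = \sum_(i in L) r.+1 ^ rank e r pi i).
    by apply: leq_sum => b bL; rewrite leq_exp2l //; case: (HL _ bL).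
  apply: eq_bigl => b; rewrite andbC.
  by case: (boolP (b \in L)) => //= /HL[-> _].
rewrite sum_nat_const; apply: (@leq_trans (r.+1 ^ j.+1)).
  by rewrite expnS ltn_mul2r expn_gt0 /= ltnS.
by rewrite leq_exp2l.
Qed.

(** Otherwise a single transposition would place this vertex right behind the clique prefix of [c];
    whatever happens to [b] is outweighed, as its rank is at most [j]. *)
Lemma no_attach (c b : 'I_k) j i : m <= c -> m <= b -> rank e r pi c = j ->
  j < r -> rank e r pi b <= j -> i < r ->
  ~~ complete e r pi j c (pi (b * r + i)).
Proof.
move=> mc mb rc jr rb ir; apply/negP => comp.
have pc : prefix_clique e r pi c j by rewrite -leq_rank ?rc // ltnW.
have ne x : x < j -> c * r + x != b * r + i.
  move=> xj; apply/eqP => E; move/completeP: comp => /(_ x xj).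
  by rewrite E eirr.
suff : outer_potential pi < outer_potential (swaps pi [:: (c * r + j, b * r + i)]).
  rewrite ltnNge no_gain //=; first by nia.
  by rewrite /outer_pairs /= !block_div // mc mb !ltn_ord.
have same x : x < j ->
    swaps pi [:: (c * r + j, b * r + i)] (c * r + x) = pi (c * r + x).
  by move=> xj; rewrite /= /swap eqn_add2l ltn_eqF // (negPf (ne _ xj)).
apply: (@outer_gain _ [set c; b] c j); rewrite ?inE ?eqxx //.
- by rewrite cards2; lia.
- by move=> x; rewrite !inE => /orP[]/eqP->; rewrite ?rc.
- rewrite leq_rank //; apply: prefix_cliqueS => //.
    by rewrite (@eq_prefix_clique _ _ _ _ pi).
  apply/completeP => // x xj; rewrite (same x) //= /swap eqxx.
  by move/completeP: comp; apply.
- move=> x _; rewrite !inE negb_or => /andP[xc xb].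
  apply: eq_leq; apply: eq_rank => y yr; rewrite /= /swap.
  case: eqP => [/block_index_inj[]//|_].
    by move/val_inj => E; case/eqP: xc.
  case: eqP => [/block_index_inj[]//|_] //.
  by move/val_inj => E; case/eqP: xb.
Qed.

Definition defect (j : nat) (c b : nat) :=
  count (fun i => ~~ complete e r pi j c (pi (b * r + i))) (iota 0 r).

(* Otherwise one could exchange the prefix of c' with j vertices of t, one of
   which is complete to the prefix of c, and then attach that vertex to c. *)
Lemma no_double_excess (c c' t : 'I_k) j : m <= c -> m <= c' -> m <= t ->
  c != c' -> rank e r pi c = j -> rank e r pi c' = j -> 0 < j < r ->
  rank e r pi t = r ->
  defect j c t < j -> j <= defect j c' t.
Proof.
move=> mc mc' mt cc' rc rc' /andP[j0 jr] rt dc; rewrite leqNgt; apply/negP => dc'.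
have ct : c != t by apply/eqP => E; move: rt; rewrite -E rc; lia.
have ct' : c' != t by apply/eqP => E; move: rt; rewrite -E rc'; lia.
have ft : full e r pi t by rewrite full_rank // rt.
have pc : prefix_clique e r pi c j by rewrite -leq_rank ?rc // ltnW.
have pc' : prefix_clique e r pi c' j by rewrite -leq_rank ?rc' // ltnW.
have [i0 i0r ci0] : exists2 i, i < r & complete e r pi j c (pi (t * r + i)).
  have : has (fun i => complete e r pi j c (pi (t * r + i))) (iota 0 r).
    rewrite -[has _ _]negbK -all_predC all_count size_iota.
    by apply: contraTN dc => /eqP; rewrite /defect /= => ->; lia.
  by case/hasP => i; rewrite mem_iota => ir ci; exists i.
(* With [i0] at the head, the exchange brings that vertex to position 0 of [c'], and one more swap
   takes it to position [j] of [c]. There is room for [i0] because the defect with respect to [c']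
   is strictly below [j]. *)
have := @exists_sublist _ i0
  (fun i => ~~ complete e r pi j c' (pi (t * r + i))) (iota 0 r) j
  (iota_uniq _ _).
rewrite mem_iota i0r size_iota j0 (ltnW jr) /=.
case=> [||//|q [sq uq [hq iq] qr Pq]] //.
  by rewrite -/(defect j c' t); case: (complete _ _ _ _ _ _) dc' => /=; lia.
have sub_q x : x \in q -> x < r by move/qr; rewrite mem_iota.
have := @exchange_many T e r esym pi j [:: (val c', val t, q)]
  (fun b => m <= b < k) (ltnW jr).
case=> [|x|ps /= [sps ops same ex]].
- by rewrite /= inE andbT; move: ct'; rewrite -val_eqE.
- rewrite inE => /eqP-> /=; rewrite mc' mt !ltn_ord; split=> //; split=> //=.
    by split=> //; apply/allP => x' /sub_q.
  move=> i ir; apply: contraNT => ?; apply: Pq => //.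
  by rewrite mem_iota.
have [/= f1 [p1 t1]] := ex _ (mem_head _ _).
set pi1 := swaps pi ps in same f1 p1 t1.
have same1 b : b != c' :> nat -> b != t :> nat -> same_block r pi pi1 b.
  by move=> bc bt; apply: same; rewrite inE.
have E0 : pi1 (c' * r) = pi (t * r + i0).
  have := p1 0 j0; rewrite addn0 => ->; congr (pi (_ + _)).
  by rewrite nth0; case: (q) hq sq j0 => [|y s] //= _ <-.
suff : outer_potential pi <
    outer_potential (swaps pi (ps ++ [:: (c * r + j, c' * r)])).
  rewrite ltnNge no_gain //.
    by rewrite size_cat sps /= mul1n addn1 (leq_trans jr) // leq_pmulr.
  rewrite /outer_pairs all_cat ops /= block_div //.
  by rewrite -[c' * r]addn0 block_div // mc mc' !ltn_ord.
have bneq (x y : 'I_k) : x != y -> (val x == val y) = false by move/negPf.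
rewrite swaps_cat -/pi1.
set pi2 := swaps pi1 _.
have same2 b : b != c :> nat -> b != c' :> nat -> same_block r pi1 pi2 b.
  move=> bc bc' x xr; rewrite /pi2 /= /swap.
  case: eqP => [/block_index_inj[]// E|_]; first by rewrite E eqxx in bc.
  rewrite -[c' * r]addn0.
  by case: eqP => [/block_index_inj[]// E|_] //; rewrite E eqxx in bc'.
have sc : same_block r pi pi1 c by apply: same1.
have cE x : x < j -> pi2 (c * r + x) = pi (c * r + x).
  move=> xj; rewrite /pi2 /= /swap eqn_add2l ltn_eqF // -[c' * r]addn0.
  case: eqP => [/block_index_inj E|_]; last by apply: sc; apply: ltn_trans jr.
  by case: E => //; [exact: ltn_trans jr|move/val_inj => E; rewrite E eqxx in cc'].
apply: (@outer_gain _ [set c; c'] c j); rewrite ?inE ?eqxx //.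
- by rewrite cards2 (leq_ltn_trans _ r_gt2) //; case: (c != c').
- by move=> x; rewrite !inE => /orP[]/eqP->; rewrite ?rc ?rc'.
- rewrite leq_rank //; apply: prefix_cliqueS => //.
    by rewrite (@eq_prefix_clique _ _ _ _ pi).
  apply/completeP => // x xj; rewrite (cE x) // /pi2 /= /swap eqxx E0.
  by move/completeP: ci0; apply.
- move=> x _; rewrite !inE negb_or => /andP[xc xc'].
  have s2 := same2 x xc xc'.
  have [->|xt] := eqVneq x t.
    rewrite (_ : rank e r pi2 t = r) ?rank_le //.
    apply/eqP; rewrite -full_rank // (@eq_full _ _ _ _ pi1) //.
    by apply: same2; rewrite eq_sym.
  apply: eq_leq; apply: eq_rank => y yr; rewrite s2 // same1 //.
Qed.

Definition block_of (v : T) := position r k pi v %/ r.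

Lemma position_eq v :
  position r k pi v = block_of v * r + position r k pi v %% r.
Proof. exact: divn_eq. Qed.

Lemma block_of_lt v : block_of v < k.
Proof. by rewrite ltn_divLR // (position_lt cardT inj). Qed.

(* If the ys were exchangeable with the prefixes of the corresponding cs, then
   j + 1 exchanges would free them to form the prefix of the first of the cs. *)
Lemma no_new_clique j (cs : seq 'I_k) (ys : seq T) c0 y0 : 0 < j < r ->
  size cs = j.+1 -> size ys = j.+1 -> uniq cs -> uniq [seq block_of y | y <- ys] ->
  {in cs, forall c : 'I_k, m <= c /\ rank e r pi c = j} ->
  {in ys, forall y, m <= block_of y /\ rank e r pi (block_of y) = r} ->
  pairwise e ys ->
  ~ forall i, i < j.+1 -> let c := nth c0 cs i in let y := nth y0 ys i in
      defect j c (block_of y) <= j /\ ~~ complete e r pi j c y.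
Proof.
move=> /andP[j0 jr] scs sys ucs uys Hcs Hys pys HD.
pose C (i : nat) : nat := nth c0 cs i.
pose Y i := nth y0 ys i.
have CP i : i < j.+1 -> m <= C i /\ rank e r pi (C i) = j.
  by move=> ij; apply: Hcs; rewrite mem_nth ?scs.
have YP i : i < j.+1 -> m <= block_of (Y i) /\ rank e r pi (block_of (Y i)) = r.
  by move=> ij; apply: Hys; rewrite mem_nth ?sys.
have Cinj i i' : i < j.+1 -> i' < j.+1 -> C i = C i' -> i = i'.
  move=> ij ij' /val_inj E; apply/eqP.
  by rewrite -(nth_uniq c0 _ _ ucs) ?scs // E.
have Yinj i i' : i < j.+1 -> i' < j.+1 -> block_of (Y i) = block_of (Y i') -> i = i'.
  move=> ij ij' E; apply/eqP.
  by rewrite -(nth_uniq 0 _ _ uys) ?size_map ?sys // !(nth_map y0) ?sys ?E.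
have CY i i' : i < j.+1 -> i' < j.+1 -> C i <> block_of (Y i').
  move=> ij ij' E; have [_ rC] := CP _ ij; have [_ rY] := YP _ ij'.
  by move: rY; rewrite -E rC; arith.
have rem_lt i : position r k pi (Y i) %% r < r by rewrite ltn_mod.
have Yeq i : pi (block_of (Y i) * r + position r k pi (Y i) %% r) = Y i.
  by rewrite -position_eq (positionK cardT inj).
(* Here a defect equal to [j] is affordable: [Y i] is itself not complete to the prefix, hence among
   the forced positions, and needs no extra room. *)
have Qex (i : 'I_j.+1) : exists q : seq nat,
    [/\ exchangeable e r pi j (C i, block_of (Y i), q) &
        nth 0 q 0 = position r k pi (Y i) %% r].
  have [dC cC] := HD _ (ltn_ord i).
  have := @exists_sublist _ (position r k pi (Y i) %% r)
    (fun x => ~~ complete e r pi j (C i) (pi (block_of (Y i) * r + x)))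
    (iota 0 r) j (iota_uniq _ _).
  rewrite mem_iota rem_lt size_iota j0 (ltnW jr) /=.
  case=> [||//|q [sq uq [hq iq] qr Pq]] //.
    by rewrite Yeq (negPf cC) addn0.
  exists q; split; last by case: (q) hq sq => [|z s] //= _ E; exfalso; move: j0; rewrite -E.
  have [_ rY] := YP _ (ltn_ord i); have [_ rC] := CP _ (ltn_ord i).
  split=> /=.
  - by rewrite full_rank // rY.
  - by rewrite -leq_rank ?rC // ltnW.
  - by split=> //; apply/allP => x /qr; rewrite mem_iota.
  - by move=> x xr; apply: contraNT => ?; apply: Pq => //; rewrite mem_iota.
have [Q HQ] := fin_all_exists Qex.
pose L := [seq (C i, block_of (Y i), Q i) | i : 'I_j.+1 <- enum 'I_j.+1].
have LC : [seq c.1.1 | c <- L] = [seq C i | i <- iota 0 j.+1].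
  by rewrite -map_comp -val_enum_ord -map_comp.
have LY : [seq c.1.2 | c <- L] = [seq block_of (Y i) | i <- iota 0 j.+1].
  by rewrite -map_comp -val_enum_ord -map_comp.
have := @exchange_many T e r esym pi j L (fun b => m <= b < k) (ltnW jr).
case=> [|x|ps /= [sps ops same ex]].
- rewrite LC LY cat_uniq !map_inj_in_uniq ?iota_uniq ?andbT.
  + apply/hasPn => x /mapP[i]; rewrite mem_iota => ij ->.
    by apply/mapP => -[i']; rewrite mem_iota => ij' E; apply: (CY _ _ ij' ij).
  + by move=> x y; rewrite !mem_iota; apply: Yinj.
  + by move=> x y; rewrite !mem_iota; apply: Cinj.
- case/mapP => i _ ->; split; first by case: (HQ i).
  rewrite /= block_of_lt ltn_ord !andbT.
  by rewrite (proj1 (CP _ (ltn_ord i))) (proj1 (YP _ (ltn_ord i))).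
rewrite size_map size_enum_ord in sps; set pi1 := swaps pi ps in same ex.
have pi1C i : i < j.+1 -> pi1 (C i * r) = Y i.
  move=> ij; have [|_ [p1 _]] := ex (C i, block_of (Y i), Q (Ordinal ij)).
    by apply/mapP; exists (Ordinal ij); rewrite ?mem_enum.
  rewrite -[C i * r]addn0 [LHS](p1 0 j0) /=.
  by have [_ /= ->] := HQ (Ordinal ij); apply: Yeq.
have pi1Y i : i < j.+1 -> full e r pi1 (block_of (Y i)).
  move=> ij; have [|f1 _] // := ex (C i, block_of (Y i), Q (Ordinal ij)).
  by apply/mapP; exists (Ordinal ij); rewrite ?mem_enum.
(* After the exchanges each [Y i] is at position 0 of block [C i]; swapping [A] with [B] collects
   them at positions 0, ..., j of block [C 0]. Altogether this takes (j + 1) j + j <= r^2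
   transpositions. *)
pose A := [seq C 0 * r + l | l <- iota 1 j].
pose B := [seq C l * r | l <- iota 1 j].
have sAB : size A = size B by rewrite !size_map.
have Br l : C l * r = C l * r + 0 by rewrite addn0.
have uAB : uniq (A ++ B).
  rewrite cat_uniq !map_inj_in_uniq ?iota_uniq ?andbT.
  - apply/hasPn => x /mapP[l]; rewrite mem_iota => lj ->.
    apply/mapP => -[l']; rewrite mem_iota Br => lj' /block_index_inj[]; arith.
  - move=> x y; rewrite !mem_iota => xj yj; rewrite Br (Br y).
    by case/block_index_inj => // /Cinj -> //; arith.
  - by move=> x y _ _ /addnI.
have nthA l : 0 < l < j.+1 -> nth 0 A l.-1 = C 0 * r + l.
  move=> lj; rewrite (nth_map 0) ?size_iota ?nth_iota; arith.
have nthB l : 0 < l < j.+1 -> nth 0 B l.-1 = C l * r.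
  move=> lj; rewrite (nth_map 0) ?size_iota ?nth_iota; try arith.
  by rewrite add1n prednK //; case/andP: lj.
set pi2 := swaps pi1 (zip A B).
have inAB p : p \in A ++ B -> exists2 i, i < j.+1 & p %/ r = C i.
  rewrite mem_cat => /orP[]/mapP[l]; rewrite mem_iota => lj ->.
    by exists 0; rewrite ?block_div //; arith.
  by exists l; [arith|rewrite Br block_div].
have same2 b : (forall i, i < j.+1 -> b <> C i) -> same_block r pi1 pi2 b.
  move=> bC x xr; apply: swaps_zip_out => //;
    apply/negP => xA; have [|i ij] := inAB (b * r + x);
    by rewrite ?mem_cat ?xA ?orbT // block_div // => /bC; apply.
have pi2C l : l < j.+1 -> pi2 (C 0 * r + l) = Y l.
  move=> lj; have [->|l0] := posnP l.
    rewrite addn0 -pi1C // /pi2 swaps_zip_out //.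
      by apply/mapP => -[x]; rewrite mem_iota; arith.
    apply/mapP => -[x]; rewrite mem_iota Br (Br x) => xj.
    by case/block_index_inj => // /Cinj E _; have := E isT; arith.
  have lj' : 0 < l < j.+1 by rewrite l0.
  rewrite -nthA // /pi2 swaps_zip_l //.
    by rewrite nthB // pi1C.
  by rewrite size_map size_iota; arith.
suff : outer_potential pi < outer_potential (swaps pi (ps ++ zip A B)).
  rewrite ltnNge no_gain //.
    rewrite size_cat sps size_zip -sAB minnn size_map size_iota.
    by rewrite -mulSnr; move: jr; clear; nia.
  rewrite /outer_pairs all_cat ops /=; apply/allP => -[p p'] /mem_zip[pA pB].
  have [|i ij ->] := inAB p; first by rewrite mem_cat pA.
  have [|i' ij' ->] := inAB p'; first by rewrite mem_cat pB orbT.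
  by rewrite (proj1 (CP _ ij)) (proj1 (CP _ ij')) !ltn_ord.
rewrite swaps_cat -/pi1 -/pi2.
have memcs (b : 'I_k) : b \notin cs -> forall i, i < j.+1 -> val b <> C i.
  by move=> bcs i ij /val_inj E; rewrite E mem_nth ?scs in bcs.
apply: (@outer_gain _ [set c in cs] (nth c0 cs 0) j).
- by rewrite inE mem_nth ?scs.
- by rewrite cardsE (leq_trans (card_size _)) // scs.
- by move=> b; rewrite inE => /Hcs[mb ->].
- rewrite leq_rank //; apply/(prefix_cliqueP esym) => x y xj yj xy.
  rewrite -/(C 0) !pi2C //.
  move/(pairwiseP y0): pys => H; move: xy; rewrite neq_ltn.
  by case/orP => ?; [|rewrite esym]; apply: H => //; rewrite inE sys.
- move=> b _; rewrite inE => /memcs bC.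
  case: (boolP (val b \in [seq block_of (Y i) | i <- iota 0 j.+1])).
    case/mapP => i; rewrite mem_iota => ij Eb.
    rewrite (_ : rank e r pi2 b = r) ?rank_le //.
    apply/eqP; rewrite -full_rank // (@eq_full _ _ _ _ pi1); first by rewrite Eb pi1Y.
    exact: same2.
  move=> bY; apply: eq_leq; apply: eq_rank => x xr.
  rewrite same2 // same ?LC ?LY //.
  by apply/mapP => -[i]; rewrite mem_iota => ij; apply: bC.
Qed.

End Augment.

(** The letters count blocks: L low, X exact and O more, of defect r, j and at least j + 1; A inner,
    D of intermediate rank, E of smaller defect. The total defect is about j per block, and each
    block of L or O exceeds that by at least 1, so only A, D, E and the slack [a] can compensate,
    each unit by at most j. *)
Lemma exact_blocks_arith r j k a m M L O A D E X :
  r * L + j * X + j.+1 * O <= j * (k + a) -> A <= m -> D <= M ->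
  k <= A + L + D + E + O + X -> j < r ->
  k <= X + 3 * r * (m + M + a + E).
Proof.
move=> H1 Am DM H2 jr.
have H3 : L + O <= j * (A + D + E + a).
  have := leq_mul (leqnn j) H2; have : j.+1 * L <= r * L by rewrite leq_mul2r jr orbT.
  by move: H1; clear; lia.
have H4 : j * (A + D + E + a) <= r * (m + M + a + E) by apply: leq_mul; lia.
have H5 : m + M + a + E <= r * (m + M + a + E) by apply: leq_pmull; lia.
by move: H2 H3 H4 H5 Am DM; clear; lia.
Qed.

(** * Few outer blocks are not cliques *)

Section FewNonfull.
Variables (T : finType) (e : rel T) (r k m : nat) (pi : nat -> T).
Hypotheses (esym : symmetric e) (eirr : irreflexive e) (r_gt2 : 2 < r).
Hypothesis cardT : #|T| = k * r.
Hypothesis inj : {in [pred x | x < k * r] &, injective pi}.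
Hypothesis no_gain : forall ps, size ps <= r * r -> outer_pairs r k m ps ->
  outer_potential e r k m (swaps pi ps) <= outer_potential e r k m pi.
Variables (a b g M : nat).
Hypothesis nonnbh : forall v, #|~: nbh e v| <= k + a.
Hypothesis dense : forall Y : {set T}, k <= #|Y| + b ->
  #|T| ^ 2 <= g * \sum_(v in Y) #|Y :&: nbh e v|.
Hypothesis b_small : b.*2 <= k.
Hypothesis g_small : g.*2 <= k.
Hypothesis M_gt0 : 0 < M.
Hypothesis M_large :
  r * (3 * r * ((m + r * M + a) * M + k.*2)) + M * r * (a + r) +
    2 * (k * r) * r <= M * b.

Let r0 : 0 < r. Proof. exact: ltn_trans r_gt2. Qed.
Notation rank := (rank e r pi).
Notation complete := (complete e r pi).
Notation block_of := (block_of r k pi).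
Notation defect := (defect e r pi).

Let level j : {set 'I_k} := [set c : 'I_k | (m <= c) && (rank c == j)].

Lemma card_rank (P : pred nat) :
  #|[set c : 'I_k | (m <= c) && P (rank c)]| = \sum_(i < r.+1 | P i) #|level i|.
Proof.
rewrite -sum1_card (partition_big (fun c : 'I_k => inord (rank c) : 'I_r.+1)
  (fun i => P i)) /=; last first.
  by move=> c; rewrite inE inordK ?ltnS ?rank_le // => /andP[].
apply: eq_bigr => i Pi; rewrite -sum1_card; apply: eq_bigl => c; rewrite !inE.
have -> : (inord (rank c) == i) = (rank c == i).
  by rewrite -val_eqE /= inordK // ltnS rank_le.
case: eqP => [->|]; first by rewrite Pi !andbT.
by rewrite !andbF.
Qed.

Lemma level0 : level 0 = set0.
Proof.
apply/setP => c; rewrite !inE; apply/negP => /andP[_ /eqP E].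
have := @leq_rank T e r esym pi c 1 r0.
by rewrite E prefix_clique1.
Qed.

Lemma card_incomplete j c :
  #|[set v | ~~ complete j c v]| <= j * (k + a).
Proof.
elim: j => [|j IH].
  by rewrite leqn0 cards_eq0; apply/eqP/setP => v; rewrite !inE.
rewrite mulSn addnC (leq_trans _ (leq_add IH (nonnbh (pi (c * r + j))))) //.
apply: leq_trans (leq_card_setU _ _).1; apply: subset_leq_card.
apply/subsetP => v; rewrite !inE -negb_and; apply: contra => /andP[cj].
rewrite esym => ev; apply/completeP => x; rewrite ltnS leq_eqVlt.
by case/orP => [/eqP->//|]; move/completeP: cj; apply.
Qed.

Lemma sum_defect j c : \sum_(x < k) defect j c x <= j * (k + a).
Proof.
rewrite (sum_blocks cardT inj (fun v => ~~ complete j c v)).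
by rewrite -cardsE card_incomplete.
Qed.

Lemma count_config (P : nat -> pred T) :
  #|[set v | P (block_of v) v]| =
  \sum_(x < k) count (fun i => P x (pi (x * r + i))) (iota 0 r).
Proof.
rewrite cardsE -(sum_blocks cardT inj); apply: eq_bigr => x _.
apply: eq_in_count => i; rewrite mem_iota => /andP[_ ir].
rewrite /block_of configK //; first by rewrite block_div.
rewrite (leq_trans _ (_ : x.+1 * r <= _)) //; last by rewrite leq_mul2r ltn_ord orbT.
by rewrite mulSn addnC ltn_add2r.
Qed.

Lemma card_same_block v : #|[set u | block_of u == block_of v]| <= r.
Proof.
rewrite (count_config (fun x u => x == block_of v)).
rewrite (bigD1 (Ordinal (block_of_lt r_gt2 cardT inj v))) //= big1 ?addn0.
  by rewrite -[leqRHS](size_iota 0) count_size.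
by move=> x; rewrite -val_eqE /= => /negPf ->; apply/eqP; rewrite -leqn0 count_pred0.
Qed.

(** Edges inside blocks are dropped so that the vertices of a clique lie in distinct blocks, as
    [no_new_clique] requires. *)
Definition cross : rel T := [rel u v | e u v && (block_of u != block_of v)].

Lemma nbh_cross v : #|~: nbh cross v| <= k + (a + r).
Proof.
rewrite addnA (leq_trans _ (leq_add (nonnbh v) (card_same_block v))) //.
apply: leq_trans (leq_card_setU _ _).1; apply: subset_leq_card.
apply/subsetP => u; rewrite !inE /= negb_and negbK eq_sym.
by [].
Qed.

(** The edges inside blocks contribute at most r |T| to the degree sum, and 2 g r |T| <= |T|^2
    because 2 g <= k. Half of the bound survives, whence the doubled [g]. *)
Lemma dense_cross (Y : {set T}) : k <= #|Y| + b ->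
  #|T| ^ 2 <= g.*2 * \sum_(v in Y) #|Y :&: nbh cross v|.
Proof.
move/dense => H.
have : \sum_(v in Y) #|Y :&: nbh e v| <=
    \sum_(v in Y) #|Y :&: nbh cross v| + #|T| * r.
  apply: (@leq_trans (\sum_(v in Y) (#|Y :&: nbh cross v| + r))).
    apply: leq_sum => v _; rewrite (leq_trans _ (leq_add (leqnn _) (card_same_block v))) //.
    apply: leq_trans (leq_card_setU _ _).1; apply: subset_leq_card.
    apply/subsetP => u; rewrite !inE /= [block_of u == _]eq_sym.
    by rewrite /cross /= => /andP[-> ->]; rewrite orNb.
  by rewrite big_split /= leq_add2l sum_nat_const leq_mul2r max_card orbT.
move: (\sum_(v in Y) _) (\sum_(v in Y) _) H => s s' H1 H2.
have : g * s' <= g * (s + #|T| * r) by rewrite leq_mul2l H2 orbT.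
have : g * 2 * (#|T| * r) <= #|T| ^ 2.
  rewrite expnS expn1 mulnCA leq_mul2l cardT muln2 leq_mul2r g_small !orbT //.
move: H1 {H2}; clear; lia.
Qed.

Section Level.
Variable j : nat.
Hypotheses (j0 : 0 < j) (jr : j < r) (large_level : M < #|level j|)
  (small_levels : forall i, j < i < r -> #|level i| <= M).

Let excess c := [set t : 'I_k | (m <= t) && (rank t == r) && (defect j c t < j)].
Let exact c (t : nat) := [&& m <= t, rank t == r & defect j c t == j].

Lemma levelP c : c \in level j -> m <= c /\ rank c = j.
Proof. by rewrite inE => /andP[? /eqP]. Qed.

Lemma k_gt0 : 0 < k.
Proof.
case: (pickP (mem (level j))) => [c _|L0]; first exact: leq_ltn_trans (leq0n c) (ltn_ord c).
by move: large_level; rewrite (eq_card0 L0) ltn0.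
Qed.

Lemma defect_low c (t : 'I_k) : c \in level j -> m <= t -> rank t <= j ->
  defect j c t = r.
Proof.
move=> /levelP[mc rc] mt rt; rewrite -[RHS](size_iota 0); apply/eqP.
rewrite -all_count; apply/allP => i; rewrite mem_iota => /andP[_ ir].
exact: (no_attach esym eirr r_gt2 cardT no_gain mc mt rc jr rt ir).
Qed.

Lemma card_mid : #|[set c : 'I_k | (m <= c) && (j < rank c < r)]| <= r * M.
Proof.
rewrite (card_rank (fun i => j < i < r)).
rewrite big_mkcond big_ord_recr /= ltnn andbF addn0 -[r in r * M]card_ord.
rewrite -sum_nat_const; apply: leq_sum => i _.
by case: ifP => // /small_levels.
Qed.

(** All defects together are at most j (k + a), while low blocks have the largest possible defect
    [r] by [no_attach]. Up to [excess c] and small errors, this forces a defect of exactly [j]. *)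
Lemma exact_blocks c : c \in level j ->
  k <= \sum_(t < k) exact c t + 3 * r * (m + r * M + a + #|excess c|).
Proof.
move=> cj; pose low := [pred t : 'I_k | (m <= t) && (rank t <= j)].
pose mid := [pred t : 'I_k | (m <= t) && (j < rank t < r)].
pose more := [pred t : 'I_k | [&& m <= t, rank t == r & j < defect j c t]].
pose exc := [pred t : 'I_k | [&& m <= t, rank t == r & defect j c t < j]].
pose S (P : pred 'I_k) := \sum_(t < k) P t.
have Sexc : S exc = #|excess c|.
  rewrite /S -big_mkcond /= sum1_card -cardsE; apply: eq_card => t.
  by rewrite !inE unfold_in /= andbA.
have Smid : S mid <= r * M.
  by rewrite /S -big_mkcond /= sum1_card -cardsE card_mid.
have Sm : S [pred t : 'I_k | t < m] <= m.
  rewrite /S -big_mkcond /= -(big_mkord (fun t => t < m) (fun=> 1)).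
  rewrite sum1_count -size_filter -[leqRHS](size_iota 0) uniq_leq_size //.
    by rewrite filter_uniq // iota_uniq.
  by move=> x; rewrite mem_filter !mem_iota add0n => /andP[-> _].
have total : k <= S [pred t : 'I_k | t < m] + S low + S mid + S exc + S more +
    \sum_(t < k) exact c t.
  rewrite -!big_split /= -[leqLHS]card_ord -sum1_card; apply: leq_sum => t _.
  have := rank_le e r pi t; rewrite /exact /low /mid /more /exc /=.
  case: (leqP m t) => //= _; case: (leqP (rank t) j) => //= _.
  by case: (ltngtP (rank t) r) => //= _ _; case: (ltngtP (defect j c t) j).
have sum_def : r * S low + j * \sum_(t < k) exact c t + j.+1 * S more <=
    j * (k + a).
  apply: leq_trans (sum_defect j c); rewrite !big_distrr /= -!big_split /=.
  apply: leq_sum => t _; rewrite /low /more /exact /=.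
  case: (leqP m t) => //= mt; last by rewrite !muln0.
  case: (leqP (rank t) j) => [rj|jr2] /=.
    have -> : (rank t == r) = false by rewrite ltn_eqF // (leq_ltn_trans rj).
    by rewrite defect_low //= !muln0 muln1 !addn0.
  case: (rank t =P r) => [_|_] /=; last by rewrite !muln0.
  case: (ltngtP (defect j c t) j) => [?|?|->] //=;
    by rewrite ?muln0 ?muln1 ?addn0 ?add0n.
rewrite -Sexc; move: sum_def Sm Smid total jr.
move: (S _) (S _) (S _) (S _) (S _) (\sum_(t < k) _) => L O E D A X.
exact: exact_blocks_arith.
Qed.

(** By [no_double_excess], a block belongs to [excess c] for at most one [c]. *)
Lemma sum_excess : \sum_(c in level j) #|excess c| <= k.
Proof.
under eq_bigr => c _ do rewrite -sum1_card.
rewrite (exchange_big_dep predT) //= -[leqRHS]card_ord -sum1_card.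
apply: leq_sum => t _; rewrite sum1_card leqNgt; apply/negP => /card_gt1P[c [c' []]].
rewrite unfold_in => /andP[/levelP[mc rc]]; rewrite inE -andbA => /and3P[mt /eqP rt dc].
rewrite unfold_in => /andP[/levelP[mc' rc']]; rewrite inE => /andP[_ dc'] cc'.
have jr' : 0 < j < r by rewrite j0.
have := no_double_excess esym r_gt2 cardT no_gain mc mc' mt cc' rc rc' jr' rt dc.
by rewrite leqNgt dc'.
Qed.

(** Markov's inequality for [sum_excess]: more than M / 2 blocks of the level satisfy this
    ([card_nice]), and for them [exact_blocks] misses only few blocks. *)
Let nice : {set 'I_k} := [set c in level j | #|excess c| * M <= k.*2].

Lemma card_nice : M < #|nice|.*2.
Proof.
have le1 : #|level j :\: nice| * k.*2 <= k * M.
  apply: (@leq_trans (\sum_(c in level j :\: nice) #|excess c| * M)).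
    rewrite -sum_nat_const; apply: leq_sum => c; rewrite !inE.
    by move=> /andP[H cj]; move: H; rewrite cj /= -ltnNge => /ltnW.
  rewrite -big_distrl leq_mul2r; apply/orP; right; apply: leq_trans sum_excess.
  by rewrite [leqRHS](big_setID nice) /= leq_addl.
have le2 : #|level j :\: nice|.*2 <= M.
  by rewrite -(leq_pmul2l k_gt0) -doubleMr doubleMl mulnC; move: le1; clear; lia.
have := cardsID nice (level j); rewrite (setIidPr _); last first.
  by apply/subsetP => c; rewrite inE => /andP[].
by move: large_level le2; clear; lia.
Qed.

Let moved c : {set T} := [set v | exact c (block_of v) && ~~ complete j c v].

Lemma card_moved c : #|moved c| = j * \sum_(t < k) exact c t.
Proof.
rewrite (count_config (fun x v => exact c x && ~~ complete j c v)) big_distrr /=.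
apply: eq_bigr => t _; case: (boolP (exact c t)) => /= [/and3P[_ _ /eqP E]|_].
  by rewrite -/(defect j c t) E muln1.
by rewrite count_pred0 muln0.
Qed.

(* Enough blocks c remain available for a greedy choice of distinct ones. *)
Let popular : {set T} := [set v | r <= #|[set c in nice | v \in moved c]|].

(** Double counting of the pairs of a nice [c] and a vertex of [moved c]: each [c] contributes
    almost j k vertices, each unpopular vertex fewer than [r] pairs. The summand j.-1 * (a + r) is
    the slack that [num_cliques_lower_bound] demands for [cross], where [a] becomes a + r. *)
Lemma card_popular : j * k + j.-1 * (a + r) <= #|popular| + b.
Proof.
set F := 3 * r * ((m + r * M + a) * M + k.*2).
have le1 c : c \in nice -> j * k * M <= #|moved c| * M + j * F.
  rewrite inE => /andP[cj ec]; rewrite card_moved -!mulnA -mulnDr.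
  rewrite leq_mul2l; apply/orP; right.
  have := leq_mul (exact_blocks cj) (leqnn M).
  rewrite mulnDl => /leq_trans; apply; rewrite leq_add2l /F -!mulnA.
  by rewrite !leq_mul2l mulnDl leq_add2l ec !orbT.
have le2 : #|nice| * (j * k * M) <=
    (\sum_(c in nice) #|moved c|) * M + #|nice| * (j * F).
  by rewrite -!sum_nat_const big_distrl -big_split; apply: leq_sum.
have le3 : \sum_(c in nice) #|moved c| <= #|popular| * #|nice| + k * r * r.
  under eq_bigr => c _ do rewrite -sum1_card.
  rewrite (exchange_big_dep predT) //= -cardT -!sum_nat_const.
  rewrite (bigID (mem popular)) /= leq_add //.
    apply: leq_sum => v _; rewrite sum1_card; apply: subset_leq_card.
    by apply/subsetP => c; rewrite unfold_in => /andP[].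
  rewrite [leqRHS](bigID (mem popular)) /= (leq_trans _ (leq_addl _ _)) //.
  apply: leq_sum => v; rewrite inE -ltnNge => /ltnW; apply: leq_trans.
  rewrite sum1_card; apply: eq_leq; apply: eq_card => c.
  by rewrite inE unfold_in.
have := card_nice; have : j * F <= r * F by rewrite leq_mul2r ltnW ?orbT.
move: le2 le3 M_large; rewrite -/F.
have : j.-1 * (a + r) <= r * (a + r) by rewrite leq_mul2r; apply/orP; right; move: jr; clear; lia.
move: (#|nice|) (#|popular|) (\sum_(c in nice) _) (j * F) (r * F) (j.-1 * _).
move: M_gt0; clear => M0 N P S jF rF jar H1 H2 H3 H4 H5 H6; rewrite leqNgt; apply/negP => H7.
have N0 : 0 < N by move: H6; clear; lia.
have K1 : M * N * (P + b).+1 <= M * N * (j * k + jar) by rewrite leq_mul2l H7 orbT.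
have K2 : S * M <= (P * N + k * r * r) * M by rewrite leq_mul2r H3 orbT.
have K3 : N * (rF + M * r * (a + r) + 2 * (k * r) * r) <= N * (M * b).
  by rewrite leq_mul2l H4 orbT.
have K4 : k * r * r * M <= k * r * r * N.*2 by rewrite leq_mul2l (ltnW H6) orbT.
have K5 : N * jF <= N * rF by rewrite leq_mul2l H5 orbT.
have K6 : M * N * jar <= M * N * (r * (a + r)) by rewrite leq_mul2l H1 orbT.
have K7 : 0 < M * N by rewrite muln_gt0 M0.
by move: H2 K1 K2 K3 K4 K5 K6 K7; clear; lia.
Qed.

(** [popular] is large enough to contain a (j + 1)-clique of [cross]. Each of its vertices can be
    moved for at least r > j nice blocks, so distinct blocks can be assigned to them, against
    [no_new_clique]. *)
Lemma level_false : False.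
Proof.
(* Averaging over a one-point type merely extracts one clique from a positive count. *)
have pos : 0 < \sum_(u in [set: unit]) num_cliques cross j.+1 popular.
  rewrite sum_nat_const cardsT card_unit mul1n.
  have := @num_cliques_lower_bound T cross r k g.*2 (a + r) b cardT nbh_cross
    dense_cross b_small j.-1 popular.
  rewrite prednK // => /(_ card_popular) le.
  have n0 : 0 < #|T| ^ j.+1 by rewrite expn_gt0 cardT muln_gt0 k_gt0 r0.
  by move: (leq_trans n0 le); rewrite muln_gt0 => /andP[].
have [S [sS pS leS]] := num_cliques_averaging pos.
move: (leq_trans pos leS); rewrite muln_gt0 => /andP[_ /card_gt0P[[]]].
rewrite !inE /= => /allP popS.
have [|| cs [scs ucs Dcs]] :=
  @exists_representatives _ _ (fun v => [set c in nice | v \in moved c]) S r.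
- by move=> v /popS /=; rewrite inE.
- by rewrite sS.
have [y0 [c0 _]] : exists (y0 : T) (c0 : 'I_k), true.
  by case: (S) (cs) sS scs => [|y ?] // [|c ?] // _ _; exists y, c.
have csP i : i < j.+1 -> nth c0 cs i \in nice /\ nth y0 S i \in moved (nth c0 cs i).
  by move=> ij; have := Dcs y0 c0 i; rewrite sS inE => /(_ ij)/andP[].
apply: (@no_new_clique _ _ _ _ _ _ esym r_gt2 cardT inj no_gain j cs S c0 y0) => //.
- by rewrite j0.
- by rewrite scs.
- rewrite uniq_pairwise pairwise_map; apply: sub_pairwise pS => u v.
  by case/andP.
- move=> c /(nthP c0)[i]; rewrite scs sS => ij <-; have [+ _] := csP i ij.
  by rewrite inE => /andP[/levelP[]].
- move=> y /(nthP y0)[i]; rewrite sS => ij <-; have [_] := csP i ij.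
  by rewrite inE => /andP[/and3P[-> /eqP-> _] _].
- by apply: sub_pairwise pS => u v /andP[].
- move=> i ij /=; have [_] := csP i ij.
  by rewrite inE => /andP[/and3P[_ _ /eqP E] cy]; split=> //; rewrite -[leqRHS]E.
Qed.

End Level.

(** Otherwise some rank below [r] occurs more than [M] times. [level_false] applies to the largest
    such rank, since by maximality the ranks strictly between it and [r] are rare. *)
Lemma few_nonfull : #|[set c : 'I_k | (m <= c) && ~~ full e r pi c]| <= r * M.
Proof.
rewrite leqNgt; apply/negP => large.
pose P j := (j < r) && (M < #|level j|).
have Pub j : P j -> j <= r by case/andP => /ltnW.
have exP : exists j, P j.
  have [/existsP[j Mj]|/existsPn small] := boolP [exists j : 'I_r, M < #|level j|].
    by exists j; rewrite /P ltn_ord.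
  move: large; rewrite ltnNge -[X in _ <= X * _](card_ord r) -sum_nat_const.
  have -> : [set c : 'I_k | (m <= c) && ~~ full e r pi c] =
      [set c : 'I_k | (m <= c) && (rank c < r)].
    by apply/setP => c; rewrite !inE full_rank // ltn_neqAle rank_le andbT.
  rewrite (card_rank (fun i => i < r)) big_mkcond big_ord_recr /= ltnn addn0.
  rewrite leq_sum // => i _; rewrite ltn_ord leqNgt; exact: small.
case: (ex_maxnP exP Pub) => j /andP[jr Mj] max_j.
have j0 : 0 < j.
  by case: posnP Mj => // ->; rewrite level0 cards0.
apply: (@level_false j) => // i /andP[ji ir]; rewrite leqNgt; apply/negP => Mi.
by have := max_j i; rewrite /P ir Mi leqNgt ji => /(_ isT).
Qed.

End FewNonfull.

(** * Absorbers *)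

Section Absorbers.
Variables (T : finType) (e : rel T) (r k : nat).
Hypotheses (esym : symmetric e) (eirr : irreflexive e) (r_gt2 : 2 < r).
Hypotheses (cardT : #|T| = k * r) (k_gt0 : 0 < k).
Variables (a b g q : nat).
Hypothesis nonnbh : forall v, #|~: nbh e v| <= k + a.
Hypothesis dense : forall Y : {set T}, k <= #|Y| + b ->
  #|T| ^ 2 <= g * \sum_(v in Y) #|Y :&: nbh e v|.
Hypothesis b_small : b.*2 <= k.
Hypothesis b_large : r * a + q + r + r * r <= b.

(** Every [Y u] contains the proportion 1 / (g (2 r)^i) of all tuples as ordered cliques, so by
    averaging one clique serves that proportion of [U]. *)
Lemma pick_clique (I : finType) (U : {set I}) (Y : I -> {set T}) i :
  0 < #|U| -> {in U, forall u, i.+1 * k + i * a <= #|Y u| + b} ->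
  exists S : seq T, [/\ size S = i.+2, pairwise e S &
    #|U| <= g * r.*2 ^ i * #|[set u in U | all (mem (Y u)) S]|].
Proof.
move=> U0 HY.
have n0 : 0 < #|T| ^ i.+2.
  by rewrite expn_gt0 cardT muln_gt0 k_gt0 (ltn_trans _ r_gt2).
have le : #|U| * #|T| ^ i.+2 <= g * r.*2 ^ i * \sum_(u in U) num_cliques e i.+2 (Y u).
  rewrite -sum_nat_const big_distrr /=; apply: leq_sum => u /HY.
  exact: num_cliques_lower_bound cardT nonnbh dense b_small _ _.
have pos : 0 < \sum_(u in U) num_cliques e i.+2 (Y u).
  have : 0 < #|U| * #|T| ^ i.+2 by rewrite muln_gt0 U0.
  by move/leq_trans => /(_ _ le); rewrite muln_gt0 => /andP[].
have [S [sS pS leS]] := num_cliques_averaging pos; exists S; split=> //.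
rewrite -(leq_pmul2r n0) (leq_trans le) // -[leqRHS]mulnA leq_mul2l.
by rewrite [_ * #|T| ^ _]mulnC leS orbT.
Qed.

Variable O : {set T}.
Hypothesis card_O : #|~: O| <= q.

Lemma card_O_lower : k * r <= #|O| + q.
Proof. by rewrite -cardT -(cardsC O) leq_add2l. Qed.

Lemma column_exists :
  exists y : seq T, [/\ size y = r, pairwise e y & {subset y <= O}].
Proof.
have [||y [sy py le]] := @pick_clique unit [set: unit] (fun=> O) r.-2.
- by rewrite cardsT card_unit.
- move=> _ _; have := card_O_lower; move: b_large r_gt2; clear.
  case: r => [|[|s]] //= b_large _ /=; nia.
exists y; split=> //; first by rewrite sy; move: r_gt2; clear; lia.
move: le; rewrite cardsT card_unit muln_gt0 => /andP[_ /card_gt0P[u]].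
by rewrite !inE => /allP H v /H.
Qed.

Let G := g * r.*2 ^ (r - 3).

(** Row [i] has to be adjacent to the i-th vertex of the column [y] and, for as many [u] as
    possible, to [X u i]. Each new row keeps at least 1 / G of the indices that have survived so
    far, and avoids the column and the earlier rows. *)
Lemma rows_exist (N : nat) (X : 'I_N -> nat -> T) (U : {set 'I_N}) (y : seq T)
    (x0 : T) i :
  0 < #|U| -> size y = r -> i <= r ->
  exists s : nat -> seq T,
    (forall j, j < i -> [/\ size (s j) = r.-1, pairwise e (s j),
       {subset s j <= O}, all (e (nth x0 y j)) (s j) /\ ~~ has (mem y) (s j) &
       forall j', j' < j -> ~~ has (mem (s j')) (s j)]) /\
    #|U| <= G ^ i * #|[set u in U |
                        all (fun j => all (e (X u j)) (s j)) (iota 0 i)]|.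
Proof.
move=> U0 sy; elim: i => [|i IH] ir.
  exists (fun=> [::]); split=> //; rewrite mul1n subset_leq_card //.
  by apply/subsetP => u uU; rewrite inE uU.
have [s [Hs cs]] := IH (ltnW ir).
set U1 := [set u in U | _] in cs.
have U1_gt0 : 0 < #|U1|.
  by move: (leq_trans U0 cs); rewrite muln_gt0 => /andP[].
pose used := y ++ flatten [seq s j | j <- iota 0 i].
have size_used : size used <= r + r * r.
  rewrite size_cat sy leq_add2l size_flatten sumnE !big_map.
  apply: (@leq_trans (\sum_(j <- iota 0 i) r)).
    rewrite big_seq [leqRHS]big_seq; apply: leq_sum => j.
    by rewrite mem_iota => /Hs[-> _ _ _ _]; rewrite leq_pred.
  by rewrite big_const_seq count_predT size_iota iter_addn_0 leq_mul2l ltnW ?orbT.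
(* Two neighbourhoods have about (r - 2) k common vertices, just what [pick_clique] needs for a
   clique of r - 1 = (r - 3) + 2 vertices. The slack in the degrees, the set outside [O] and the
   vertices in [used] are paid for by [b_large]. *)
pose Y u := (nbh e (X u i) :&: nbh e (nth x0 y i)) :&: (O :\: [set x in used]).
have [|S [sS pS leS]] := @pick_clique _ U1 Y (r - 3) U1_gt0.
  move=> u _; rewrite /Y.
  have H1 := card_setI_nbh nonnbh (nbh e (X u i) :&: (O :\: [set x in used]))
    (nth x0 y i).
  have H2 := card_setI_nbh nonnbh (O :\: [set x in used]) (X u i).
  have H3 : #|O| <= #|O :\: [set x in used]| + (r + r * r).
    rewrite -(cardsID [set x in used] O) addnC leq_add2l.
    rewrite (leq_trans (subset_leq_card (subsetIr _ _))) // cardsE.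
    exact: leq_trans (card_size _) size_used.
  have H4 := card_O_lower.
  move: H1 H2 H3 H4 b_large r_gt2; rewrite setIAC [_ :&: nbh e (X u i)]setIC.
  move: #|_| #|_| #|_| #|_|; clear.
  by case: r => [|[|[|s]]] // x z w v; rewrite !subSS subn0 /=; nia.
exists (fun x => if x == i then S else s x).
have ne j : j < i -> (j == i) = false by move=> /ltn_eqF.
have SY : {subset S <= O :\: [set x in used]} /\ all (e (nth x0 y i)) S.
  have /card_gt0P[u] : 0 < #|[set u in U1 | all (mem (Y u)) S]|.
    by move: (leq_trans U1_gt0 leS); rewrite muln_gt0 => /andP[].
  rewrite inE => /andP[_ /allP SY].
  by split; [move=> v /SY|apply/allP => v /SY]; rewrite !inE => /andP[/andP[]].
split.
  move=> j; rewrite ltnS leq_eqVlt => /orP[/eqP->|ji].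
    rewrite eqxx; case: SY => SO eS.
    have notused v : v \in S -> v \notin used by move/SO; rewrite !inE => /andP[].
    split=> //.
    - by rewrite sS; move: r_gt2; clear; lia.
    - by move=> v /SO; rewrite !inE => /andP[].
    - split=> //; apply/hasPn => v /notused; rewrite mem_cat negb_or.
      by case/andP.
    - move=> j' j'i; rewrite ne //; apply/hasPn => v /notused.
      rewrite mem_cat negb_or => /andP[_]; apply: contra => vs.
      by apply/flattenP; exists (s j') => //; apply: map_f; rewrite mem_iota.
  have [s1 s2 s3 s4 s5] := Hs _ ji; rewrite ne //; split=> // j' j'j.
  by rewrite ne ?s5 // (ltn_trans j'j).
apply: leq_trans cs _; rewrite expnSr -mulnA leq_mul2l; apply/orP; right.
apply: leq_trans leS _; rewrite leq_mul2l; apply/orP; right.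
apply: subset_leq_card; apply/subsetP => u.
rewrite [in X in X -> _]inE => /andP[uU1 /allP SYu].
have /andP[uU /allP Us] : (u \in U) && all (fun j => all (e (X u j)) (s j)) (iota 0 i).
  by move: uU1; rewrite inE.
rewrite inE uU andTb; apply/allP => j; rewrite mem_iota => /andP[_].
rewrite add0n ltnS leq_eqVlt.
case/orP => [/eqP->|ji].
  by rewrite eqxx; apply/allP => v /SYu; rewrite 3!inE -andbA => /andP[]; rewrite inE.
by rewrite ne //; apply: Us; rewrite mem_iota.
Qed.

(* An absorber consists of the disjoint cliques w i 0, ..., w i (r - 1), whose first
   vertices w i 0 form a clique too: it absorbs u when X u i can replace w i 0
   for all i. *)
Lemma absorber_exists (N : nat) (X : 'I_N -> nat -> T) (U : {set 'I_N}) :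
  0 < #|U| ->
  exists w : nat -> nat -> T,
  [/\ forall i l i' l', i < r -> l < r -> i' < r -> l' < r ->
        w i l = w i' l' -> i = i' /\ l = l',
      forall i l, i < r -> l < r -> w i l \in O,
      forall i l l', i < r -> l < r -> l' < r -> l != l' -> e (w i l) (w i l'),
      forall i i', i < r -> i' < r -> i != i' -> e (w i 0) (w i' 0) &
      #|U| <= G ^ r * #|[set u in U | [forall i : 'I_r, forall l : 'I_r,
        (0 < l) ==> e (X u i) (w i l)]]|].
Proof.
move=> U0; have r0 : 0 < r by exact: ltn_trans r_gt2.
have [y [sy py yO]] := column_exists.
have x0 : T by case: (y) sy r0 => [<-|v].
have [s [Hs cs]] := rows_exist X x0 U0 sy (leqnn r).
pose w i l := nth x0 (nth x0 y i :: s i) l.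
have yP i : i < r -> nth x0 y i \in y by move=> ir; rewrite mem_nth // sy.
have sP i l : i < r -> l.+1 < r -> w i l.+1 \in s i.
  by move=> ir lr; have [si _ _ _ _] := Hs i ir; rewrite /w /= mem_nth // si -ltnS prednK.
have ys i l : i < r -> l.+1 < r -> w i l.+1 \notin y.
  move=> ir lr; have [_ _ _ [_ /hasPn H] _] := Hs i ir.
  exact/H/sP.
have lt_pred l : l.+1 < r -> l < r.-1 by rewrite ltn_predRL.
have uy : uniq y by exact: pairwise_uniq py.
exists w; split.
- move=> i [|l] i' [|l'] ir lr ir' lr'.
  + by rewrite /w /= => /eqP; rewrite nth_uniq ?sy // => /eqP.
  + by move=> E; have := ys _ _ ir' lr'; rewrite -E yP.
  + by move=> E; have := ys _ _ ir lr; rewrite E yP.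
  + move=> E; have Ei : i = i'.
      case: (ltngtP i i') => // [ii'|i'i].
        have [_ _ _ _ /(_ _ ii')/hasPn/(_ _ (sP _ _ ir' lr'))] := Hs i' ir'.
        by case/negP; rewrite /= -E sP.
      have [_ _ _ _ /(_ _ i'i)/hasPn/(_ _ (sP _ _ ir lr))] := Hs i ir.
      by case/negP; rewrite /= E sP.
    split=> //; congr _.+1; move: E; rewrite -Ei /w /= => /eqP.
    have [si psi _ _ _] := Hs i ir; rewrite nth_uniq ?si ?lt_pred //.
      by move/eqP.
    exact: pairwise_uniq psi.
- move=> i [|l] ir lr; first by apply/yO/yP.
  by have [_ _ H _ _] := Hs i ir; apply/H/sP.
- have row i l l' : i < r -> l < l' -> l' < r -> e (w i l) (w i l').
    move=> ir ll' lr'; have [si psi _ [/allP H _] _] := Hs i ir.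
    case: l l' ll' lr' => [|l] [|l'] //= ll' lr'; first exact/H/sP.
    rewrite /w /=; move/(pairwiseP x0): psi; apply; rewrite ?inE ?si ?lt_pred //.
    exact: ltn_trans lr'.
  move=> i l l' ir lr lr'; rewrite neq_ltn => /orP[] ?; last rewrite esym.
    exact: row.
  exact: row.
- have col i i' : i < i' -> i' < r -> e (w i 0) (w i' 0).
    by move=> ii' ir'; rewrite /w /=; move/(pairwiseP x0): py; apply; rewrite ?inE ?sy // (ltn_trans ii').
  move=> i i' ir ir'; rewrite neq_ltn => /orP[] ?; last rewrite esym.
    exact: col.
  exact: col.
- apply: leq_trans cs _; rewrite leq_mul2l; apply/orP; right.
  apply: subset_leq_card; apply/subsetP => u; rewrite !inE => /andP[-> /allP H] /=.
  apply/'forall_forallP => i l; apply/implyP; case: l => -[|l] // lr _.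
  have /allP : all (e (X u i)) (s i) by apply: H; rewrite mem_iota ltn_ord.
  by apply; apply: sP.
Qed.

End Absorbers.

(** * The score of an ordering *)

Section Score.
Variables (T : finType) (e : rel T) (r k m N c0 d : nat) (X : nat -> nat -> T).
Implicit Type pi : nat -> T.

(* X u 0, ..., X u (r - 1) is the u-th of the N = n ^ r tuples of vertices, and
   slot s consists of the blocks s * r, ..., s * r + r - 1. *)
Definition valid pi s :=
  all (full e r pi) (iota (s * r) r) &&
  pairwise e [seq pi (b * r) | b <- iota (s * r) r].

Definition absorbs pi s u :=
  all (fun i => all (e (X u i)) [seq pi p | p <- iota ((s * r + i) * r).+1 r.-1])
    (iota 0 r).

Definition hits pi u := \sum_(s < m) (valid pi s && absorbs pi s u : nat).

Definition nonfull pi := \sum_(b < k) (~~ full e r pi b : nat).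

Definition scarce pi h := \sum_(u < N) (hits pi u < h : nat).

(** Hits count only up to [c0], so a slot earns nothing from tuples that are already well served.
    The first sum makes any absorber better than an invalid slot. *)
Definition supply pi :=
  \sum_(s < m) (valid pi s : nat) + \sum_(u < N) minn (hits pi u) c0.

(* Exceeds every outer_potential, so that multiples of it take precedence. *)
Definition unit_score := k * r.+1 ^ r + 1.

(* Exceeds every score in the case of insufficient absorbers. *)
Definition threshold := (c0 * N + m + 1) * unit_score.

(** Every value of the first case exceeds every value of the second. The required number of hits is
    the current [nonfull pi] rather than a constant, so that the condition persists when an absorber
    is spent to repair a block ([advance]). *)
Definition score pi :=
  if scarce pi (nonfull pi) * d <= N then threshold + (k - nonfull pi)
  else supply pi * unit_score + outer_potential e r k (m * r) pi.

Definition local_max (F : (nat -> T) -> nat) pi := forall ps,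
  size ps <= r * r -> all (fun pq => (pq.1 < k * r) && (pq.2 < k * r)) ps ->
  F (swaps pi ps) <= F pi.

Hypotheses (esym : symmetric e) (eirr : irreflexive e) (r_gt2 : 2 < r).

Let r0 : 0 < r. Proof. exact: ltn_trans r_gt2. Qed.

Lemma validP pi s :
  reflect ((forall i, i < r -> full e r pi (s * r + i)) /\
           (forall i i', i < r -> i' < r -> i != i' ->
              e (pi ((s * r + i) * r)) (pi ((s * r + i') * r))))
          (valid pi s).
Proof.
have E : pairwise e [seq pi (b * r) | b <- iota (s * r) r] =
    prefix_clique e r (fun p => pi (p * r)) s r.
  by rewrite /prefix_clique.
rewrite /valid E; apply: (iffP andP) => [[/allP H1 /(prefix_cliqueP esym) H2]|[H1 H2]].
  by split=> // i ir; apply: H1; rewrite mem_iota leq_addr ltn_add2l.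
split; last exact/(prefix_cliqueP esym).
by apply/allP => b; rewrite mem_iota => /andP[sb bs]; rewrite -(subnKC sb) H1 //; lia.
Qed.

Lemma absorbsP pi s u :
  reflect (forall i l, i < r -> 0 < l < r -> e (X u i) (pi ((s * r + i) * r + l)))
          (absorbs pi s u).
Proof.
apply: (iffP allP) => [H i l ir /andP[l0 lr]|H i].
  have /allP : all (e (X u i)) [seq pi p | p <- iota ((s * r + i) * r).+1 r.-1].
    by apply: H; rewrite mem_iota.
  by apply; apply: map_f; rewrite mem_iota; lia.
rewrite mem_iota => ir; apply/allP => _ /mapP[p + ->]; rewrite mem_iota => ph.
by rewrite -(subnKC (ltnW (andP ph).1)); apply: H; lia.
Qed.

Section SameSlot.
Variables (pi pi' : nat -> T) (s : nat).
Hypothesis same : forall i, i < r -> same_block r pi pi' (s * r + i).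

Lemma valid_same : valid pi' s = valid pi s.
Proof.
have first i : i < r -> pi' ((s * r + i) * r) = pi ((s * r + i) * r).
  by move=> ir; have := same ir r0; rewrite addn0.
have fullE i : i < r -> full e r pi' (s * r + i) = full e r pi (s * r + i).
  by move=> ir; apply: eq_full; apply: same.
by apply/validP/validP => -[H1 H2]; split=> [i ir|i i' ir ir' ii'];
  [rewrite -fullE ?H1|rewrite -!first ?H2|rewrite fullE ?H1|rewrite !first ?H2].
Qed.

Lemma absorbs_same u : absorbs pi' s u = absorbs pi s u.
Proof.
by apply/absorbsP/absorbsP => H i l ir /[dup] /andP[_ lr] ?;
  [rewrite -(same ir lr)|rewrite (same ir lr)]; apply: H.
Qed.

End SameSlot.

Lemma hits_le pi u : hits pi u <= m.
Proof.
rewrite -[leqRHS]card_ord -sum1_card; apply: leq_sum => s _.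
by case: (_ && _).
Qed.

Lemma supply_le pi : supply pi <= c0 * N + m.
Proof.
rewrite addnC leq_add //.
  by rewrite -[leqRHS]card_ord -sum1_card; apply: leq_sum => s _; case: valid.
by rewrite mulnC -[N in N * _]card_ord -sum_nat_const leq_sum // => u _; rewrite geq_minr.
Qed.

Lemma outer_potential_lt pi : outer_potential e r k (m * r) pi < unit_score.
Proof.
rewrite /unit_score addn1 ltnS /outer_potential big_mkcond /=.
apply: (@leq_trans (\sum_(b < k) r.+1 ^ r)); last by rewrite sum_nat_const card_ord.
apply: leq_sum => b _; by case: ifP => // _; rewrite leq_exp2l // rank_le.
Qed.

Lemma score_le pi : score pi <= threshold + k.
Proof.
rewrite /score; case: ifP => _; first by rewrite leq_add2l leq_subr.
apply: leq_trans (leq_addr _ _).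
apply: (@leq_trans ((supply pi).+1 * unit_score)).
  by rewrite mulSn addnC leq_add2r ltnW // outer_potential_lt.
by rewrite leq_mul2r addn1 ltnS supply_le orbT.
Qed.

Lemma scarce_max pi : (nonfull pi <= c0) -> scarce pi c0 * d <= N ->
  scarce pi (nonfull pi) * d <= N.
Proof.
move=> fc; apply: leq_trans; rewrite leq_mul2r; apply/orP; right.
apply: leq_sum => u _; case: (ltnP (hits pi u) (nonfull pi)) => // lt.
by rewrite (leq_trans lt fc).
Qed.

(** One unit of [supply] is worth [unit_score], more than any outer potential; and a swap that
    changes the case only reaches an even higher score. *)
Lemma local_max_supply pi : ~~ (scarce pi (nonfull pi) * d <= N) ->
  local_max score pi -> local_max supply pi.
Proof.
move=> inv max ps sps pps; rewrite leqNgt; apply/negP => lt.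
have := max ps sps pps; rewrite /score (negPf inv) leqNgt => /negP; apply.
have lt1 : supply pi * unit_score + outer_potential e r k (m * r) pi <
    supply (swaps pi ps) * unit_score.
  apply: (@leq_trans ((supply pi).+1 * unit_score)); last by rewrite leq_mul2r lt orbT.
  by rewrite mulSn [ltnRHS]addnC ltn_add2l outer_potential_lt.
case: ifP => _; last exact: leq_trans lt1 (leq_addr _ _).
apply: leq_trans lt1 _; apply: leq_trans (leq_addr _ _).
by rewrite leq_mul2r (leq_trans (supply_le _)) ?orbT // leq_addr.
Qed.

(** Swaps among outer blocks leave all slots alone, so [supply] is constant and the outer potential
    decides. A change of case would lift the score to [threshold] or more, against maximality. *)
Lemma local_max_outer pi : m * r <= k -> ~~ (scarce pi (nonfull pi) * d <= N) ->
  local_max score pi -> forall ps, size ps <= r * r ->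
  outer_pairs r k (m * r) ps ->
  outer_potential e r k (m * r) (swaps pi ps) <= outer_potential e r k (m * r) pi.
Proof.
move=> mk inv max ps sps pps.
have pps' : all (fun pq => (pq.1 < k * r) && (pq.2 < k * r)) ps.
  apply: sub_all pps => -[p q] /= /andP[/andP[_ pk] /andP[_ qk]].
  by rewrite -!ltn_divLR // pk qk.
have same b : b < m * r -> same_block r pi (swaps pi ps) b.
  move=> bm x xr; apply: swaps_out; apply/mapP => -[[p q] /(allP pps) /=].
    by move=> /andP[/andP[+ _] _] E; rewrite -E block_div // leqNgt bm.
  by move=> /andP[_ /andP[+ _]] E; rewrite -E block_div // leqNgt bm.
have slot s i : s < m -> i < r -> s * r + i < m * r.
  move=> sm ir; apply: (@leq_trans (s.+1 * r)); last by rewrite leq_mul2r sm orbT.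
  by rewrite mulSn addnC ltn_add2r.
have E : supply (swaps pi ps) = supply pi.
  have V (s : 'I_m) : valid (swaps pi ps) s = valid pi s.
    by apply: valid_same => i ir; apply/same/slot.
  rewrite /supply; congr (_ + _); first by apply: eq_bigr => s _; rewrite V.
  apply: eq_bigr => u _; congr (minn _ _); apply: eq_bigr => s _; rewrite V.
  by rewrite (@absorbs_same pi) // => i ir; apply/same/slot.
have := max ps sps pps'; rewrite {2}/score (negPf inv) /score E.
case: ifP => _; last by rewrite leq_add2l.
move=> le; exfalso; move: le; rewrite leqNgt => /negP; apply.
apply: leq_trans (leq_addr _ _).
apply: (@leq_trans ((supply pi).+1 * unit_score)).
  by rewrite mulSn [ltnRHS]addnC ltn_add2l outer_potential_lt.
by rewrite leq_mul2r addn1 ltnS supply_le orbT.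
Qed.

End Score.

(** * Replacing a slot by a better absorber *)

Section Supply.
Variables (T : finType) (e : rel T) (r k m N c0 d : nat) (X : nat -> nat -> T).
Variable pi : nat -> T.
Hypotheses (esym : symmetric e) (eirr : irreflexive e) (r_gt2 : 2 < r).
Hypotheses (cardT : #|T| = k * r) (k_gt0 : 0 < k) (N_gt0 : 0 < N).
Hypothesis inj : {in [pred x | x < k * r] &, injective pi}.
Variables (a b g : nat).
Hypothesis nonnbh : forall v, #|~: nbh e v| <= k + a.
Hypothesis dense : forall Y : {set T}, k <= #|Y| + b ->
  #|T| ^ 2 <= g * \sum_(v in Y) #|Y :&: nbh e v|.
Hypothesis b_small : b.*2 <= k.
Hypothesis b_large : r * a + m * r * r + r + r * r <= b.
Hypothesis m_small : m * r <= k.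

Let G := g * r.*2 ^ (r - 3).
Hypothesis m_large : G ^ r * c0 * d <= m.
Hypothesis m_gt0 : 0 < m.

Let r0 : 0 < r. Proof. exact: ltn_trans r_gt2. Qed.
Notation valid := (valid e r).
Notation absorbs := (absorbs e r X).
Notation hits := (hits e r m X).
Notation supply := (supply e r m N c0 X).

Lemma slot_block s i : s < m -> i < r -> s * r + i < m * r.
Proof.
move=> sm ir; apply: (@leq_trans (s.+1 * r)); last by rewrite leq_mul2r sm orbT.
by rewrite mulSn addnC ltn_add2r.
Qed.

Let O : {set T} := [set v | m * r <= block_of r k pi v].

Lemma card_inner : #|~: O| <= m * r * r.
Proof.
have -> : ~: O = [set v | block_of r k pi v < m * r].
  by apply/setP => v; rewrite !inE ltnNge.
rewrite (count_config cardT inj (fun x _ => x < m * r)).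
apply: (@leq_trans (\sum_(x < k) if x < m * r then r else 0)).
  apply: leq_sum => x _; case: ifP => _; last by rewrite count_pred0.
  by rewrite -[leqRHS](size_iota 0) count_size.
by rewrite -big_mkcond -(big_ord_widen _ (fun=> r)) // sum_nat_const card_ord.
Qed.

Section Replace.
Variables (s : nat) (w : nat -> nat -> T).
Hypotheses (sm : s < m)
  (w_inj : forall i l i' l', i < r -> l < r -> i' < r -> l' < r ->
     w i l = w i' l' -> i = i' /\ l = l')
  (w_out : forall i l, i < r -> l < r -> w i l \in O).

Let A := iota (s * r * r) (r * r).
Let B := [seq position r k pi (w (p %/ r) (p %% r)) | p <- iota 0 (r * r)].
Definition replace_pairs := zip A B.
Let pi' := swaps pi replace_pairs.

Lemma replace_sizes : size A = size B.
Proof. by rewrite size_iota size_map size_iota. Qed.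

Lemma digits_lt p : p < r * r -> p %/ r < r /\ p %% r < r.
Proof. by move=> pr; rewrite ltn_divLR // pr ltn_mod. Qed.

Lemma inner_lt p : p \in A -> p < m * r * r.
Proof.
rewrite mem_iota => /andP[_ lt]; apply: (leq_trans lt).
by rewrite -mulnDl -mulSnr !leq_mul2r sm !orbT.
Qed.

Lemma outer_ge p : p \in B -> m * r * r <= p < k * r.
Proof.
case/mapP => x; rewrite mem_iota => /digits_lt[dx mx] ->.
rewrite position_lt // andbT.
have := w_out dx mx; rewrite inE /block_of => le.
by rewrite -leq_divRL.
Qed.

Lemma replace_uniq : uniq (A ++ B).
Proof.
rewrite cat_uniq iota_uniq map_inj_in_uniq ?iota_uniq ?andbT.
  by apply/hasPn => p /outer_ge/andP[le _]; apply/negP => /inner_lt; rewrite ltnNge le.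
move=> x y; rewrite !mem_iota => /digits_lt[dx mx] /digits_lt[dy my] E.
have := congr1 pi E; rewrite !(positionK cardT inj) => /w_inj E'.
have [//|//|//|//|E1 E2] := E' _ _ _ _.
by rewrite (divn_eq x r) E1 E2 -divn_eq.
Qed.

Lemma replace_slot i l : i < r -> l < r -> pi' ((s * r + i) * r + l) = w i l.
Proof.
move=> ir lr; have lt : i * r + l < r * r.
  apply: (@leq_trans (i.+1 * r)); last by rewrite leq_mul2r ir orbT.
  by rewrite mulSn addnC ltn_add2r.
have := swaps_zip_l pi (i := i * r + l) replace_sizes replace_uniq.
rewrite size_iota nth_iota // (nth_map 0) ?size_iota // nth_iota //.
rewrite add0n block_div // modnMDl modn_small // positionK // mulnDl addnA.
exact.
Qed.

Lemma replace_other s' : s' < m -> s' != s ->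
  forall i, i < r -> same_block r pi pi' (s' * r + i).
Proof.
move=> sm' ss' i ir x xr; apply: swaps_zip_out; first exact: replace_sizes.
  rewrite mem_iota; apply/negP => /andP[le1 le2].
  have E : (s' * r + i) * r + x = s' * (r * r) + (i * r + x).
    by rewrite mulnDl mulnA addnA.
  have lt : i * r + x < r * r.
    apply: (@leq_trans (i.+1 * r)); last by rewrite leq_mul2r ir orbT.
    by rewrite mulSn addnC ltn_add2r.
  have := @block_index_inj (r * r) s' s (i * r + x) (s' * (r * r) + (i * r + x) - s * (r * r)) lt.
  move: le1 le2; rewrite E -mulnA => le1 le2; rewrite subnKC // => /(_ _ erefl)[].
    by move: le1 le2; clear; lia.
  by move=> Es _; move: ss'; rewrite Es eqxx.
apply/negP => /outer_ge/andP[+ _]; rewrite leqNgt => /negP; apply.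
apply: (@leq_trans ((s' * r + i).+1 * r)).
  by rewrite mulSn addnC ltn_add2r.
by rewrite leq_mul2r slot_block ?orbT.
Qed.

Lemma replace_small : size replace_pairs <= r * r /\
  all (fun pq => (pq.1 < k * r) && (pq.2 < k * r)) replace_pairs.
Proof.
split; first by rewrite size_zip -replace_sizes minnn size_iota.
apply/allP => -[p p'] /mem_zip[/inner_lt pA /outer_ge/andP[_ ->]].
by rewrite andbT (leq_trans pA) // leq_mul2r m_small orbT.
Qed.

Hypotheses
  (w_row : forall i l l', i < r -> l < r -> l' < r -> l != l' -> e (w i l) (w i l'))
  (w_col : forall i i', i < r -> i' < r -> i != i' -> e (w i 0) (w i' 0)).

Lemma replace_valid : valid pi' s.
Proof.
apply/(validP esym r_gt2); split=> [i ir|i i' ir ir' ii'].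
  by apply/(prefix_cliqueP esym) => l l' lr lr' ll'; rewrite !replace_slot ?w_row.
rewrite -[_ * r]addn0 -[(s * r + i') * r]addn0.
by rewrite !replace_slot // w_col.
Qed.

Lemma replace_absorbs u : absorbs pi' s u =
  [forall i : 'I_r, forall l : 'I_r, (0 < l) ==> e (X u i) (w i l)].
Proof.
apply/(absorbsP e X r_gt2)/'forall_forallP => H i l.
  by apply/implyP => l0; rewrite -replace_slot // H // l0 /=.
move=> ir /andP[l0 lr]; rewrite replace_slot //.
exact: (implyP (H (Ordinal ir) (Ordinal lr))).
Qed.

Lemma replace_hits (u : nat) : let x := valid pi s && absorbs pi s u in
  hits pi' u + x = hits pi u + absorbs pi' s u.
Proof.
rewrite /= /hits (bigD1 (Ordinal sm)) //= [in RHS](bigD1 (Ordinal sm)) //=.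
rewrite replace_valid /= addnAC [RHS]addnAC; congr (_ + _).
  by rewrite addnC.
apply: eq_bigr => s' ss'; have oth := replace_other (ltn_ord s') ss'.
by rewrite (valid_same esym r_gt2 oth) (absorbs_same e X r_gt2 oth).
Qed.

(** A tuple gains if it was below the cap and is absorbed by the new slot; it can lose only if the
    old slot absorbed it and it was not above the cap. The balance is written additively because
    subtraction on naturals is truncated. *)
Lemma replace_supply :
  supply pi + ~~ valid pi s +
    \sum_(u < N) ((hits pi u < c0) && absorbs pi' s u) <=
  supply pi' + \sum_(u < N) [&& valid pi s, absorbs pi s u & hits pi u <= c0].
Proof.
have le1 : \sum_(s < m) (valid pi s : nat) + ~~ valid pi s <=
    \sum_(s < m) (valid pi' s : nat).
  rewrite (bigD1 (Ordinal sm)) //= [leqRHS](bigD1 (Ordinal sm)) //= replace_valid.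
  rewrite addnAC leq_add //; first by case: valid.
  apply: leq_sum => s' ss'.
  by rewrite (valid_same esym r_gt2 (replace_other (ltn_ord s') ss')).
have le2 : \sum_(u < N) minn (hits pi u) c0 +
    \sum_(u < N) ((hits pi u < c0) && absorbs pi' s u) <=
    \sum_(u < N) minn (hits pi' u) c0 +
    \sum_(u < N) [&& valid pi s, absorbs pi s u & hits pi u <= c0].
  rewrite -!big_split; apply: leq_sum => u _ /=.
  have := replace_hits u; rewrite /= [in X in _ <= _ + X]andbA.
  move: (hits pi' u) (hits pi u) (valid pi s && _) (absorbs pi' s u).
  rewrite /minn => h' h x z; case: (ltnP h c0) (ltnP h' c0) (leqP h c0) => ? [] ? [] ?;
    by case: x z => [] [] /=; lia.
rewrite /supply; move: le1 le2.
move: (\sum_(s < m) _) (\sum_(s < m) _) (\sum_(u < N) _) (\sum_(u < N) _) (\sum_(u < N) _) (\sum_(u < N) _).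
by clear; lia.
Qed.

End Replace.

(** Replacing an invalid slot loses nothing, so no slot is invalid. If the set [U] of scarce tuples
    had more than N / d elements, some absorber would serve |U| / G^r of them, while the cheapest
    slot loses at most c0 N / m; by [m_large] the gain prevails. *)
Lemma supply_max : local_max r k supply pi ->
  (forall s, s < m -> valid pi s) /\ scarce e r m N X pi c0 * d <= N.
Proof.
move=> max.
have absorber (U : {set 'I_N}) : 0 < #|U| -> _ :=
  @absorber_exists T e r k esym eirr r_gt2 cardT k_gt0 a b g (m * r * r)
    nonnbh dense b_small b_large O card_inner N (fun u => X u) U.
have stuck s w : s < m -> 
    (forall i l i' l', i < r -> l < r -> i' < r -> l' < r ->
       w i l = w i' l' -> i = i' /\ l = l') ->
    (forall i l, i < r -> l < r -> w i l \in O) ->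
    (forall i l l', i < r -> l < r -> l' < r -> l != l' -> e (w i l) (w i l')) ->
    (forall i i', i < r -> i' < r -> i != i' -> e (w i 0) (w i' 0)) ->
    ~~ valid pi s + #|[set u in [set u : 'I_N | hits pi u < c0] |
       [forall i : 'I_r, forall l : 'I_r, (0 < l) ==> e (X u i) (w i l)]]| <=
    \sum_(u < N) [&& valid pi s, absorbs pi s u & hits pi u <= c0].
  move=> sm w_inj w_out w_row w_col.
  have := replace_supply sm w_inj w_out w_row w_col.
  have [s1 s2] := replace_small sm w_out.
  have := max _ s1 s2; set pi' := swaps _ _.
  have -> : \sum_(u < N) ((hits pi u < c0) && absorbs pi' s u) =
     #|[set u in [set u : 'I_N | hits pi u < c0] |
       [forall i : 'I_r, forall l : 'I_r, (0 < l) ==> e (X u i) (w i l)]]|.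
    rewrite -sum1_card [RHS]big_mkcond /=; apply: eq_bigr => u _.
    by rewrite !inE (replace_absorbs sm w_inj w_out) //; case: (_ && _).
  by clear; lia.
have allvalid s : s < m -> valid pi s.
  move=> sm; apply/negPn/negP => nv.
  have [|w [w1 w2 w3 w4 _]] := absorber [set: 'I_N].
    by rewrite cardsT card_ord.
  have := stuck s w sm w1 w2 w3 w4; rewrite nv (negPf nv) /= big1 //.
split=> //; rewrite leqNgt; apply/negP => large.
pose U := [set u : 'I_N | hits pi u < c0].
have cardU : scarce e r m N X pi c0 = #|U|.
  rewrite -sum1_card [RHS]big_mkcond /=; apply: eq_bigr => u _.
  by rewrite inE; case: (_ < _).
rewrite cardU in large.
have U0 : 0 < #|U| by case: posnP large => // ->; rewrite mul0n.
have [w [w1 w2 w3 w4 w5]] := absorber U U0.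
pose loss s := \sum_(u < N) [&& valid pi s, absorbs pi s u & hits pi u <= c0].
(* A tuple with at most [c0] hits is charged to at most [c0] slots, any other tuple to none. *)
have sum_loss : \sum_(s < m) loss s <= c0 * N.
  rewrite exchange_big /= mulnC -[N in N * _]card_ord -sum_nat_const.
  apply: leq_sum => u _; case: (leqP (hits pi u) c0) => [le|lt].
    by apply: leq_trans le; apply: leq_sum => s _; rewrite andbT.
  by rewrite big1 // => s _; rewrite !andbF.
have [s loss_s] : exists s : 'I_m, m * loss s <= c0 * N.
  apply/existsP; rewrite -[X in is_true X]negbK negb_exists; apply/negP => /forallP H.
  have : \sum_(s < m) c0 * N < \sum_(s < m) m * loss s.
    rewrite (bigD1 (Ordinal m_gt0)) //= [ltnRHS](bigD1 (Ordinal m_gt0)) //=.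
    rewrite -addSn leq_add //; first by rewrite ltnNge; exact: (H (Ordinal m_gt0)).
    by apply: leq_sum => s _; apply: ltnW; rewrite ltnNge; apply: H.
  by rewrite sum_nat_const card_ord -big_distrr /= ltn_mul2l m_gt0 /= ltnNge sum_loss.
have := stuck s w (ltn_ord s) w1 w2 w3 w4; rewrite {1}allvalid // add0n -/U -/(loss s).
move: w5 loss_s large m_large U0; rewrite -/G; move: m_gt0.
move: #|[set u in U | _]| #|U| (loss s) (G ^ r); clear => gain u1 l1 g1 m0 H1 H2 H3 H4 u0 H6.
have K1 : u1 <= g1 * l1 by apply: leq_trans H1 _; rewrite leq_mul2l H6 orbT.
have g0 : 0 < g1 by case: (posnP g1) K1 u0 => // ->; rewrite mul0n leqn0 => /eqP->.
have c_gt0 : 0 < c0.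
  case: (posnP c0) H2 => // ->; rewrite mul0n leqn0 muln_eq0 eqn0Ngt m0 /=.
  by move/eqP => l0; move: K1 u0; rewrite l0 muln0 leqn0 => /eqP->.
have K2 : m * u1 <= g1 * (c0 * N).
  apply: (@leq_trans (m * (g1 * l1))); first by rewrite leq_mul2l K1 orbT.
  by rewrite mulnCA leq_mul2l H2 orbT.
have K3 : g1 * (c0 * N) < g1 * (c0 * (u1 * d)) by rewrite !ltn_mul2l g0 c_gt0 H3.
have K4 : g1 * c0 * d * u1 <= m * u1 by rewrite leq_mul2r H4 orbT.
by move: K2 K3 K4; clear; lia.
Qed.

End Supply.

(** Only the number of good extensions is bounded; the set of extensions may depend on the prefix,
    so this is not the cardinality of a product. *)
Lemma card_stepwise_tuples (T : finType) (P : seq T -> bool) (q n : nat) :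
  P [::] ->
  (forall s, size s < n -> P s -> q <= #|[set x | P (rcons s x)]|) ->
  q ^ n <= #|[set t : n.-tuple T | P t]|.
Proof.
move=> P0; elim: n => [|n IH] step.
  by apply/card_gt0P; exists [tuple]; rewrite inE.
pose D := [set p : n.-tuple T * T | P p.1 && P (rcons p.1 p.2)].
have inj_rcons : injective (fun p : n.-tuple T * T => [tuple of rcons p.1 p.2]).
  move=> [t x] [t' x'] /(congr1 val) /= /rcons_inj[E ->].
  by congr (_, _); apply: val_inj.
apply: (@leq_trans #|D|).
  apply: (@leq_trans (\sum_(t : n.-tuple T | P t) #|[set x | P (rcons t x)]|)).
    apply: (@leq_trans (\sum_(t : n.-tuple T | P t) q)).
      rewrite sum_nat_const mulnC expnS leq_mul2l; apply/orP; right.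
      have := IH (fun s sn => step s (ltnW sn)); move/leq_trans; apply.
      by rewrite cardsE.
    by apply: leq_sum => t Pt; apply: step; rewrite ?size_tuple.
  under eq_bigr => t _ do rewrite -sum1_card.
  rewrite pair_big_dep /= sum1_card; apply: subset_leq_card.
  by apply/subsetP => -[t x]; rewrite unfold_in /= !inE.
rewrite -(card_imset _ inj_rcons); apply: subset_leq_card.
by apply/subsetP => y /imsetP[[t x] + ->]; rewrite !inE => /andP[].
Qed.

(** * Repairing a block by means of an absorber *)

Section Advance.
Variables (T : finType) (e : rel T) (r k m N d : nat) (X : nat -> nat -> T).
Variable pi : nat -> T.
Hypotheses (esym : symmetric e) (eirr : irreflexive e) (r_gt2 : 2 < r).
Hypotheses (cardT : #|T| = k * r) (k_gt0 : 0 < k) (N_def : N = (k * r) ^ r).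
Hypothesis inj : {in [pred x | x < k * r] &, injective pi}.
Hypothesis X_onto : forall y : nat -> T,
  exists u : 'I_N, forall i, i < r -> X u i = y i.
Variable a : nat.
Hypothesis nonnbh : forall v, #|~: nbh e v| <= k + a.
Hypothesis k_large : 3 * (a + 2 * (m * r + m) + r * r) <= 2 * k.
Hypothesis d_large : (3 * r) ^ r < d.

Let r0 : 0 < r. Proof. exact: ltn_trans r_gt2. Qed.
Notation full := (full e r).
Notation valid := (valid e r).
Notation absorbs := (absorbs e r X).
Notation hits := (hits e r m X).
Notation nonfull := (nonfull e r k).
Notation scarce := (scarce e r m N X).
Notation block_of := (block_of r k pi).

Lemma nonadjacent_le v :
  \sum_(t < k) count (fun i => ~~ e v (pi (t * r + i))) (iota 0 r) <= k + a.
Proof.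
rewrite (sum_blocks cardT inj (fun u => ~~ e v u)) -cardsE.
apply: leq_trans (nonnbh v); apply: subset_leq_card.
by apply/subsetP => u; rewrite !inE.
Qed.

(** [x] can take the place of such a [y], and the block of [y] stays a clique. *)
Definition replaceable x : {set T} :=
  [set y | [&& m * r <= block_of y, full pi (block_of y) &
    [forall l : 'I_r, (pi (block_of y * r + l) != y) ==>
       e x (pi (block_of y * r + l))]]].

(** In a full outer block without non-neighbours of [x] all r >= 2 vertices are replaceable, and if
    there is exactly one non-neighbour, it is replaceable itself. So replaceable vertices and
    non-neighbours together number at least 2 per block, and the non-neighbours use up only k + a of
    these 2 k. *)
Lemma card_replaceable x :
  2 * k <= #|replaceable x| + (k + a) + 2 * (m * r + nonfull pi).
Proof.
have := nonadjacent_le x.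
rewrite /replaceable (count_config cardT inj (fun t y =>
  [&& m * r <= t, full pi t & [forall l : 'I_r, (pi (t * r + l) != y) ==>
     e x (pi (t * r + l))]])).
move=> nonadj; apply: leq_trans (leq_add (leq_add (leqnn _) nonadj) (leqnn _)).
have inner : \sum_(t < k) (t < m * r : nat) <= m * r.
  case: (leqP (m * r) k) => [le|/ltnW le].
    rewrite (eq_bigr (fun t : 'I_k => if t < m * r then 1 else 0)) //.
    by rewrite -big_mkcond -(big_ord_widen _ (fun=> 1)) // sum1_card card_ord.
  apply: leq_trans le; rewrite -[leqRHS]card_ord -sum1_card leq_sum // => t _.
  by case: (_ < _).
apply: leq_trans (leq_add (leqnn _) (leq_mul (leqnn 2) (leq_add inner (leqnn _)))).
rewrite -[k in leqLHS]card_ord mulnC -sum_nat_const.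
rewrite /nonfull -!big_split big_distrr -!big_split; apply: leq_sum => t _ /=.
case: (leqP (m * r) t) => [mt|_]; last first.
  by rewrite mulnDr (leq_trans _ (leq_addl _ _)) // leq_addr.
case: (boolP (full pi t)) => [ft|_]; last first.
  by rewrite muln1 (leq_trans _ (leq_addl _ _)).
rewrite /= muln0 addn0.
set c := count _ _; set c' := count _ _.
have [le2|lt2] := leqP 2 c'; first exact: leq_trans le2 (leq_addl _ _).
have [i0 i0r Hi0] : exists2 i0, i0 < r &
    forall l, l < r -> ~~ e x (pi (t * r + l)) -> l = i0.
  have [/hasP[i0]|/hasPn none] := boolP (has (fun i => ~~ e x (pi (t * r + i))) (iota 0 r)).
    rewrite mem_iota => i0r ni0; exists i0 => // l lr nl; apply/eqP.
    have : size (filter (fun i => ~~ e x (pi (t * r + i))) (iota 0 r)) < 2.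
      by rewrite size_filter.
    rewrite ltnNge; apply: contraR => li.
    have : {subset [:: l; i0] <= filter (fun i => ~~ e x (pi (t * r + i))) (iota 0 r)}.
      move=> z; rewrite !inE mem_filter mem_iota.
      by case/orP => /eqP->; rewrite ?nl ?ni0 /= add0n.
    by move/uniq_leq_size; apply; rewrite /= inE li.
  by exists 0 => // l lr nl; have := none l; rewrite mem_iota lr nl => /(_ isT).
have good i : i < r -> (i == i0) || (c' == 0) ->
    [forall l : 'I_r, (pi (t * r + l) != pi (t * r + i)) ==> e x (pi (t * r + l))].
  move=> ir H; apply/forallP => l; apply/implyP; apply: contraR => nl.
  have El : val l = i0 := Hi0 _ (ltn_ord l) nl.
  case/orP: H => [/eqP->|]; first by rewrite -El.
  rewrite /c' -leqn0 leqNgt -has_count => /hasPn/(_ l).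
  by rewrite mem_iota ltn_ord nl => /(_ isT).
have [c0|c1] := posnP c'.
  have -> : c = r.
    rewrite -[RHS](size_iota 0); apply/eqP; rewrite -all_count.
    by apply/allP => i; rewrite mem_iota => ir; rewrite /= good ?c0 ?orbT.
  exact: leq_trans (ltnW r_gt2) (leq_addr _ _).
have c2 : 0 < c.
  rewrite -has_count; apply/hasP; exists i0; rewrite ?mem_iota //.
  by rewrite /= good ?eqxx.
exact: leq_add c2 c1.
Qed.

Lemma card_blocks (bs : seq nat) : #|[set v | block_of v \in bs]| <= size bs * r.
Proof.
elim: bs => [|b bs IH].
  by rewrite leqn0 cards_eq0; apply/eqP/setP => v; rewrite !inE.
have [v bv|nb] := pickP (fun v => block_of v == b); last first.
  rewrite (_ : [set v | _] = [set v | block_of v \in bs]).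
    by rewrite (leq_trans IH) // leq_mul2r leqnSn orbT.
  by apply/setP => v; rewrite !inE nb.
rewrite /= mulSn (leq_trans _ (leq_add (card_same_block r_gt2 cardT inj v) IH)) //.
apply: leq_trans (leq_card_setU _ _).1; apply: subset_leq_card.
by apply/subsetP => u; rewrite !inE (eqP bv).
Qed.

Lemma targets_exist (x : nat -> T) : 0 < nonfull pi -> scarce pi (nonfull pi) * d <= N ->
  exists (y : seq T) (s : 'I_m),
  [/\ size y = r, uniq [seq block_of v | v <- y],
      forall x0 i, i < r -> nth x0 y i \in replaceable (x i), valid pi s &
      forall x0 i l, i < r -> 0 < l < r ->
        e (nth x0 y i) (pi ((s * r + i) * r + l))].
Proof.
set f := nonfull pi => f0 ok.
have N0 : 0 < N by rewrite N_def expn_gt0 muln_gt0 k_gt0 r0.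
have d1 : 1 < d.
  by apply: leq_trans d_large; rewrite ltnS expn_gt0 muln_gt0 r0.
(* Otherwise every tuple would be scarce, as none has more than [m] hits. This bounds the number of
   non-cliques by a constant. *)
have fm : f <= m.
  have [/existsP[u uf]|/existsPn none] := boolP [exists u : 'I_N, f <= hits pi u].
    exact: leq_trans uf (hits_le _ _ _ _ _ _).
  have : scarce pi f = N.
    rewrite /scarce -[RHS]card_ord -sum1_card; apply: eq_bigr => u _.
    by rewrite ltnNge none.
  by move=> E; move: ok; rewrite E leqNgt -[ltnLHS]muln1 ltn_mul2l N0 d1.
pose q := k - (a + 2 * (m * r + m) + r * r).
have q3 : k <= 3 * q by rewrite /q mulnBr; move: k_large; clear; lia.
have q0 : 0 < q by move: q3 k_gt0; clear; lia.
have x0 : T := x 0.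
pose P s := uniq [seq block_of v | v <- s] &&
  all (fun i => nth x0 s i \in replaceable (x i)) (iota 0 (size s)).
have cnt : q ^ r <= #|[set t : r.-tuple T | P t]|.
  apply: card_stepwise_tuples => // s sr /andP[us /allP rs].
  pose used := [set v | block_of v \in [seq block_of w | w <- s]].
  have le1 : #|replaceable (x (size s)) :\: used| <= #|[set v | P (rcons s v)]|.
    apply: subset_leq_card; apply/subsetP => v.
    rewrite in_setD => /andP[nu rv].
    have nv : block_of v \notin [seq block_of w | w <- s] by move: nu; rewrite inE.
    rewrite inE /P map_rcons rcons_uniq nv us /=; apply/allP => i.
    rewrite size_rcons mem_iota /= add0n ltnS leq_eqVlt nth_rcons.
    case/orP => [/eqP->|is_]; first by rewrite ltnn eqxx.
    by rewrite is_ rs // mem_iota.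
  have le2 : #|replaceable (x (size s))| <=
      #|replaceable (x (size s)) :\: used| + r * r.
    rewrite -(cardsID used) addnC leq_add2l.
    rewrite (leq_trans (subset_leq_card (subsetIr _ _))) //.
    rewrite (leq_trans (card_blocks _)) // size_map leq_mul2r ltnW ?orbT //.
  have := card_replaceable (x (size s)); rewrite -/f.
  move: le1 le2 fm; rewrite /q; clear; lia.
have [phi Hphi] : exists phi : r.-tuple T -> 'I_N,
    forall t i, i < r -> X (phi t) i = nth x0 t i.
  have H (t : r.-tuple T) : exists u : 'I_N, forall i, i < r -> X u i = nth x0 t i.
    exact: X_onto.
  by have [phi ?] := fin_all_exists H; exists phi.
have phi_inj : injective phi.
  move=> t t' E; apply: val_inj; apply: (@eq_from_nth _ x0); rewrite ?size_tuple // => i ir.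
  by rewrite -!Hphi // E.
have [t Pt ht] : exists2 t : r.-tuple T, P t & f <= hits pi (phi t).
  apply/exists_inP; rewrite -[X in is_true X]negbK negb_exists_in.
  apply/negP => /forall_inP none.
  have le : q ^ r <= scarce pi f.
    apply: leq_trans cnt _; rewrite -(card_imset _ phi_inj) -sum1_card big_mkcond /=.
    apply: leq_sum => u _; case: ifP => // /imsetP[t]; rewrite inE => /none.
    by rewrite -ltnNge => h ->; rewrite h.
  have : N <= (3 * r) ^ r * scarce pi f.
    apply: (@leq_trans ((3 * r) ^ r * q ^ r)); last by rewrite leq_mul2l le orbT.
    rewrite N_def -expnMn leq_exp2r // mulnAC leq_mul2r mulnC.
    by rewrite [X in _ <= X]mulnC q3 orbT.
  move/(leq_trans ok); rewrite mulnC leq_mul2r leqNgt d_large orbF.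
  by move/eqP => E; move: le; rewrite E leqn0 expn_eq0 -leqn0 leqNgt q0.
have [s] : exists s : 'I_m, valid pi s && absorbs pi s (phi t).
  apply/existsP; apply: contraTT ht; rewrite negb_exists => /forallP none.
  by rewrite -ltnNge /hits big1 // => s _; rewrite (negPf (none s)).
case/andP => vs /(absorbsP e X r_gt2) abs; exists t, s.
case/andP: Pt => ut /allP rt.
have dflt y0 i : i < r -> nth y0 t i = nth x0 t i.
  by move=> ir; apply: set_nth_default; rewrite size_tuple.
split=> //; first by rewrite size_tuple.
  by move=> y0 i ir; rewrite dflt // rt // size_tuple mem_iota.
by move=> y0 i l ir lr; rewrite dflt // -Hphi // abs.
Qed.

(** The bad block [b] trades its vertices for the targets [y], and then these for the first vertices
    of the rows of slot [s]. Thus [b] becomes the clique of first vertices, the rows continue with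
    the targets in front, and the blocks of the targets keep the vertices of [b] as substitutes. *)
Lemma advance : 0 < nonfull pi -> scarce pi (nonfull pi) * d <= N ->
  exists ps, [/\ size ps <= r * r,
    all (fun pq => (pq.1 < k * r) && (pq.2 < k * r)) ps,
    nonfull (swaps pi ps) < nonfull pi &
    scarce (swaps pi ps) (nonfull (swaps pi ps)) * d <= N].
Proof.
move=> f0 ok.
have mk : m * r <= k by move: k_large; clear; lia.
have [b nb] : exists b : 'I_k, ~~ full pi b.
  apply/existsP; apply: contraTT f0; rewrite negb_exists => /forallP H.
  by rewrite -leqNgt leqn0 /nonfull big1 // => b _; rewrite (negPf (H b)).
have [y [s [sy uy ry vs abs]]] := targets_exist (fun i => pi (b * r + i)) f0 ok.
have [full_s col_s] := validP esym r_gt2 _ _ vs.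
have x0 : T := pi 0.
pose Y i := nth x0 y i.
have sr i : i < r -> s * r + i < m * r by apply: slot_block.
have b_ns i : i < r -> s * r + i != b :> nat.
  by move=> ir; apply: contraNneq nb => <-; apply: full_s.
have Yrep i : i < r -> Y i \in replaceable (pi (b * r + i)) by apply: ry.
have Yout i : i < r -> m * r <= block_of (Y i).
  by move/Yrep; rewrite inE => /and3P[].
have Yfull i : i < r -> full pi (block_of (Y i)).
  by move/Yrep; rewrite inE => /and3P[].
have Yadj i l : i < r -> l < r -> pi (block_of (Y i) * r + l) != Y i ->
    e (pi (b * r + i)) (pi (block_of (Y i) * r + l)).
  move=> ir lr ne; have := Yrep i ir; rewrite inE => /and3P[_ _ /forallP H].
  exact: (implyP (H (Ordinal lr))).
have Yinj i i' : i < r -> i' < r -> block_of (Y i) = block_of (Y i') -> i = i'.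
  move=> ir ir' E; apply/eqP.
  by rewrite -(nth_uniq 0 _ _ uy) ?size_map ?sy // !(nth_map x0) ?sy ?E.
have Yb i : i < r -> block_of (Y i) != b.
  by move=> ir; apply: contraNneq nb => <-; apply: Yfull.
have Ys i i' : i < r -> i' < r -> block_of (Y i) != s * r + i'.
  move=> ir ir'; apply: contraTneq (Yout i ir) => ->.
  by rewrite -ltnNge sr.
pose A := iota (b * r) r.
pose B := [seq position r k pi (Y i) | i <- iota 0 r].
pose C := [seq (s * r + i) * r | i <- iota 0 r].
have sAB : size A = size B by rewrite size_map !size_iota.
have sAC : size A = size C by rewrite size_map !size_iota.
have Adiv p : p \in A -> p %/ r = b.
  rewrite mem_iota => /andP[le1 le2]; rewrite -(subnKC le1) block_div //.
  by move: le1 le2; clear; lia.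
have Bdiv p : p \in B -> exists2 i, i < r & p %/ r = block_of (Y i).
  by case/mapP => i; rewrite mem_iota => ir ->; exists i.
have Cdiv p : p \in C -> exists2 i, i < r & p %/ r = s * r + i.
  by case/mapP => i; rewrite mem_iota => ir ->; exists i; rewrite ?mulnK.
have posK i : pi (position r k pi (Y i)) = Y i by apply: (positionK cardT inj).
have uAB : uniq (A ++ B).
  rewrite cat_uniq iota_uniq map_inj_in_uniq ?iota_uniq ?andbT.
    apply/hasPn => p /Bdiv[i ir E]; apply/negP => /Adiv; rewrite E.
    exact/eqP/Yb.
  by move=> i i'; rewrite !mem_iota => ir ir' E; apply: Yinj => //; rewrite /block_of E.
have uAC : uniq (A ++ C).
  rewrite cat_uniq iota_uniq map_inj_in_uniq ?iota_uniq ?andbT.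
    apply/hasPn => p /Cdiv[i ir E]; apply/negP => /Adiv; rewrite E.
    exact/eqP/b_ns.
  by move=> i i' _ _ /eqP; rewrite eqn_pmul2r // eqn_add2l => /eqP.
have nthA i : i < r -> nth 0 A i = b * r + i by apply: nth_iota.
have nthB i : i < r -> nth 0 B i = position r k pi (Y i).
  by move=> ir; rewrite (nth_map 0) ?size_iota // nth_iota.
have nthC i : i < r -> nth 0 C i = (s * r + i) * r.
  by move=> ir; rewrite (nth_map 0) ?size_iota // nth_iota.
pose pi1 := swaps pi (zip A B); pose pi2 := swaps pi1 (zip A C).
have pi1A i : i < r -> pi1 (b * r + i) = Y i.
  by move=> ir; rewrite -nthA // /pi1 (swaps_zip_l _ sAB uAB) ?size_iota // nthB // posK.
have pi1B i : i < r -> pi1 (position r k pi (Y i)) = pi (b * r + i).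
  by move=> ir; rewrite -nthB // /pi1 (swaps_zip_r _ sAB uAB) ?size_iota // nthA.
have pi1out p : p \notin A -> p \notin B -> pi1 p = pi p.
  exact: swaps_zip_out.
have pi2A i : i < r -> pi2 (b * r + i) = pi ((s * r + i) * r).
  move=> ir; rewrite -nthA // /pi2 (swaps_zip_l _ sAC uAC) ?size_iota // nthC //.
  apply: pi1out; apply/negP.
    by move/Adiv; rewrite mulnK // => /eqP; apply/negP/b_ns.
  by case/Bdiv => i' ir'; rewrite mulnK // => E; have := Ys _ _ ir' ir; rewrite E eqxx.
have pi2C i : i < r -> pi2 ((s * r + i) * r) = Y i.
  by move=> ir; rewrite -nthC // /pi2 (swaps_zip_r _ sAC uAC) ?size_iota // nthA // pi1A.
have pi2out p : p \notin A -> p \notin C -> pi2 p = pi1 p.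
  exact: swaps_zip_out.
have same (c : nat) : c != b :> nat -> (forall i, i < r -> c != block_of (Y i)) ->
    (forall i, i < r -> c != s * r + i) -> same_block r pi pi2 c.
  move=> cb cY cs x xr; have xA : c * r + x \notin A.
    by apply/negP => /Adiv; rewrite block_div //; apply/eqP.
  rewrite pi2out ?pi1out //; apply/negP.
    by case/Bdiv => i ir; rewrite block_div //; apply/eqP/cY.
  by case/Cdiv => i ir; rewrite block_div //; apply/eqP/cs.
have full_b : full pi2 b.
  by apply/(prefix_cliqueP esym) => i i' ir ir' ii'; rewrite !pi2A // col_s.
have full_Y i : i < r -> full pi2 (block_of (Y i)).
  move=> ir; have E l : l < r -> pi2 (block_of (Y i) * r + l) =
      if block_of (Y i) * r + l == position r k pi (Y i) then pi (b * r + i)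
      else pi (block_of (Y i) * r + l).
    move=> lr; rewrite pi2out.
    - case: eqP => [->|ne]; first exact: pi1B.
      apply: pi1out; apply/negP.
        by move/Adiv; rewrite block_div //; apply/eqP/Yb.
      case/mapP => i'; rewrite mem_iota => ir' E; apply: ne; rewrite E.
      congr (position _ _ _ (Y _)); apply: Yinj => //.
      by rewrite /block_of -E block_div.
    - by apply/negP => /Adiv; rewrite block_div //; apply/eqP/Yb.
    - by apply/negP => /Cdiv[i' ir']; rewrite block_div //; apply/eqP/Ys.
  have ne l : block_of (Y i) * r + l != position r k pi (Y i) -> l < r ->
      pi (block_of (Y i) * r + l) != Y i.
    move=> H lr; apply: contraNneq H => E1; apply/eqP.
    rewrite -[X in position _ _ _ X]E1 (configK cardT inj) //.
    apply: (@leq_trans ((block_of (Y i)).+1 * r)).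
      by rewrite mulSn addnC ltn_add2r.
    by rewrite leq_mul2r block_of_lt ?orbT.
  apply/(prefix_cliqueP esym) => l l' lr lr' ll'; rewrite !E //.
  case: eqP => [El|/eqP nl]; case: eqP => [El'|/eqP nl'].
  - by move: ll'; rewrite -(eqn_add2l (block_of (Y i) * r)) El El' eqxx.
  - exact/Yadj/ne.
  - by rewrite esym; apply/Yadj/ne.
  - by move/(prefix_cliqueP esym): (Yfull i ir); apply.
have full_slot i : i < r -> full pi2 (s * r + i).
  move=> ir; have E l : l < r -> 0 < l ->
      pi2 ((s * r + i) * r + l) = pi ((s * r + i) * r + l).
    move=> lr l0; have nA : (s * r + i) * r + l \notin A.
      by apply/negP => /Adiv; rewrite block_div //; apply/eqP/b_ns.
    rewrite pi2out ?pi1out //; apply/negP.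
      case/Bdiv => i' ir'; rewrite block_div // => E.
      by have := Ys _ _ ir' ir; rewrite E eqxx.
    case/mapP => i' _; rewrite -[(s * r + i') * r]addn0 => /block_index_inj[] //.
    by move=> _ l00; rewrite l00 in l0.
  have E0 : pi2 ((s * r + i) * r + 0) = Y i by rewrite addn0 pi2C.
  apply/(prefix_cliqueP esym) => -[|l] [|l'] lr lr' ll' //.
  - by rewrite E0 E // abs.
  - by rewrite E0 E // esym abs.
  - by rewrite !E //; move/(prefix_cliqueP esym): (full_s i ir); apply.
have full_mono (c : 'I_k) : full pi c -> full pi2 c.
  move=> fc; have cb : val c != b by apply: contraNneq nb => /val_inj <-.
  have [/hasP[i]|/hasPn cY] := boolP (has (fun i => val c == block_of (Y i)) (iota 0 r)).
    by rewrite mem_iota => ir /eqP ->; apply: full_Y.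
  have [/hasP[i]|/hasPn cs] := boolP (has (fun i => val c == s * r + i) (iota 0 r)).
    by rewrite mem_iota => ir /eqP ->; apply: full_slot.
  rewrite (@eq_full _ _ _ _ pi) //; apply: same => // i ir.
    by apply: cY; rewrite mem_iota.
  by apply: cs; rewrite mem_iota.
have lt_f : nonfull pi2 < nonfull pi.
  rewrite /nonfull (bigD1 b) //= [ltnRHS](bigD1 b) //= nb full_b ltnS.
  apply: leq_sum => c _; have := full_mono c.
  by case: (full pi c) => [->|]; case: (full pi2 c).
(* Only slot [s] is spent: another valid slot is untouched, because [b] is not full and the targets
   lie in outer blocks. *)
have hits_ge u : hits pi u <= (hits pi2 u).+1.
  rewrite /hits (bigD1 s) //= -add1n leq_add ?leq_b1 //.
  rewrite [leqRHS](bigD1 s) //= (leq_trans _ (leq_addl _ _)) //.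
  apply: leq_sum => s' ss'; case: (boolP (valid pi s')) => // vs'.
  have [full_s' _] := validP esym r_gt2 _ _ vs'.
  have sm i : i < r -> same_block r pi pi2 (s' * r + i).
    move=> ir; apply: same => [|i' ir'|i' ir'].
    - by apply: contraNneq nb => <-; apply: full_s'.
    - apply: contraTneq (Yout i' ir') => <-; rewrite -ltnNge.
      exact: slot_block.
    - apply: contraNneq ss' => /block_index_inj[] // E _.
      exact/eqP/val_inj.
  by rewrite (valid_same esym r_gt2 sm) vs' (absorbs_same e X r_gt2 sm).
exists (zip A B ++ zip A C); rewrite swaps_cat -/pi1 -/pi2; split=> //.
- rewrite size_cat !size_zip -sAB -sAC minnn size_iota addnn -mul2n.
  by rewrite leq_mul2r ltnW ?orbT.
- have ltk p : p %/ r < k -> p < k * r by rewrite ltn_divLR.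
  rewrite all_cat; apply/andP; split; apply/allP => -[p p'] /mem_zip[/Adiv pA].
    by case/Bdiv => i ir pB; rewrite !ltk ?pA ?pB ?block_of_lt.
  case/Cdiv => i ir pC; rewrite !ltk ?pA ?pC // (leq_trans (sr i ir)) //.
(* Each tuple loses at most one hit, while the required number of hits drops by at least one. *)
- apply: leq_trans ok; rewrite leq_mul2r; apply/orP; right.
  apply: leq_sum => u _; case: (ltnP (hits pi2 u) _) => // lt.
  rewrite lt0b; apply: leq_ltn_trans (hits_ge u) _.
  exact: leq_ltn_trans lt lt_f.
Qed.

End Advance.

Section LocalMax.
Variables (T : finType) (e : rel T) (r k m N d M : nat) (X : nat -> nat -> T).
Variable pi : nat -> T.
Hypotheses (esym : symmetric e) (eirr : irreflexive e) (r_gt2 : 2 < r).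
Hypotheses (cardT : #|T| = k * r) (k_gt0 : 0 < k) (N_def : N = (k * r) ^ r).
Hypothesis inj : {in [pred x | x < k * r] &, injective pi}.
Hypothesis X_onto : forall y : nat -> T,
  exists u : 'I_N, forall i, i < r -> X u i = y i.
Variables (a b g : nat).
Hypothesis nonnbh : forall v, #|~: nbh e v| <= k + a.
Hypothesis dense : forall Y : {set T}, k <= #|Y| + b ->
  #|T| ^ 2 <= g * \sum_(v in Y) #|Y :&: nbh e v|.
Hypotheses (b_small : b.*2 <= k) (g_small : g.*2 <= k) (M_gt0 : 0 < M).
Hypothesis M_large :
  r * (3 * r * ((m * r + r * M + a) * M + k.*2)) + M * r * (a + r) +
    2 * (k * r) * r <= M * b.
Hypothesis b_large : r * a + m * r * r + r + r * r <= b.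
Hypothesis k_large : 3 * (a + 2 * (m * r + m) + r * r) <= 2 * k.
Hypothesis d_large : (3 * r) ^ r < d.
Hypothesis m_large : (g * r.*2 ^ (r - 3)) ^ r * (r * M) * d <= m.
Hypothesis m_gt0 : 0 < m.

Notation score := (score e r k m N (r * M) d X).
Notation scarce := (scarce e r m N X).
Notation nonfull := (nonfull e r k).

Let r0 : 0 < r. Proof. exact: ltn_trans r_gt2. Qed.

Lemma nonfull_le_k pi' : nonfull pi' <= k.
Proof.
rewrite -[leqRHS]card_ord -sum1_card; apply: leq_sum => b' _.
exact: leq_b1.
Qed.

(** The cap [r * M] is the bound of [few_nonfull]: a supply that is good up to this cap suffices for
    the actual number of non-cliques, so the score cannot be in its lower case. In the upper case
    [advance] contradicts maximality as long as a non-clique is left. *)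
Lemma local_max_full : local_max r k score pi ->
  forall c, c < k -> full e r pi c.
Proof.
move=> max; have mk : m * r <= k by move: k_large; clear; lia.
have N_gt0 : 0 < N by rewrite N_def expn_gt0 muln_gt0 k_gt0 r0.
have ok : scarce pi (nonfull pi) * d <= N.
  apply/negPn/negP => inv.
  have [allvalid sc] : (forall s, s < m -> valid e r pi s) /\ scarce pi (r * M) * d <= N.
    apply: (supply_max esym eirr r_gt2 cardT k_gt0 N_gt0 inj nonnbh dense) => //.
    exact: (local_max_supply r_gt2 inv).
  have max_out := local_max_outer esym r_gt2 mk inv max.
  have := few_nonfull esym eirr r_gt2 cardT inj (max_out) nonnbh dense b_small
    g_small M_gt0 M_large.
  move=> few; apply: (negP inv); apply: scarce_max sc.
  apply: leq_trans few; rewrite -sum1_card big_mkcond /=; apply: leq_sum => c _.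
  rewrite inE; case: (leqP (m * r) c) => [_|cm]; first by case: full.
  have cE : val c = c %/ r * r + c %% r by apply: divn_eq.
  have := validP esym r_gt2 _ _ (allvalid (c %/ r) _).
  rewrite ltn_divLR // => /(_ cm) [/(_ (c %% r)) + _].
  by rewrite -cE ltn_mod r0 => ->.
have [f0|f_gt0] := posnP (nonfull pi).
  move=> c ck; apply: contraTT (leqnn (nonfull pi)) => nc.
  rewrite -ltnNge [ltnLHS]f0 /nonfull (bigD1 (Ordinal ck)) //= nc.
  exact: leq_addr.
have [ps [sps pps lt_f ok']] := advance esym r_gt2 cardT k_gt0 N_def inj X_onto
  nonnbh k_large d_large f_gt0 ok.
have := max ps sps pps; rewrite /score ok ok' leq_add2l.
rewrite leqNgt ltn_sub2l //; exact: leq_trans lt_f (nonfull_le_k _).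
Qed.

End LocalMax.

(** * Execution without overflow *)

(* The value without overflow. *)
Fixpoint ideal (s : state) (a : expr) : nat :=
  match a with
  | Const k => k
  | Reg x => regs s x
  | Read a1 => Defs.mem s (ideal s a1)
  | Bin o a1 a2 => binop_fun o (ideal s a1) (ideal s a2)
  end.

(* ideal s a <= B ^ degree_expr a when all stored values are at most B. *)
Fixpoint degree_expr (a : expr) : nat :=
  match a with
  | Const k => k.+1
  | Reg _ => 1
  | Read a1 => (degree_expr a1).+1
  | Bin _ a1 a2 => degree_expr a1 + degree_expr a2
  end.

Fixpoint degree_cmd (c : cmd) : nat :=
  match c with
  | Skip => 0
  | Assign _ a => degree_expr a
  | Write a b => maxn (degree_expr a) (degree_expr b)
  | Seq c1 c2 => maxn (degree_cmd c1) (degree_cmd c2)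
  | If a c1 c2 => maxn (degree_expr a) (maxn (degree_cmd c1) (degree_cmd c2))
  | While a c1 => maxn (degree_expr a) (degree_cmd c1)
  end.

Definition bounded (B : nat) (s : state) :=
  (forall x, regs s x <= B) /\ (forall x, Defs.mem s x <= B).

(* Execution without overflow and with all stored values at most B; by
   iexec_exec this is the real execution for words of O(log B) bits. *)
Inductive iexec (B : nat) : cmd -> state -> nat -> state -> Prop :=
  | IExecSkip s : iexec B Skip s 1 s
  | IExecAssign s x a : ideal s a <= B ->
      iexec B (Assign x a) s (cost a).+1 (set_reg s x (ideal s a))
  | IExecWrite s a b : ideal s b <= B ->
      iexec B (Write a b) s (cost a + cost b).+1
        (set_mem s (ideal s a) (ideal s b))
  | IExecSeq s1 s2 s3 c1 c2 t1 t2 :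
      iexec B c1 s1 t1 s2 -> iexec B c2 s2 t2 s3 ->
      iexec B (Seq c1 c2) s1 (t1 + t2) s3
  | IExecIfTrue s s' b c1 c2 t :
      ideal s b != 0 -> iexec B c1 s t s' ->
      iexec B (If b c1 c2) s (cost b + t).+1 s'
  | IExecIfFalse s s' b c1 c2 t :
      ideal s b = 0 -> iexec B c2 s t s' ->
      iexec B (If b c1 c2) s (cost b + t).+1 s'
  | IExecWhileTrue s1 s2 s3 b c t1 t2 :
      ideal s1 b != 0 -> iexec B c s1 t1 s2 -> iexec B (While b c) s2 t2 s3 ->
      iexec B (While b c) s1 (cost b + t1 + t2).+1 s3
  | IExecWhileFalse s b c :
      ideal s b = 0 -> iexec B (While b c) s (cost b).+1 s.

Section Transfer.
Variables (w B : nat).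
Hypothesis B2 : 1 < B.

Lemma degree_expr_gt0 a : 0 < degree_expr a.
Proof. by elim: a => //= o a1 H1 a2 H2; rewrite addn_gt0 H1. Qed.

Lemma ideal_le s a : bounded B s -> ideal s a <= B ^ degree_expr a.
Proof.
move=> [Hr Hm]; elim: a => [k|x|a IH|o a1 IH1 a2 IH2] /=.
(* Here k < B ^ k would do; the additional 1 in the degree of a constant keeps all degrees positive,
   so that both powers are at least 2 in the case of [Add], where x + y <= x y is used. *)
- apply: leq_trans (ltnW (ltn_expl k B2)) _; rewrite leq_exp2l //.
- by rewrite expn1.
- by apply: leq_trans (Hm _) _; rewrite -[leqLHS]expn1 leq_exp2l.
have pos a : 0 < B ^ degree_expr a by rewrite expn_gt0 ltnW.
have le1 : B ^ degree_expr a1 <= B ^ (degree_expr a1 + degree_expr a2).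
  by rewrite leq_exp2l // leq_addr.
have ge2 a : 2 <= B ^ degree_expr a.
  apply: leq_trans B2 _; rewrite -[leqLHS]expn1 leq_exp2l //.
  exact: degree_expr_gt0.
case: o => /=.
- rewrite expnD; apply: leq_trans (leq_add IH1 IH2) _.
  move: (ge2 a1) (ge2 a2); clear; nia.
- exact: leq_trans (leq_subr _ _) (leq_trans IH1 le1).
- by rewrite expnD leq_mul.
- exact: leq_trans (leq_div _ _) (leq_trans IH1 le1).
- exact: leq_trans (leq_mod _ _) (leq_trans IH1 le1).
- by apply: leq_trans (leq_b1 _) _; rewrite expn_gt0 ltnW.
- by apply: leq_trans (leq_b1 _) _; rewrite expn_gt0 ltnW.
Qed.

Lemma eval_ideal s a : bounded B s -> B ^ degree_expr a < 2 ^ w ->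
  eval w s a = ideal s a.
Proof.
move=> bs; elim: a => [k|x|a IH|o a1 IH1 a2 IH2] //=.
- by move=> lt; rewrite modn_small // (leq_ltn_trans _ lt) // (ideal_le (Const k) bs).
- by move=> lt; rewrite IH // (leq_ltn_trans _ lt) // leq_exp2l.
- move=> lt; rewrite IH1 ?IH2.
  + by rewrite modn_small // (leq_ltn_trans _ lt) // (ideal_le (Bin o a1 a2) bs).
  + by rewrite (leq_ltn_trans _ lt) // leq_exp2l // leq_addl.
  + by rewrite (leq_ltn_trans _ lt) // leq_exp2l // leq_addr.
Qed.

Lemma iexec_exec c s t s' : iexec B c s t s' -> bounded B s ->
  B ^ degree_cmd c < 2 ^ w -> exec w c s t s' /\ bounded B s'.
Proof.
have lt_max p q : B ^ maxn p q < 2 ^ w -> B ^ p < 2 ^ w /\ B ^ q < 2 ^ w.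
  by move=> lt; split; apply: leq_ltn_trans lt; rewrite leq_exp2l // ?leq_maxl ?leq_maxr.
elim=> {c s t s'} /=.
- by move=> s bs _; split=> //; constructor.
- move=> s x a aB bs lt; split; last first.
    by case: bs => Hr Hm; split=> //= y; rewrite /upd; case: eqP.
  by rewrite -(eval_ideal bs lt); constructor.
- move=> s a b bB bs /lt_max[lta ltb]; split; last first.
    by case: bs => Hr Hm; split=> //= y; rewrite /upd; case: eqP.
  by rewrite -(eval_ideal bs lta) -(eval_ideal bs ltb); constructor.
- move=> s1 s2 s3 c1 c2 t1 t2 _ IH1 _ IH2 bs /lt_max[lt1 lt2].
  have [e1 b1] := IH1 bs lt1; have [e2 b2] := IH2 b1 lt2.
  by split=> //; apply: ExecSeq e1 e2.
- move=> s s' b c1 c2 t nb _ IH bs /lt_max[ltb /lt_max[lt1 _]].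
  have [e1 b1] := IH bs lt1; split=> //.
  by apply: ExecIfTrue => //; rewrite (eval_ideal bs ltb).
- move=> s s' b c1 c2 t nb _ IH bs /lt_max[ltb /lt_max[_ lt2]].
  have [e1 b1] := IH bs lt2; split=> //.
  by apply: ExecIfFalse => //; rewrite (eval_ideal bs ltb).
- move=> s1 s2 s3 b c t1 t2 nb _ IH1 _ IH2 bs lt; have [ltb ltc] := lt_max _ _ lt.
  have [e1 b1] := IH1 bs ltc; have [e2 b2] := IH2 b1 lt.
  by split=> //; apply: ExecWhileTrue e1 e2; rewrite (eval_ideal bs ltb).
- move=> s b c nb bs /lt_max[ltb _]; split=> //.
  by apply: ExecWhileFalse; rewrite (eval_ideal bs ltb).
Qed.

End Transfer.

Section Triples.
Variable B : nat.

(** Total correctness with a time bound. [T] bounds the time only from above, so branches of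
    different length can share it. *)
Definition wp (c : cmd) (s : state) (T : nat) (Q : state -> Prop) :=
  exists t s', [/\ iexec B c s t s', t <= T & Q s'].

Lemma wp_weaken c s T T' (Q Q' : state -> Prop) : wp c s T Q -> T <= T' ->
  (forall s', Q s' -> Q' s') -> wp c s T' Q'.
Proof.
move=> [t [s' [H tT Qs]]] TT' QQ'; exists t, s'; split=> //.
  exact: leq_trans TT'.
exact: QQ'.
Qed.

Lemma wp_assign x a s (Q : state -> Prop) : ideal s a <= B ->
  Q (set_reg s x (ideal s a)) -> wp (Assign x a) s (cost a).+1 Q.
Proof. by move=> aB Qs; do 2!eexists; split; [constructor| |]. Qed.

Lemma wp_write a b s (Q : state -> Prop) : ideal s b <= B ->
  Q (set_mem s (ideal s a) (ideal s b)) ->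
  wp (Write a b) s (cost a + cost b).+1 Q.
Proof. by move=> aB Qs; do 2!eexists; split; [constructor| |]. Qed.

Lemma wp_seq c1 c2 s T1 T2 (Q : state -> Prop) :
  wp c1 s T1 (fun s' => wp c2 s' T2 Q) -> wp (Seq c1 c2) s (T1 + T2) Q.
Proof.
move=> [t1 [s1 [H1 le1 [t2 [s2 [H2 le2 Q2]]]]]]; exists (t1 + t2), s2.
by split; [apply: IExecSeq H1 H2|apply: leq_add|].
Qed.

Lemma wp_if b c1 c2 s T (Q : state -> Prop) :
  (ideal s b != 0 -> wp c1 s T Q) -> (ideal s b = 0 -> wp c2 s T Q) ->
  wp (If b c1 c2) s (cost b + T).+1 Q.
Proof.
move=> H1 H2; have [b0|/negPf nb] := eqVneq (ideal s b) 0.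
  have [t [s' [H le Qs]]] := H2 b0; exists (cost b + t).+1, s'.
  by split=> //; [apply: IExecIfFalse|rewrite ltnS leq_add2l].
have {}nb : ideal s b != 0 by rewrite nb.
have [t [s' [H le Qs]]] := H1 nb; exists (cost b + t).+1, s'.
by split=> //; [apply: IExecIfTrue|rewrite ltnS leq_add2l].
Qed.

Lemma wp_while_false b c s (Q : state -> Prop) : ideal s b = 0 -> Q s ->
  wp (While b c) s (cost b).+1 Q.
Proof. by move=> b0 Qs; do 2!eexists; split; [apply: IExecWhileFalse| |]. Qed.

Lemma wp_while_true b c s T1 T2 (Q : state -> Prop) : ideal s b != 0 ->
  wp c s T1 (fun s' => wp (While b c) s' T2 Q) ->
  wp (While b c) s (cost b + T1 + T2).+1 Q.
Proof.
move=> nb [t1 [s1 [H1 le1 [t2 [s2 [H2 le2 Q2]]]]]].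
exists (cost b + t1 + t2).+1, s2; split=> //; first exact: IExecWhileTrue H1 H2.
by rewrite ltnS leq_add // leq_add2l.
Qed.

Definition For (i : nat) (lim : expr) (body : cmd) : cmd :=
  Seq (Assign i (Const 0))
    (While (Bin Lt (Reg i) lim) (Seq body (Assign i (Bin Add (Reg i) (Const 1))))).

(** Each round costs [T] for the body, cost lim + 3 for the test and 4 for the increment; the
    initial assignment costs 2 and the final failing test cost lim + 3. *)
Definition for_time (lim : expr) (N T : nat) := N * (T + (cost lim + 7)) + (cost lim + 5).

(** The limit is evaluated anew in every round, hence its value must follow from the invariant; N <=
    B keeps the counter in range. *)
Lemma wp_for i lim body N T (Inv : nat -> state -> Prop) s (Q : state -> Prop) :
  N <= B ->
  (forall j s', j <= N -> Inv j s' -> ideal s' lim = N) ->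
  Inv 0 (set_reg s i 0) ->
  (forall j s', j < N -> Inv j s' -> regs s' i = j ->
     wp body s' T (fun s'' => regs s'' i = j /\ Inv j.+1 (set_reg s'' i j.+1))) ->
  (forall s', Inv N s' -> Q s') ->
  wp (For i lim body) s (for_time lim N T) Q.
Proof.
move=> NB Hlim Inv0 Hbody HQ.
suff H j s' : j <= N -> Inv (N - j) s' -> regs s' i = N - j ->
    wp (While (Bin Lt (Reg i) lim)
      (Seq body (Assign i (Bin Add (Reg i) (Const 1))))) s'
      (j * (T + (cost lim + 7)) + (cost lim + 3)) Q.
  have := H N (set_reg s i 0) (leqnn N); rewrite subnn => /(_ Inv0).
  rewrite /= /upd eqxx => /(_ erefl) HW.
  apply: wp_weaken (_ : _ <= _) (fun s' q => q); last first.
    rewrite /for_time; apply: (@leq_trans (2 + (N * (T + (cost lim + 7)) + (cost lim + 3)))) (leqnn _) _.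
    by rewrite addnCA leq_add2l addnC -addnA.
  by apply: wp_seq; apply: wp_assign.
elim: j s' => [|j IH] s' jN HI ri.
  rewrite subn0 in HI ri.
  apply: wp_weaken (_ : _ <= _) (fun s' q => q); last first.
    by rewrite mul0n add0n; apply: (_ : (cost (Bin Lt (Reg i) lim)).+1 <= _); rewrite /= addnC addn1 addn3.
  apply: wp_while_false; last exact: HQ.
  by rewrite /= ri (Hlim N) // ltnn.
have ltN : N - j.+1 < N by rewrite ltn_subrL (leq_trans _ jN).
have cont : ideal s' (Bin Lt (Reg i) lim) != 0.
  by rewrite /= ri (Hlim _ _ (ltnW ltN) HI) ltN.
apply: wp_weaken (wp_while_true (T1 := T + 4)
  (T2 := j * (T + (cost lim + 7)) + (cost lim + 3)) cont _) _ (fun s' q => q).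
  apply: wp_seq; apply: wp_weaken (Hbody _ _ ltN HI ri) (leqnn _) _ => s'' [ri'' HI''].
  apply: wp_assign; rewrite /= ri'' addn1; first exact: leq_trans ltN NB.
  have E : (N - j.+1).+1 = N - j by rewrite -subSn // subSS.
  by apply: IH; rewrite ?E // ?(ltnW jN) //=; [rewrite -E|rewrite /upd eqxx].
by rewrite mulSn /=; lia.
Qed.

End Triples.

(** * The local search program *)

(** Since [r] and [m] do not depend on the input, conjunctions over positions and slots are unrolled
    into single expressions of constant cost, with truth values multiplied. *)
Definition eprod (es : seq expr) : expr := foldr (Bin Mul) (Const 1) es.
Definition esum (es : seq expr) : expr := foldr (Bin Add) (Const 0) es.

Lemma ideal_eprod s es : ideal s (eprod es) = \prod_(x <- es) ideal s x.
Proof. by elim: es => [|x es IH] /=; rewrite ?big_nil // big_cons IH. Qed.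

Lemma ideal_esum s es : ideal s (esum es) = \sum_(x <- es) ideal s x.
Proof. by elim: es => [|x es IH] /=; rewrite ?big_nil // big_cons IH. Qed.

Lemma prod_bool (I : eqType) (l : seq I) (F : I -> nat) (P : pred I) :
  {in l, forall x, F x = P x} -> \prod_(x <- l) F x = all P l.
Proof.
elim: l => [|x l IH] H; first by rewrite big_nil.
rewrite big_cons (H _ (mem_head _ _)) IH /=; first by rewrite mulnb.
by move=> y yl; apply: H; rewrite inE yl orbT.
Qed.

(* Register 0 holds n; the adjacency matrix starts at 0, the current ordering
   of the vertices at n ^ 2 and the candidate ordering at n ^ 2 + n. *)
Notation reg_n := (Reg 0).
Definition base1 := Bin Mul reg_n reg_n.
Definition base2 := Bin Add base1 reg_n.
Definition candidate (p : expr) := Read (Bin Add base2 p).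
Definition adjacent (x y : expr) := Read (Bin Add (Bin Mul x reg_n) y).

Fixpoint pairwise_expr (es : seq expr) : expr :=
  if es is x :: es' then
    Bin Mul (eprod [seq adjacent x y | y <- es']) (pairwise_expr es')
  else Const 1.

Definition power_n (i : nat) := eprod (nseq i reg_n).

Section Exprs.
Variables (n r m c0 d : nat).

Definition prefix_expr (b : expr) (i : nat) := pairwise_expr
  [seq candidate (Bin Add (Bin Mul b (Const r)) (Const l)) | l <- iota 0 i].
Definition full_expr b := prefix_expr b r.
Definition weight_expr b := eprod
  [seq Bin Add (Const 1) (Bin Mul (Const r) (prefix_expr b i)) | i <- iota 1 r].
Definition valid_expr (t : nat) := Bin Mul
  (eprod [seq full_expr (Const b) | b <- iota (t * r) r])
  (pairwise_expr [seq candidate (Const (b * r)) | b <- iota (t * r) r]).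
(** A tuple of vertices is the list of base n digits of its number, so tuples need no storage. *)
Definition digit_expr (u : expr) (i : nat) := Bin Mod (Bin Div u (power_n i)) reg_n.
Definition absorbs_expr (u : expr) (t : nat) := eprod
  [seq eprod [seq adjacent (digit_expr u i) (candidate (Const p))
             | p <- iota ((t * r + i) * r).+1 r.-1] | i <- iota 0 r].
Definition hits_expr u := esum
  [seq Bin Mul (valid_expr t) (absorbs_expr u t) | t <- iota 0 m].

Variables (e : rel 'I_n) (s : state) (pi : nat -> 'I_n).
Hypotheses (s_n : regs s 0 = n)
  (s_e : forall i j : 'I_n, Defs.mem s (i * n + j) = e i j)
  (s_pi : forall p, p < n -> Defs.mem s (n * n + n + p) = pi p).

Lemma ideal_adjacent x y (v w : 'I_n) : ideal s x = v -> ideal s y = w ->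
  ideal s (adjacent x y) = e v w.
Proof. by rewrite /= s_n => -> ->. Qed.

Lemma ideal_candidate x p : ideal s x = p -> p < n ->
  ideal s (candidate x) = pi p.
Proof. by rewrite /= s_n => -> /s_pi. Qed.

Lemma ideal_pairwise es (vs : seq 'I_n) :
  [seq ideal s x | x <- es] = [seq val v | v <- vs] ->
  ideal s (pairwise_expr es) = pairwise e vs.
Proof.
elim: es vs => [|x es IH] [|v vs] //= H.
have xv : ideal s x = v := congr1 (head 0) H.
have {H} E := congr1 behead H.
rewrite (IH _ E) ideal_eprod big_map -mulnb; congr (_ * _).
elim: es vs E {IH} => [|y es IH] [|w vs] //= H; first by rewrite big_nil.
have yw : ideal s y = w := congr1 (head 0) H.
have {H} E := congr1 behead H; have /= adj := ideal_adjacent xv yw.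
by rewrite big_cons (IH _ E) adj mulnb.
Qed.

Lemma ideal_power_n i : ideal s (power_n i) = n ^ i.
Proof.
rewrite /power_n ideal_eprod; elim: i => [|i IH]; first by rewrite big_nil.
by rewrite /= big_cons IH expnS /= s_n.
Qed.

Lemma ideal_prefix x b i : ideal s x = b -> b * r + i <= n ->
  ideal s (prefix_expr x i) = prefix_clique e r pi b i.
Proof.
move=> xb le; apply: ideal_pairwise; rewrite -2!map_comp.
have := iotaDl (b * r) 0 i; rewrite addn0 => ->; rewrite -map_comp.
apply/eq_in_map => l; rewrite mem_iota add0n => /andP[_ li].
apply: (@ideal_candidate _ (b * r + l)); first by rewrite /= xb.
by apply: leq_trans le; rewrite ltn_add2l.
Qed.

Lemma ideal_full x b : ideal s x = b -> (b.+1) * r <= n ->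
  ideal s (full_expr x) = full e r pi b.
Proof. by move=> xb le; apply: ideal_prefix; rewrite // addnC -mulSn. Qed.

Hypothesis esym : symmetric e.

Lemma ideal_weight x b : ideal s x = b -> (b.+1) * r <= n ->
  ideal s (weight_expr x) = r.+1 ^ rank e r pi b.
Proof.
move=> xb le; rewrite ideal_eprod big_map /rank.
have : {in iota 1 r, forall i, i <= r} by move=> i; rewrite mem_iota; lia.
elim: (iota 1 r) => [|i l IH] H; first by rewrite big_nil.
rewrite big_cons IH; last by move=> j jl; apply: H; rewrite inE jl orbT.
have ir : i <= r by apply: H; rewrite mem_head.
rewrite [LHS]/= (@ideal_prefix _ b) //; last by move: le; rewrite mulSn; lia.
by rewrite expnD; case: prefix_clique; rewrite ?muln1 ?muln0 ?expn1 ?add1n.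
Qed.

Hypothesis slots : m * r * r <= n.

Let slot_le t b : t < m -> b \in iota (t * r) r -> b.+1 * r <= n.
Proof.
move=> tm; rewrite mem_iota => /andP[_ lt]; apply: leq_trans slots.
rewrite leq_mul2r; apply/orP; right; apply: leq_trans lt _.
by rewrite -mulSnr leq_mul2r tm orbT.
Qed.

Lemma ideal_valid t : t < m -> ideal s (valid_expr t) = valid e r pi t.
Proof.
move=> tm; rewrite /valid -mulnb [LHS]/=; congr (_ * _).
  rewrite ideal_eprod big_map; apply: prod_bool => b bl.
  by apply: ideal_full => //; apply: slot_le bl.
apply: ideal_pairwise; rewrite -2!map_comp; apply/eq_in_map => b bl.
have [E|r0] := posnP r; first by move: bl; rewrite E.
apply: ideal_candidate => //; apply: leq_trans (slot_le tm bl).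
by rewrite mulSn -[ltnLHS]add0n ltn_add2r.
Qed.

Variable X : nat -> nat -> 'I_n.
Hypothesis X_digits : forall u i, X u i = (u %/ n ^ i) %% n :> nat.

Lemma ideal_digit x u i : ideal s x = u -> ideal s (digit_expr x i) = X u i.
Proof. by move=> xu; rewrite [LHS]/= ideal_power_n s_n xu X_digits. Qed.

Lemma ideal_absorbs x u t : ideal s x = u -> t < m ->
  ideal s (absorbs_expr x t) = absorbs e r X pi t u.
Proof.
move=> xu tm; rewrite /absorbs ideal_eprod big_map; apply: prod_bool => i ir.
have bl : t * r + i \in iota (t * r) r.
  by move: ir; rewrite !mem_iota leq_addr ltn_add2l.
rewrite ideal_eprod big_map all_map; apply: prod_bool => p.
rewrite mem_iota => /andP[_ lt]; apply: ideal_adjacent; first exact: ideal_digit.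
apply: ideal_candidate => //; apply: leq_trans (slot_le tm bl).
apply: leq_trans lt _; rewrite addSnnS prednK ?mulSn 1?addnC //.
by move: ir; rewrite mem_iota; lia.
Qed.

Lemma ideal_hits x u : ideal s x = u ->
  ideal s (hits_expr x) = hits e r m X pi u.
Proof.
move=> xu; rewrite ideal_esum big_map /hits -(big_mkord xpredT
  (fun t => (valid e r pi t && absorbs e r X pi t u : nat))) /index_iota subn0.
apply: eq_big_seq => t; rewrite mem_iota => tm.
rewrite -[LHS]/(ideal s (valid_expr t) * ideal s (absorbs_expr x t)).
by rewrite ideal_valid // (ideal_absorbs xu) // mulnb.
Qed.

End Exprs.

Definition frame (l : seq nat) (s s' : state) :=
  Defs.mem s' = Defs.mem s /\ forall x, x \notin l -> regs s' x = regs s x.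

Lemma frame_set_reg l s s' x v : frame l s s' -> x \in l -> frame l s (set_reg s' x v).
Proof.
move=> [Hm Hr] xl; split=> //= y yl; rewrite /upd; case: eqP => [yx|_]; last exact: Hr.
by move: yl; rewrite yx xl.
Qed.

Section Evaluate.
Variables (r m c0 d : nat).

(* Registers: 9 = number of non-full blocks, 10 = outer potential, 11 = block,
   12 = supply, 13 = number of scarce tuples, 14 = tuple, 15 = score,
   16 = hits. *)
Definition count_block : cmd :=
  Seq (Assign 9 (Bin Add (Reg 9) (Bin Defs.Sub (Const 1) (full_expr r (Reg 11)))))
      (Assign 10 (Bin Add (Reg 10)
        (Bin Mul (Bin Defs.Sub (Const 1) (Bin Lt (Reg 11) (Const (m * r))))
                 (weight_expr r (Reg 11))))).

(** With truncated subtraction, h - (h - c0) is the minimum of h and [c0]. *)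
Definition count_tuple : cmd :=
  Seq (Assign 16 (hits_expr r m (Reg 14)))
  (Seq (Assign 12 (Bin Add (Reg 12) (Bin Defs.Sub (Reg 16) (Bin Defs.Sub (Reg 16) (Const c0)))))
       (Assign 13 (Bin Add (Reg 13) (Bin Lt (Reg 16) (Reg 9))))).

Definition blocks_expr := Bin Div reg_n (Const r).
Definition unit_expr := Bin Add (Bin Mul blocks_expr (Const (r.+1 ^ r))) (Const 1).
Definition threshold_expr := Bin Mul
  (Bin Add (Bin Add (Bin Mul (Const c0) (power_n r)) (Const m)) (Const 1)) unit_expr.
Definition valids_expr := esum [seq valid_expr r t | t <- iota 0 m].
Definition many_scarce := Bin Lt (power_n r) (Bin Mul (Reg 13) (Const d)).
Definition score_expr1 := Bin Add (Bin Mul (Reg 12) unit_expr) (Reg 10).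
Definition score_expr2 := Bin Add threshold_expr (Bin Defs.Sub blocks_expr (Reg 9)).

(** The blocks come before the tuples because scarcity is measured against the final number of
    non-full blocks in register 9. *)
Definition evaluate : cmd :=
  Seq (Assign 9 (Const 0)) (Seq (Assign 10 (Const 0))
  (Seq (For 11 blocks_expr count_block)
  (Seq (Assign 12 valids_expr) (Seq (Assign 13 (Const 0))
  (Seq (For 14 (power_n r) count_tuple)
       (If many_scarce (Assign 15 score_expr1) (Assign 15 score_expr2))))))).

(** An upper bound for loop-free commands only: a conditional is charged for both branches, and the
    value at [While] is a filler. *)
Fixpoint straight_time (c : cmd) : nat :=
  match c with
  | Skip => 1
  | Assign _ a => (cost a).+1
  | Write a b => (cost a + cost b).+1
  | Seq c1 c2 => straight_time c1 + straight_time c2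
  | If b c1 c2 => (cost b + (straight_time c1 + straight_time c2)).+1
  | While _ _ => 0
  end.

Definition evaluate_time (n : nat) :=
  2 + (2 + (for_time blocks_expr (n %/ r) (straight_time count_block) +
  ((cost valids_expr).+1 + (2 +
  (for_time (power_n r) (n ^ r) (straight_time count_tuple) +
   straight_time (If many_scarce (Assign 15 score_expr1) (Assign 15 score_expr2))))))).

Definition evaluate_regs := [:: 9; 10; 11; 12; 13; 14; 15; 16].

Variables (n B : nat) (e : rel 'I_n) (X : nat -> nat -> 'I_n).
Hypotheses (esym : symmetric e) (r_gt2 : 2 < r) (rn : r %| n).
Hypothesis X_digits : forall u i, X u i = (u %/ n ^ i) %% n :> nat.
Let k := n %/ r.
Let N := n ^ r.
Hypothesis mk : m * r <= k.
Hypotheses (B_large : threshold r k m N c0 + k <= B) (B_N : N <= B).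

Let score := score e r k m N c0 d X.

Lemma wp_evaluate s (pi : nat -> 'I_n) : regs s 0 = n ->
  (forall i j : 'I_n, Defs.mem s (i * n + j) = e i j) ->
  (forall p, p < n -> Defs.mem s (n * n + n + p) = pi p) ->
  wp B evaluate s (evaluate_time n) (fun s' =>
    frame evaluate_regs s s' /\ regs s' 15 = score pi).
Proof.
move=> sn se spi.
have kr : k * r = n by rewrite divnK.
have r0 : 0 < r by apply: ltn_trans r_gt2.
have slots : m * r * r <= n by rewrite -kr leq_mul2r mk orbT.
have facts s' : frame evaluate_regs s s' -> [/\ regs s' 0 = n,
    forall i j : 'I_n, Defs.mem s' (i * n + j) = e i j &
    forall p, p < n -> Defs.mem s' (n * n + n + p) = pi p].
  by move=> [Hm Hr]; rewrite Hm; split=> //; rewrite Hr.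
have unitB : unit_score r k <= B.
  apply: leq_trans B_large; apply: leq_trans (leq_addr _ _).
  by rewrite leq_pmull // addn1.
have supB : c0 * N + m <= B.
  apply: leq_trans B_large; apply: leq_trans (leq_addr _ _).
  by rewrite /threshold -[leqLHS]muln1 leq_mul ?leq_addr // /unit_score addn1.
have kB : k <= B by apply: leq_trans B_large; apply: leq_addl.
have mB : m <= B by apply: leq_trans supB; apply: leq_addl.
pose f j := \sum_(b < j) (~~ full e r pi b : nat).
pose g j := \sum_(b < j | m * r <= b) r.+1 ^ rank e r pi b.
have fB j : j <= k -> f j <= B.
  move=> jk; apply: leq_trans kB; apply: leq_trans jk.
  rewrite -[leqRHS]card_ord -sum1_card; apply: leq_sum => b' _; exact: leq_b1.
have gB j : j <= k -> g j <= B.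
  move=> jk; apply: leq_trans unitB; apply: ltnW.
  apply: leq_ltn_trans (outer_potential_lt e k m r_gt2 pi).
  have -> : g j = \sum_(b < k | (m * r <= b) && (b < j)) r.+1 ^ rank e r pi b.
    exact: (big_ord_widen_cond k (fun b => m * r <= b)
      (fun b => r.+1 ^ rank e r pi b) jk).
  rewrite /outer_potential [leqRHS](bigID (fun b : 'I_k => b < j)) /=.
  exact: leq_addr.
pose h j := \sum_(u < j) minn (hits e r m X pi u) c0.
pose sc j := \sum_(u < j) (hits e r m X pi u < f k : nat).
pose V := \sum_(t < m) (valid e r pi t : nat).
have hB j : j <= N -> V + h j <= B.
  move=> jN; apply: leq_trans supB; rewrite addnC leq_add //.
    apply: (@leq_trans (\sum_(u < j) c0)).
      by apply: leq_sum => u _; apply: geq_minr.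
    by rewrite sum_nat_const card_ord mulnC leq_mul2l jN orbT.
  by rewrite -[leqRHS]card_ord -sum1_card; apply: leq_sum => t _; apply: leq_b1.
have scB j : j <= N -> sc j <= B.
  move=> jN; apply: leq_trans B_N; apply: leq_trans jN.
  rewrite -[leqRHS]card_ord -sum1_card; apply: leq_sum => b' _; exact: leq_b1.
apply: wp_seq; apply: wp_assign => //; apply: wp_seq; apply: wp_assign => //.
set s1 := set_reg _ 10 _.
have fr1 : frame evaluate_regs s s1 by do 2!apply: frame_set_reg => //.
apply: wp_seq.
apply: (@wp_for _ _ _ _ k _ (fun j s' => [/\ frame evaluate_regs s s',
   regs s' 9 = f j & regs s' 10 = g j])) => //.
- by move=> j s' _ [/facts[s'n _ _] _ _]; rewrite /= s'n.
- split; first exact: frame_set_reg.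
    by rewrite /f big_ord0.
  by rewrite /g big_ord0.
- move=> j s' jk [fr f9 g10] r11; have [s'n s'e s'pi] := facts _ fr.
  have jn : j.+1 * r <= n by rewrite -kr leq_mul2r jk orbT.
  have E9 : ideal s' (Bin Add (Reg 9) (Bin Defs.Sub (Const 1) (full_expr r (Reg 11)))) = f j.+1.
    rewrite -[LHS]/(regs s' 9 + (1 - ideal s' (full_expr r (Reg 11)))).
    rewrite (ideal_full s'n s'e s'pi (x := Reg 11) r11 jn) f9 /f big_ord_recr /=.
    by case: full.
  apply: wp_seq; apply: wp_assign; first by rewrite E9 fB.
  rewrite E9; set s2 := set_reg s' 9 _.
  have fr2 : frame evaluate_regs s s2 by apply: frame_set_reg.
  have [s2n s2e s2pi] := facts _ fr2.
  have E10 : ideal s2 (Bin Add (Reg 10)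
      (Bin Mul (Bin Defs.Sub (Const 1) (Bin Lt (Reg 11) (Const (m * r))))
                 (weight_expr r (Reg 11)))) = g j.+1.
    rewrite -[LHS]/(regs s2 10 + (1 - (regs s2 11 < m * r)) *
      ideal s2 (weight_expr r (Reg 11))).
    rewrite (ideal_weight s2n s2e s2pi (x := Reg 11) r11 jn).
    rewrite [regs s2 10]g10 [regs s2 11]r11 /g [in RHS]big_mkcond big_ord_recr -big_mkcond /=.
    by rewrite ltnNge; case: (m * r <= j) => /=; rewrite ?mul1n ?mul0n.
  apply: wp_assign; first by rewrite E10 gB.
  rewrite E10; split; first by [].
  by split=> //; do !apply: frame_set_reg.
move=> s2 [fr2 f9 g10]; have [s2n s2e s2pi] := facts _ fr2.
have EV : ideal s2 valids_expr = V.
  rewrite ideal_esum big_map /V -(big_mkord xpredT (fun t => valid e r pi t : nat)).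
  rewrite /index_iota subn0; apply: eq_big_seq => t; rewrite mem_iota => tm.
  by rewrite (ideal_valid s2n s2e s2pi slots).
have h0 : h 0 = 0 by rewrite /h big_ord0.
apply: wp_seq; apply: wp_assign; first by rewrite EV -[V]addn0 -h0 hB.
rewrite EV; apply: wp_seq; apply: wp_assign => //.
set s3 := set_reg _ 13 _.
have fr3 : frame evaluate_regs s s3 by do 2!apply: frame_set_reg => //.
apply: wp_seq.
apply: (@wp_for _ _ _ _ N _ (fun j s' => [/\ frame evaluate_regs s s',
   regs s' 9 = f k /\ regs s' 10 = g k, regs s' 12 = V + h j & regs s' 13 = sc j])) => //.
- by move=> j s' _ [/facts[s'n _ _] _ _ _]; rewrite (ideal_power_n s'n).
- split=> //; first exact: frame_set_reg.
    by rewrite h0 addn0.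
  by rewrite /sc big_ord0.
- move=> j s' jN [fr [f9' g10'] h12 sc13] r14; have [s'n s'e s'pi] := facts _ fr.
  have E16 := ideal_hits s'n s'e s'pi slots X_digits (x := Reg 14) r14.
  apply: wp_seq; apply: wp_assign; first by rewrite E16 (leq_trans _ mB) // hits_le.
  rewrite E16; set s4 := set_reg s' 16 _.
  have E12 : ideal s4 (Bin Add (Reg 12) (Bin Defs.Sub (Reg 16)
      (Bin Defs.Sub (Reg 16) (Const c0)))) = V + h j.+1.
    by rewrite /= /upd /= h12 /h big_ord_recr /= minnE addnA.
  apply: wp_seq; apply: wp_assign; rewrite E12 ?hB //; set s5 := set_reg s4 12 _.
  have E13 : ideal s5 (Bin Add (Reg 13) (Bin Lt (Reg 16) (Reg 9))) = sc j.+1.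
    by rewrite /= /upd /= sc13 f9' /sc big_ord_recr.
  apply: wp_assign; rewrite E13 ?scB //; split=> //.
  by split=> //; do !apply: frame_set_reg.
move=> s4 [fr4 [f9' g10'] h12 sc13]; have [s4n s4e s4pi] := facts _ fr4.
have Eunit : ideal s4 unit_expr = unit_score r k by rewrite /= s4n.
have Ethr : ideal s4 threshold_expr = threshold r k m N c0.
  rewrite -[LHS]/((c0 * ideal s4 (power_n r) + m + 1) * ideal s4 unit_expr).
  by rewrite Eunit (ideal_power_n s4n).
have Econd : ideal s4 many_scarce = (N < sc N * d).
  rewrite -[LHS]/(ideal s4 (power_n r) < regs s4 13 * d : nat).
  by rewrite sc13 (ideal_power_n s4n).
have E1 : ideal s4 score_expr1 = (V + h N) * unit_score r k + g k.
  by rewrite -[LHS]/(regs s4 12 * ideal s4 unit_expr + regs s4 10) Eunit h12 g10'.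
have E2 : ideal s4 score_expr2 = threshold r k m N c0 + (k - f k).
  rewrite -[LHS]/(ideal s4 threshold_expr + (regs s4 0 %/ r - regs s4 9)).
  by rewrite Ethr s4n f9'.
have le := score_le e k m N c0 d X r_gt2 pi.
have scoreE : score pi = if sc N * d <= N then threshold r k m N c0 + (k - f k)
    else (V + h N) * unit_score r k + g k by [].
apply: wp_if; rewrite Econd => cond.
  have lt : N < sc N * d by move: cond; case: (N < _).
  apply: wp_weaken (_ : _ <= _) (fun s' q => q); last first.
    by apply: (_ : (cost score_expr1).+1 <= _); rewrite /= leq_addr.
  have E : score pi = (V + h N) * unit_score r k + g k by rewrite scoreE leqNgt lt.
  apply: wp_assign; rewrite E1 -E; first exact: leq_trans le B_large.
  by split; [apply: frame_set_reg|].
have nlt : sc N * d <= N by move/eqP: cond; rewrite eqb0 -leqNgt.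
apply: wp_weaken (_ : _ <= _) (fun s' q => q); last first.
  by apply: (_ : (cost score_expr2).+1 <= _); rewrite /= leq_addl.
have E : score pi = threshold r k m N c0 + (k - f k) by rewrite scoreE nlt.
apply: wp_assign; rewrite E2 -E; first exact: leq_trans le B_large.
by split; [apply: frame_set_reg|].
Qed.

End Evaluate.

(* Registers: 1 = index of the sequence of swaps, 2 = best score found so far,
   3 = flag (the last pass over all sequences found an improvement),
   4 = loop counter, 5 = remaining digits, 6, 7, 8 = temporary. *)
Definition copy_to_candidate : cmd :=
  For 4 reg_n (Write (Bin Add base2 (Reg 4)) (Read (Bin Add base1 (Reg 4)))).

Definition copy_from_candidate : cmd :=
  For 4 reg_n (Write (Bin Add base1 (Reg 4)) (Read (Bin Add base2 (Reg 4)))).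

Definition swap_step : cmd :=
  Seq (Assign 6 (Bin Add base2 (Bin Mod (Reg 5) reg_n)))
  (Seq (Assign 5 (Bin Div (Reg 5) reg_n))
  (Seq (Assign 7 (Bin Add base2 (Bin Mod (Reg 5) reg_n)))
  (Seq (Assign 5 (Bin Div (Reg 5) reg_n))
  (Seq (Assign 8 (Read (Reg 6)))
  (Seq (Write (Reg 6) (Read (Reg 7))) (Write (Reg 7) (Reg 8))))))).

Definition same_regs (l : seq nat) (s s' : state) :=
  forall x, x \notin l -> regs s' x = regs s x.

Lemma same_regs_trans l s s' s'' :
  same_regs l s s' -> same_regs l s' s'' -> same_regs l s s''.
Proof. by move=> H1 H2 x xl; rewrite H2 // H1. Qed.

Lemma same_regs_sub l l' s s' : {subset l <= l'} ->
  same_regs l s s' -> same_regs l' s s'.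
Proof. by move=> ll' H x xl; apply: H; apply: contra xl; apply: ll'. Qed.

Lemma same_regs_set l s s' x v :
  same_regs l s s' -> x \in l -> same_regs l s (set_reg s' x v).
Proof.
move=> Hr xl y yl /=; rewrite /upd; case: eqP => [yx|_]; last exact: Hr.
by move: yl; rewrite yx xl.
Qed.

Section Search.
Variables (n B : nat) (e : rel 'I_n).
Hypotheses (n_gt0 : 0 < n) (B_large : n * n + n + n <= B).

Let nB : n <= B. Proof. by apply: leq_trans B_large; apply: leq_addl. Qed.

Definition layout s (rho : nat -> 'I_n) :=
  [/\ regs s 0 = n, forall i j : 'I_n, Defs.mem s (i * n + j) = e i j &
      forall p, p < n -> Defs.mem s (n * n + p) = rho p].

Definition candidate_is s (pi : nat -> 'I_n) :=
  forall p, p < n -> Defs.mem s (n * n + n + p) = pi p.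

Lemma adjacency_address (i j : 'I_n) : i * n + j < n * n.
Proof.
apply: (@leq_trans (i.+1 * n)); last by rewrite leq_mul2r ltn_ord orbT.
by rewrite mulSn addnC ltn_add2r.
Qed.

Lemma layout_set_mem s rho x v : layout s rho -> n * n + n <= x ->
  layout (set_mem s x v) rho.
Proof.
move=> [Hn He Hp] le; split=> //= [i j|p pn]; rewrite /upd.
  have := adjacency_address i j.
  by case: eqP => [->|_ _]; [rewrite ltnNge (leq_trans (leq_addr _ _) le)|apply: He].
case: eqP => [E|_]; last exact: Hp.
by move: le; rewrite -E leq_add2l leqNgt pn.
Qed.

Lemma layout_set_reg s rho x v : layout s rho -> x != 0 ->
  layout (set_reg s x v) rho.
Proof.
by move=> [Hn He Hp] x0; split=> //=; rewrite /upd eq_sym (negPf x0).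
Qed.

Lemma wp_copy_to s rho : layout s rho ->
  wp B copy_to_candidate s
    (for_time reg_n n (straight_time (Write (Bin Add base2 (Reg 4)) (Read (Bin Add base1 (Reg 4))))))
    (fun s' => [/\ layout s' rho, candidate_is s' rho & same_regs [:: 4] s s']).
Proof.
move=> lay; apply: (@wp_for _ _ _ _ n _ (fun j s' => [/\ layout s' rho,
   forall p, p < j -> Defs.mem s' (n * n + n + p) = rho p & same_regs [:: 4] s s'])) => //.
- by move=> j s' _ [[]].
- by split; [apply: layout_set_reg| |apply: same_regs_set].
- move=> j s' jn [lay' cp sr] r4; have [s'n s'e s'p] := lay'.
  have Ea : ideal s' (Bin Add base2 (Reg 4)) = n * n + n + j by rewrite /= s'n r4.
  have Ev : ideal s' (Read (Bin Add base1 (Reg 4))) = rho j by rewrite /= s'n r4 s'p.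
  apply: wp_write; rewrite Ev; first exact: leq_trans (ltnW (ltn_ord _)) nB.
  rewrite Ea; split; first by [].
  split.
  + by apply: layout_set_reg => //; apply: layout_set_mem => //; apply: leq_addr.
  + move=> p; rewrite ltnS leq_eqVlt /= /upd eqn_add2l => /orP[/eqP->|pj].
      by rewrite eqxx.
    by rewrite ltn_eqF // cp.
  + exact: same_regs_set.
Qed.

Lemma wp_copy_from s rho pi : layout s rho -> candidate_is s pi ->
  wp B copy_from_candidate s
    (for_time reg_n n (straight_time (Write (Bin Add base1 (Reg 4)) (Read (Bin Add base2 (Reg 4))))))
    (fun s' => layout s' pi /\ same_regs [:: 4] s s').
Proof.
move=> [sn se _] cs; apply: (@wp_for _ _ _ _ n _ (fun j s' => [/\
   regs s' 0 = n /\ candidate_is s' pi,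
   forall i j : 'I_n, Defs.mem s' (i * n + j) = e i j,
   forall p, p < j -> Defs.mem s' (n * n + p) = pi p & same_regs [:: 4] s s'])) => //.
- by move=> j s' _ [[]].
- by split=> //; exact: same_regs_set.
- move=> j s' jn [[s'n s'c] s'e s'p sr] r4.
  have Ea : ideal s' (Bin Add base1 (Reg 4)) = n * n + j by rewrite /= s'n r4.
  have Ev : ideal s' (Read (Bin Add base2 (Reg 4))) = pi j by rewrite /= s'n r4 s'c.
  apply: wp_write; rewrite Ev; first exact: leq_trans (ltnW (ltn_ord _)) nB.
  rewrite Ea; split; first by [].
  split.
  + split=> // p pn; rewrite /= /upd -addnA eqn_add2l gtn_eqF ?ltn_addr //.
    by rewrite addnA s'c.
  + move=> i i'; rewrite /= /upd ltn_eqF ?s'e //.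
    by rewrite (leq_trans (adjacency_address _ _)) // leq_addr.
  + move=> p; rewrite ltnS leq_eqVlt /= /upd eqn_add2l => /orP[/eqP->|pj].
      by rewrite eqxx.
    by rewrite ltn_eqF // s'p.
  + exact: same_regs_set.
- by move=> s' [[s'n _] s'e s'p sr]; split.
Qed.

(** Consecutive base n digits of [u] are paired, so a counter below n ^ (2 l) runs through all
    sequences of [l] transpositions. *)
Definition swap_pairs (u l : nat) : seq (nat * nat) :=
  [seq ((u %/ n ^ (2 * i)) %% n, (u %/ n ^ (2 * i).+1) %% n) | i <- iota 0 l].

Lemma swap_pairsS u l : swap_pairs u l.+1 = swap_pairs u l ++
  [:: ((u %/ n ^ (2 * l)) %% n, (u %/ n ^ (2 * l).+1) %% n)].
Proof. by rewrite /swap_pairs -(addn1 l) iotaD map_cat. Qed.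

Lemma div_expS u i : u %/ n ^ i %/ n = u %/ n ^ i.+1.
Proof. by rewrite -divnMA expnSr. Qed.

Lemma wp_swap_step s rho pi u i : layout s rho -> candidate_is s pi ->
  u <= B -> regs s 5 = u %/ n ^ (2 * i) ->
  wp B swap_step s (straight_time swap_step) (fun s' => [/\ layout s' rho,
    candidate_is s' (swap pi ((u %/ n ^ (2 * i)) %% n) ((u %/ n ^ (2 * i).+1) %% n)),
    regs s' 5 = u %/ n ^ (2 * i.+1) & same_regs [:: 5; 6; 7; 8] s s']).
Proof.
move=> lay cs uB r5; have [sn se sp] := lay.
set a := (u %/ n ^ (2 * i)) %% n; set b := (u %/ n ^ (2 * i).+1) %% n.
have an : a < n by rewrite ltn_mod.
have bn : b < n by rewrite ltn_mod.
have addrB p : p < n -> n * n + n + p <= B.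
  by move=> pn; apply: leq_trans B_large; rewrite leq_add2l ltnW.
have qB j : u %/ n ^ j <= B by apply: leq_trans uB; apply: leq_div.
have E1 : ideal s (Bin Add base2 (Bin Mod (Reg 5) reg_n)) = n * n + n + a.
  by rewrite /= sn r5.
apply: wp_seq; apply: wp_assign; rewrite E1 ?addrB //; set s1 := set_reg s 6 _.
have E2 : ideal s1 (Bin Div (Reg 5) reg_n) = u %/ n ^ (2 * i).+1.
  by rewrite /= /upd /= sn r5 div_expS.
apply: wp_seq; apply: wp_assign; rewrite E2 ?qB //; set s2 := set_reg s1 5 _.
have E3 : ideal s2 (Bin Add base2 (Bin Mod (Reg 5) reg_n)) = n * n + n + b.
  by rewrite /= /upd /= sn.
apply: wp_seq; apply: wp_assign; rewrite E3 ?addrB //; set s3 := set_reg s2 7 _.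
have E4 : ideal s3 (Bin Div (Reg 5) reg_n) = u %/ n ^ (2 * i.+1).
  by rewrite /= /upd /= sn div_expS mulnS.
apply: wp_seq; apply: wp_assign; rewrite E4 ?qB //; set s4 := set_reg s3 5 _.
have E5 : ideal s4 (Read (Reg 6)) = pi a by rewrite /= /upd /= cs.
apply: wp_seq; apply: wp_assign; rewrite E5; first exact: leq_trans (ltnW (ltn_ord _)) nB.
set s5 := set_reg s4 8 _.
have E6 : ideal s5 (Read (Reg 7)) = pi b by rewrite /= /upd /= cs.
apply: wp_seq; apply: wp_write; rewrite E6; first exact: leq_trans (ltnW (ltn_ord _)) nB.
rewrite -[ideal s5 (Reg 6)]/(n * n + n + a); set s6 := set_mem s5 _ _.
apply: wp_write; rewrite -[ideal s6 (Reg 8)]/(val (pi a)).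
  exact: leq_trans (ltnW (ltn_ord _)) nB.
rewrite -[ideal s6 (Reg 7)]/(n * n + n + b).
split; last 2 first.
- by [].
- by do !apply: same_regs_set.
- do 2!(apply: layout_set_mem; last exact: leq_addr).
  by do !apply: layout_set_reg.
- move=> p pn; rewrite /= /upd !eqn_add2l cs // /swap.
  have [->|pb] := eqVneq p b; first by case: eqVneq => [<-|].
  by case: eqVneq.
Qed.

Lemma wp_swaps s rho pi u l : layout s rho -> candidate_is s pi ->
  u <= B -> l <= B -> regs s 5 = u ->
  wp B (For 4 (Const l) swap_step) s (for_time (Const l) l (straight_time swap_step))
   (fun s' => [/\ layout s' rho, candidate_is s' (swaps pi (swap_pairs u l)) &
     same_regs [:: 4; 5; 6; 7; 8] s s']).
Proof.
move=> lay cs uB lB r5.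
apply: (@wp_for _ _ _ _ l _ (fun j s' => [/\ layout s' rho,
   candidate_is s' (swaps pi (swap_pairs u j)), regs s' 5 = u %/ n ^ (2 * j) &
   same_regs [:: 4; 5; 6; 7; 8] s s'])) => //.
- split; [exact: layout_set_reg|exact: cs| |exact: same_regs_set].
  by rewrite /= /upd /= r5 muln0 expn0 divn1.
- move=> j s' jl [lay' cs' r5' sr] r4.
  apply: wp_weaken (wp_swap_step lay' cs' uB r5') (leqnn _) _ => s'' [l2 c2 r52 sr2].
  split; first by rewrite sr2.
  split; first exact: layout_set_reg.
  + by rewrite swap_pairsS swaps_cat.
  + by [].
  + apply: same_regs_set => //; apply: same_regs_trans sr _.
    by apply: same_regs_sub sr2 => x; rewrite !inE => ->; rewrite orbT.
- by move=> s' [].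
Qed.

End Search.

Lemma for_time_le lim N T T' : T <= T' -> for_time lim N T <= for_time lim N T'.
Proof. by move=> le; rewrite /for_time leq_add2r leq_mul2l leq_add2r le orbT. Qed.

(** * The complete program and its termination *)

Section Program.
Variables (r m c0 d : nat).

Definition accept : cmd :=
  Seq (Assign 2 (Reg 15)) (Seq (Assign 3 (Const 1)) copy_from_candidate).

Definition try_swaps : cmd :=
  Seq copy_to_candidate (Seq (Assign 5 (Reg 1))
  (Seq (For 4 (Const (r * r)) swap_step) (Seq (evaluate r m c0 d)
       (If (Bin Lt (Reg 2) (Reg 15)) accept Skip)))).

(** An improvement is accepted at once, and the pass continues from the new ordering. A pass without
    improvement has tested all sequences on one and the same ordering, which is therefore a local
    maximum. *)
Definition local_search : cmd :=
  While (Reg 3) (Seq (Assign 3 (Const 0)) (For 1 (power_n (2 * (r * r))) try_swaps)).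

Definition initialize : cmd :=
  For 4 reg_n (Write (Bin Add base1 (Reg 4)) (Reg 4)).

(** The result overwrites the beginning of the adjacency matrix; as n <= n^2, the ordering stored
    from n^2 on stays intact while it is copied. *)
Definition output : cmd :=
  For 4 reg_n (Write (Reg 4) (Read (Bin Add base1 (Reg 4)))).

Definition program : cmd :=
  Seq initialize (Seq (Assign 3 (Const 1)) (Seq local_search output)).

(** The address arithmetic is the most expensive among the copying loops, which gives a common bound
    for all of them. *)
Definition copy_time (n : nat) := for_time reg_n n
  (straight_time (Write (Bin Add base2 (Reg 4)) (Read (Bin Add base2 (Reg 4))))).

Definition try_time (n : nat) := copy_time n + (2 +
  (for_time (Const (r * r)) (r * r) (straight_time swap_step) +
   (evaluate_time r m c0 d n + (3 + (2 + (2 + copy_time n))).+1))).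

Definition pass_time (n : nat) :=
  2 + for_time (power_n (2 * (r * r))) (n ^ (2 * (r * r))) (try_time n).

Definition max_score (n : nat) := threshold r (n %/ r) m (n ^ r) c0 + n %/ r.

Definition program_time (n : nat) := copy_time n + (2 +
  (((max_score n).+1 * (pass_time n + 2) + 2) + copy_time n)).

Variables (n B : nat) (e : rel 'I_n) (X : nat -> nat -> 'I_n).
Hypotheses (n_gt0 : 0 < n) (B_square : n * n + n + n <= B).
Hypotheses (esym : symmetric e) (r_gt2 : 2 < r) (rn : r %| n).
Hypothesis X_digits : forall u i, X u i = (u %/ n ^ i) %% n :> nat.
Let k := n %/ r.
Let N := n ^ r.
Hypothesis mk : m * r <= k.
Hypotheses (B_score : max_score n <= B) (B_N : N <= B).
Hypothesis B_swaps : n ^ (2 * (r * r)) <= B.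

Let score := score e r k m N c0 d X.
Notation layout := (layout e).

Let nB : n <= B. Proof. by apply: leq_trans B_square; apply: leq_addl. Qed.

Lemma wp_try_swaps s rho : layout s rho -> regs s 1 <= B ->
  let pi := swaps rho (swap_pairs n (regs s 1) (r * r)) in
  wp B try_swaps s (try_time n) (fun s' => regs s' 1 = regs s 1 /\
    if regs s 2 < score pi then
      [/\ layout s' pi, regs s' 2 = score pi & regs s' 3 = 1]
    else [/\ layout s' rho, regs s' 2 = regs s 2 & regs s' 3 = regs s 3]).
Proof.
move=> lay uB /=; set u := regs s 1 in uB *; set pi := swaps _ _.
apply: wp_seq; apply: wp_weaken (wp_copy_to B_square lay) _ _; first exact: for_time_le.
move=> s1 [lay1 c1 sr1].
apply: wp_seq; apply: wp_assign; rewrite [ideal _ _]sr1 //.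
set s2 := set_reg s1 5 _.
have lay2 : layout s2 rho by apply: layout_set_reg.
have rrB : r * r <= B.
  apply: leq_trans B_square; rewrite -addnA; apply: leq_trans (leq_addr _ _).
  by apply: leq_mul; apply: dvdn_leq.
apply: wp_seq; apply: wp_weaken (wp_swaps n_gt0 B_square (rho := rho) (pi := rho)
  (u := u) (l := r * r) lay2 c1 uB rrB _) (leqnn _) _; first by [].
move=> s3 [lay3 c3 sr3]; have [s3n s3e s3p] := lay3.
apply: wp_seq; apply: wp_weaken (wp_evaluate d r_gt2 rn X_digits mk B_score B_N
  s3n s3e c3) (leqnn _) _ => s4 [[Hm Hr] r15].
have r_eq x : x \in [:: 1; 2; 3] -> regs s4 x = regs s x.
  rewrite !inE => x3; have x_small : x < 4 by case/or3P: x3 => /eqP->.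
  have x_pos : 0 < x by case/or3P: x3 => /eqP->.
  rewrite Hr; last by rewrite !inE; do !case: eqP => [E|_] //; rewrite E in x_small.
  rewrite sr3; last by rewrite !inE; do !case: eqP => [E|_] //; rewrite E in x_small.
  rewrite /= /upd; case: eqP => [E|_]; first by rewrite E in x_small.
  by rewrite sr1 // inE; case: eqP => [E|_] //; rewrite E in x_small.
have s4n : regs s4 0 = n by rewrite Hr.
have lay4 : layout s4 rho by split=> //; rewrite Hm.
have c4 : candidate_is s4 pi by move=> p pn; rewrite Hm c3.
have Econd : ideal s4 (Bin Lt (Reg 2) (Reg 15)) = (regs s 2 < score pi).
  by rewrite /= r15 r_eq.
apply: wp_if; rewrite Econd => cond.
  have lt : regs s 2 < score pi by move: cond; case: (_ < _).
  have sB : score pi <= B by apply: leq_trans B_score; apply: score_le.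
  have E15 : ideal s4 (Reg 15) = score pi by [].
  apply: wp_seq; apply: wp_assign; rewrite E15 //.
  apply: wp_seq; apply: wp_assign; first by apply: leq_trans nB.
  set s5 := set_reg _ 3 _.
  have lay5 : layout s5 rho by do 2!apply: layout_set_reg => //.
  apply: wp_weaken (wp_copy_from B_square lay5 (pi := pi) c4) _ _; first exact: for_time_le.
  move=> s6 [lay6 sr6]; rewrite lt; split; first by rewrite sr6 //= /upd /= r_eq.
  by split=> //; rewrite sr6.
have nlt : (regs s 2 < score pi) = false by move: cond; case: (_ < _).
by exists 1, s4; split; [constructor| |rewrite nlt !r_eq].
Qed.

Lemma swap_pairs_lt u l : all (fun pq => (pq.1 < n) && (pq.2 < n)) (swap_pairs n u l).
Proof. by apply/allP => -[p q] /mapP[i _ [-> ->]] /=; rewrite !ltn_mod n_gt0. Qed.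

Let NN := n ^ (2 * (r * r)).

(** An inequality for register 2 suffices and holds at the start, where the register is 0 and the
    initial ordering has not been evaluated. *)
Definition invariant s rho :=
  [/\ layout s rho, {in [pred x | x < n] &, injective rho} & regs s 2 <= score rho].

Lemma wp_pass s rho : invariant s rho -> regs s 3 = 0 ->
  wp B (For 1 (power_n (2 * (r * r))) try_swaps) s
    (for_time (power_n (2 * (r * r))) NN (try_time n)) (fun s' =>
    exists2 rho', invariant s' rho' &
      regs s' 3 = 1 /\ regs s 2 < regs s' 2 \/
      [/\ regs s' 3 = 0, regs s' 2 = regs s 2 &
        forall u, u < NN -> score (swaps rho' (swap_pairs n u (r * r))) <= regs s 2]).
Proof.
move=> inv r3.
apply: (@wp_for _ _ _ _ NN _ (fun j s' => exists2 rho', invariant s' rho' &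
      regs s' 3 = 1 /\ regs s 2 < regs s' 2 \/
      [/\ regs s' 3 = 0, regs s' 2 = regs s 2 &
        forall u, u < j -> score (swaps rho' (swap_pairs n u (r * r))) <= regs s 2])).
- exact: B_swaps.
- by move=> j s' _ [rho' [[s'n _ _] _ _] _]; rewrite (ideal_power_n s'n).
- exists rho; last by right.
  by case: inv => lay inj le; split=> //; apply: layout_set_reg.
- move=> j s' jN [rho' [lay inj le] alt] r1.
  have jB : regs s' 1 <= B by rewrite r1 (leq_trans (ltnW jN)).
  apply: wp_weaken (wp_try_swaps lay jB) (leqnn _) _ => s'' [r1' post].
  split; first by rewrite r1'.
  rewrite r1 in post; move: post; set pi := swaps _ _; case: ifP => [lt|nlt] [lay' r2 r3'].
    exists pi.
      split; [exact: layout_set_reg| |by rewrite /= /upd /= r2].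
      by apply: swaps_inj => //; apply: swap_pairs_lt.
    left; rewrite /= /upd /= r3' r2; split=> //.
    by case: alt => [[_ lt']|[_ E _]]; [apply: ltn_trans lt' lt|rewrite -E].
  exists rho'.
    by split; [exact: layout_set_reg| |rewrite /= /upd /= r2].
  rewrite /= /upd /= r3' r2; case: alt => [?|[E3 E2 H]]; [by left|right; split=> // u].
  rewrite ltnS leq_eqVlt => /orP[/eqP->|/H //].
  by rewrite -E2 leqNgt -/pi nlt.
- by [].
Qed.

Lemma score_max rho : score rho <= max_score n.
Proof. exact: score_le. Qed.

Lemma wp_local_search_step f s rho Q : invariant s rho -> regs s 3 = 1 ->
  (forall s' rho', invariant s' rho' -> regs s' 3 = 1 -> regs s 2 < regs s' 2 ->
     wp B local_search s' (f * (pass_time n + 2) + 2) Q) ->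
  (forall s' rho', invariant s' rho' ->
     (forall u, u < NN ->
        score (swaps rho' (swap_pairs n u (r * r))) <= score rho') -> Q s') ->
  wp B local_search s (f.+1 * (pass_time n + 2) + 2) Q.
Proof.
move=> inv r3 Hcont Hstop.
apply: wp_weaken (wp_while_true (b := Reg 3) (T1 := pass_time n)
    (T2 := f * (pass_time n + 2) + 2) _ _) _ (fun s' q => q); first by rewrite /= r3.
  apply: wp_seq; apply: wp_assign => //; set s1 := set_reg _ 3 _.
  have inv1 : invariant s1 rho.
    by case: inv => lay inj le; split=> //; apply: layout_set_reg.
  apply: wp_weaken (wp_pass inv1 _) (leqnn _) _ => // s' [rho' inv' [[r3' lt]|[r3' r2' H]]].
    exact: Hcont inv' r3' lt.
  exists 2, s'; split; [exact: (IExecWhileFalse _ _ (b := Reg 3))|exact: leq_addl|].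
  apply: (Hstop _ _ inv') => u uN; apply: leq_trans (H u uN) _.
  by case: inv' => _ _; rewrite r2'.
by rewrite mulSn /=; move: (pass_time n) (f * _); clear; lia.
Qed.

(** Every pass but the last raises register 2, which is bounded by [max_score]; [f] bounds the
    number of raises still possible. *)
Lemma wp_local_search f s rho : invariant s rho -> regs s 3 = 1 ->
  max_score n <= regs s 2 + f ->
  wp B local_search s (f.+1 * (pass_time n + 2) + 2) (fun s' =>
    exists2 rho', invariant s' rho' &
      forall u, u < NN -> score (swaps rho' (swap_pairs n u (r * r))) <= score rho').
Proof.
elim: f s rho => [|f IH] s rho inv r3 le.
  apply: (wp_local_search_step (f := 0) inv r3) => s' rho'; last by exists rho'.
  move=> [_ _ inv'] _ lt; exfalso; move: (leq_trans lt (leq_trans inv' (score_max rho'))).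
  by rewrite ltnNge -[regs s 2]addn0 le.
apply: (wp_local_search_step (f := f.+1) inv r3) => s' rho'; last by exists rho'.
move=> inv' r3' lt.
by apply: IH inv' r3' _; apply: leq_trans le _; rewrite addnS -addSn leq_add2r.
Qed.

Lemma wp_initialize s : regs s 0 = n ->
  (forall i j : 'I_n, Defs.mem s (i * n + j) = e i j) ->
  wp B initialize s (copy_time n) (fun s' =>
    layout s' (fun p => insubd (Ordinal n_gt0) p) /\ regs s' 2 = regs s 2).
Proof.
move=> sn se; apply: wp_weaken (_ : wp B initialize s (for_time reg_n n
  (straight_time (Write (Bin Add base1 (Reg 4)) (Reg 4)))) _) _ (fun s' q => q).
  apply: (@wp_for _ _ _ _ n _ (fun j s' => [/\ regs s' 0 = n,
    forall i j : 'I_n, Defs.mem s' (i * n + j) = e i j,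
    forall p, p < j -> Defs.mem s' (n * n + p) = p & regs s' 2 = regs s 2])) => //.
  - by move=> j s' _ [].
  - move=> j s' jn [s'n s'e s'p r2] r4.
    have Ea : ideal s' (Bin Add base1 (Reg 4)) = n * n + j by rewrite /= s'n r4.
    apply: wp_write; rewrite [ideal s' (Reg 4)]r4; first exact: leq_trans (ltnW jn) nB.
    rewrite Ea; split; first by [].
    split=> //.
    + move=> i i'; rewrite /= /upd ltn_eqF ?s'e //.
      by rewrite (leq_trans (adjacency_address _ _)) // leq_addr.
    + move=> p; rewrite ltnS leq_eqVlt /= /upd eqn_add2l => /orP[/eqP->|pj].
        by rewrite eqxx.
      by rewrite ltn_eqF // s'p.
  - move=> s' [s'n s'e s'p r2]; split=> //; split=> // p pn.
    by rewrite s'p // val_insubd pn.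
exact: for_time_le.
Qed.

Lemma wp_output s rho : layout s rho ->
  wp B output s (copy_time n) (fun s' => forall p, p < n -> Defs.mem s' p = rho p).
Proof.
move=> [sn _ sp]; apply: wp_weaken (_ : wp B output s (for_time reg_n n
  (straight_time (Write (Reg 4) (Read (Bin Add base1 (Reg 4)))))) _) _ (fun s' q => q).
  apply: (@wp_for _ _ _ _ n _ (fun j s' => [/\ regs s' 0 = n,
    forall p, p < n -> Defs.mem s' (n * n + p) = rho p &
    forall p, p < j -> Defs.mem s' p = rho p])) => //.
  - by move=> j s' _ [].
  - move=> j s' jn [s'n s'p s'o] r4.
    have Ev : ideal s' (Read (Bin Add base1 (Reg 4))) = rho j by rewrite /= s'n r4 s'p.
    apply: wp_write; rewrite Ev; first exact: leq_trans (ltnW (ltn_ord _)) nB.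
    rewrite [ideal s' (Reg 4)]r4; split; first by [].
    split=> //.
    + move=> p pn; rewrite /= /upd gtn_eqF ?s'p //.
      apply: leq_trans jn _; apply: leq_trans (leq_addr _ _); exact: leq_pmulr.
    + move=> p; rewrite ltnS leq_eqVlt /= /upd => /orP[/eqP->|pj].
        by rewrite eqxx.
      by rewrite ltn_eqF // s'o.
  - by move=> s' [].
exact: for_time_le.
Qed.

Lemma insubd_inj : {in [pred x | x < n] &, injective (insubd (Ordinal n_gt0))}.
Proof.
by move=> x y xn yn /(congr1 val); rewrite !val_insubd; move: xn yn; rewrite !inE => -> ->.
Qed.

Lemma wp_program s : regs s 0 = n -> regs s 2 = 0 ->
  (forall i j : 'I_n, Defs.mem s (i * n + j) = e i j) ->
  wp B program s (program_time n) (fun s' => exists rho : nat -> 'I_n,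
    [/\ {in [pred x | x < n] &, injective rho},
      forall u, u < NN -> score (swaps rho (swap_pairs n u (r * r))) <= score rho &
      forall p, p < n -> Defs.mem s' p = rho p]).
Proof.
move=> sn r2 se; apply: wp_seq.
apply: wp_weaken (wp_initialize sn se) (leqnn _) _ => s1 [lay1 r2'].
apply: wp_seq; apply: wp_assign; first exact: leq_trans nB.
set s2 := set_reg _ 3 _; have inv2 : invariant s2 (fun p => insubd (Ordinal n_gt0) p).
  split; [exact: layout_set_reg|exact: insubd_inj|].
  by rewrite /= /upd /= r2' r2.
apply: wp_seq; apply: wp_weaken (wp_local_search inv2 _ (f := max_score n) _) (leqnn _) _.
- by [].
- by rewrite leq_addl.
move=> s3 [rho [lay3 inj3 _] max3].
apply: wp_weaken (wp_output lay3) (leqnn _) _ => s4 out.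
by exists rho.
Qed.

End Program.

(** * Running time and output *)

Definition poly_bound (k : nat) (f : nat -> nat) :=
  exists C, forall n, 0 < n -> f n <= C * n ^ k.

Lemma poly_const k c : poly_bound k (fun=> c).
Proof. by exists c => n n0; rewrite leq_pmulr // expn_gt0 n0. Qed.

Lemma poly_exp j k : j <= k -> poly_bound k (fun n => n ^ j).
Proof. by move=> jk; exists 1 => n n0; rewrite mul1n leq_pexp2l. Qed.

Lemma poly_le k f g : (forall n, 0 < n -> f n <= g n) -> poly_bound k g -> poly_bound k f.
Proof. by move=> fg [C H]; exists C => n n0; apply: leq_trans (fg n n0) (H n n0). Qed.

Lemma poly_add k f g : poly_bound k f -> poly_bound k g ->
  poly_bound k (fun n => f n + g n).
Proof.
by move=> [C H] [D K]; exists (C + D) => n n0; rewrite mulnDl leq_add ?H ?K.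
Qed.

Lemma poly_mul j k l f g : j + k <= l -> poly_bound j f -> poly_bound k g ->
  poly_bound l (fun n => f n * g n).
Proof.
move=> jkl [C H] [D K]; exists (C * D) => n n0.
apply: leq_trans (leq_mul (H n n0) (K n n0)) _.
by rewrite mulnACA leq_mul2l -expnD leq_pexp2l ?orbT.
Qed.

Lemma poly_for_time j k l lim N T : j + k <= l -> poly_bound j N -> poly_bound k T ->
  poly_bound l (fun n => for_time lim (N n) (T n)).
Proof.
move=> jkl PN PT; apply: poly_add; last exact: poly_const.
by apply: poly_mul jkl PN _; apply: poly_add PT _; apply: poly_const.
Qed.

Lemma poly_div r k : 0 < k -> poly_bound k (fun n => n %/ r).
Proof.
move=> k0; apply: poly_le (poly_exp k0) => n _.
by rewrite expn1 leq_div.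
Qed.

Section Time.
Variables (r m c0 d : nat).
Hypothesis r_gt2 : 2 < r.

Lemma poly_copy_time l : 0 < l -> poly_bound l copy_time.
Proof.
move=> l0; apply: (@poly_for_time 1 0) => //; last exact: poly_const.
by apply: poly_le (poly_exp (leqnn 1)) => n _; rewrite expn1.
Qed.

Lemma poly_try_time : poly_bound r (try_time r m c0 d).
Proof.
have r0 : 0 < r by apply: ltn_trans r_gt2.
apply: poly_add; first exact: poly_copy_time.
apply: poly_add; first exact: poly_const.
apply: poly_add; first exact: poly_const.
apply: poly_add.
  do 2!(apply: poly_add; first exact: poly_const).
  apply: poly_add.
    by apply: (@poly_for_time 1 0); [|apply: poly_div|apply: poly_const].
  do 2!(apply: poly_add; first exact: poly_const).
  apply: poly_add; last exact: poly_const.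
  apply: (@poly_for_time r 0); [by rewrite addn0| |exact: poly_const].
  exact: poly_exp.
apply: (@poly_le _ _ (fun n => 8 + copy_time n)); first by move=> n _; lia.
by apply: poly_add; [apply: poly_const|apply: poly_copy_time].
Qed.

Lemma poly_max_score : poly_bound r.+1 (max_score r m c0).
Proof.
apply: poly_add; last exact: poly_div.
apply: (@poly_mul r 1); first by rewrite addn1.
  do 2!(apply: poly_add; last exact: poly_const).
  by apply: (@poly_mul 0 r) => //; [apply: poly_const|apply: poly_exp].
apply: poly_add; last exact: poly_const.
by apply: (@poly_mul 1 0) => //; [apply: poly_div|apply: poly_const].
Qed.

Lemma poly_program_time : poly_bound (4 * r ^ 2) (program_time r m c0 d).
Proof.
have r2 : 0 < 4 * r ^ 2 by rewrite muln_gt0 expn_gt0 (ltn_trans _ r_gt2).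
apply: poly_add; first exact: poly_copy_time.
apply: poly_add; first exact: poly_const.
apply: poly_add; last exact: poly_copy_time.
apply: poly_add; last exact: poly_const.
(* O(n^(r+1)) passes of O(n^(2 r^2 + r)) steps each, and 2 r^2 + 2 r + 1 <= 4 r^2. *)
apply: (@poly_mul r.+1 (2 * (r * r) + r)); first by move: r_gt2; clear; nia.
  apply: (@poly_le _ _ (fun n => max_score r m c0 n + 1)); first by move=> n _; rewrite addn1.
  by apply: poly_add; [exact: poly_max_score|exact: poly_const].
apply: poly_add; last exact: poly_const.
apply: poly_add; first exact: poly_const.
apply: (@poly_for_time (2 * (r * r)) r) => //; last exact: poly_try_time.
exact: poly_exp.
Qed.

End Time.

Lemma digits_exist n l (y : nat -> nat) : 0 < n -> (forall i, y i < n) ->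
  exists2 u, u < n ^ l & forall i, i < l -> (u %/ n ^ i) %% n = y i.
Proof.
move=> n0; elim: l y => [|l IH] y yn; first by exists 0.
have [u ul Hu] := IH (fun i => y i.+1) (fun i => yn i.+1).
exists (u * n + y 0).
  apply: (@leq_trans (u.+1 * n)); last by rewrite expnSr leq_mul2r ul orbT.
  by rewrite mulSn addnC ltn_add2r.
move=> [|i] il; first by rewrite divn1 modnMDl modn_small.
by rewrite expnS divnMA divnMDl // (divn_small (yn 0)) addn0 Hu.
Qed.

Lemma swap_self (T : Type) (pi : nat -> T) p : swap pi p p = pi.
Proof.
by apply: funext => x; rewrite /swap; case: eqP => [->|].
Qed.

Lemma swaps_nseq_self (T : Type) (pi : nat -> T) p l : swaps pi (nseq l (p, p)) = pi.
Proof. by elim: l => //= l IH; rewrite swap_self. Qed.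

(** Shorter sequences are padded by transpositions of position 0 with itself, so the program, which
    always tries exactly [l] transpositions, covers all shorter moves as well. *)
Lemma swap_pairs_onto n l (ps : seq (nat * nat)) : 0 < n -> size ps <= l ->
  all (fun pq => (pq.1 < n) && (pq.2 < n)) ps ->
  exists2 u, u < n ^ (2 * l) & forall (T : Type) (pi : nat -> T),
    swaps pi (swap_pairs n u l) = swaps pi ps.
Proof.
move=> n0 sl /allP Hps.
pose y i := let pq := nth (0, 0) ps i./2 in if odd i then pq.2 else pq.1.
have [|u un Hu] := @digits_exist n (2 * l) y n0.
  move=> i; rewrite /y; have [lt|ge] := ltnP i./2 (size ps).
    by have /andP[p1 p2] := Hps _ (mem_nth (0, 0) lt); case: odd.
  by rewrite nth_default //; case: odd.
exists u => // T pi.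
suff -> : swap_pairs n u l = ps ++ nseq (l - size ps) (0, 0).
  by rewrite swaps_cat swaps_nseq_self.
apply: (@eq_from_nth _ (0, 0)); first by rewrite size_map size_iota size_cat size_nseq subnKC.
move=> i; rewrite size_map size_iota => il.
rewrite (nth_map 0) ?size_iota // nth_iota // add0n !Hu; try lia.
rewrite /y /= oddM /= mul2n uphalf_double doubleK.
rewrite nth_cat; case: ltnP => [_|ge]; first by case: nth.
by rewrite nth_default // nth_nseq; case: ifP.
Qed.

Section Output.
Variables (n r : nat) (e : rel 'I_n) (s : state) (rho : nat -> 'I_n).
Hypotheses (esym : symmetric e) (rn : r %| n) (r_gt0 : 0 < r).
Hypothesis inj : {in [pred x | x < n] &, injective rho}.
Hypothesis out : forall p, p < n -> Defs.mem s p = rho p.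
Hypothesis all_full : forall c, c < n %/ r -> full e r rho c.

Let index_lt c i : c < n %/ r -> i < r -> c * r + i < n.
Proof.
move=> cn ir; rewrite -(divnK rn); apply: (@leq_trans (c.+1 * r)).
  by rewrite mulSn addnC ltn_add2r.
by rewrite leq_mul2r cn orbT.
Qed.

Lemma output_blockP c v : c < n %/ r ->
  reflect (exists2 i, i < r & v = rho (c * r + i)) (v \in output_block n r s c).
Proof.
move=> cn; rewrite inE; apply: (iffP existsP) => [[i /eqP E]|[i ir ->]].
  by exists i => //; apply: val_inj; rewrite /= -E out // index_lt.
by exists (Ordinal ir); rewrite out ?index_lt.
Qed.

Lemma output_is_factor : is_Kr_factor e r (output_family n r s).
Proof.
split.
- move=> S /imsetP[c _ ->]; have cn := ltn_ord c; split.
    have -> : output_block n r s c = [set rho (c * r + i) | i : 'I_r].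
      apply/setP => v; apply/output_blockP/imsetP => // [[i ir ->]|[i _ ->]].
        by exists (Ordinal ir).
      by exists i.
    rewrite card_imset ?card_ord // => i i' /inj; rewrite !inE => E; apply: val_inj.
    by have /addnI := E (index_lt cn (ltn_ord i)) (index_lt cn (ltn_ord i')).
  move=> x y /(output_blockP _ cn)[i ir ->] /(output_blockP _ cn)[i' ir' ->] ne.
  move/(prefix_cliqueP esym): (all_full cn); apply=> //.
  by apply: contraNneq ne => ->.
- apply/trivIsetP => _ _ /imsetP[c _ ->] /imsetP[c' _ ->] ne.
  have cn := ltn_ord c; have cn' := ltn_ord c'.
  apply/pred0P => v /=; apply/negP => /andP[/(output_blockP _ cn)[i ir ->]].
  move=> /(output_blockP _ cn')[i' ir' /inj]; rewrite !inE.
  move=> /(_ (index_lt cn ir) (index_lt cn' ir'))/block_index_inj[] // E _.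
  by case/eqP: ne; rewrite E.
- apply/setP => v; rewrite inE; apply/bigcupP.
  have cardT : #|'I_n| = n %/ r * r by rewrite card_ord divnK.
  have injr : {in [pred x | x < n %/ r * r] &, injective rho} by rewrite divnK.
  have vK := positionK cardT injr v; have lt := position_lt cardT injr v.
  set p := position _ _ _ _ in vK lt.
  have cn : p %/ r < n %/ r by rewrite ltn_divLR.
  exists (output_block n r s (p %/ r)).
    by apply/imsetP; exists (Ordinal cn).
  apply/output_blockP => //; exists (p %% r); first by rewrite ltn_mod.
  by rewrite -divn_eq vK.
Qed.

End Output.

(** * Choice of the constants *)

Import Order.TTheory GRing.Theory Num.Theory.

Lemma exists_subset_card (T : finType) (A : {set T}) k : k <= #|A| ->
  exists2 B : {set T}, B \subset A & #|B| = k.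
Proof.
move=> kA; exists [set x in take k (enum A)].
  by apply/subsetP => x; rewrite inE => /mem_take; rewrite mem_enum.
rewrite cardsE (card_uniqP _) ?take_uniq ?enum_uniq // size_take -cardE.
by case: ltngtP kA.
Qed.

Section Dense.
Variables (T : finType) (e : rel T).
Hypothesis esym : symmetric e.

Lemma card_induced_edges (U : {set T}) :
  #|induced_edges e U| <= \sum_(v in U) #|U :&: nbh e v|.
Proof.
pose D := [set p : T * T | (p.1 \in U) && (p.2 \in U :&: nbh e p.1)].
apply: (@leq_trans #|D|).
  apply: leq_trans (leq_imset_card (fun p : T * T => [set p.1; p.2]) D).
  apply: subset_leq_card; apply/subsetP => E; rewrite /induced_edges inE => /andP[/imsetP[p pe ->] /subsetP sub].
  have ep : e p.1 p.2 by move: pe; rewrite inE.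
  apply/imsetP; exists p => //.
  by rewrite !inE ep !sub ?set21 ?set22.
under eq_bigr => v _ do rewrite -sum1_card.
rewrite pair_big_dep /= sum1_card; apply: subset_leq_card.
by apply/subsetP => -[u v]; rewrite inE /= => /andP[uU vU]; rewrite unfold_in /= uU vU.
Qed.

Lemma sum_nbh_subset (A B : {set T}) : A \subset B ->
  \sum_(v in A) #|A :&: nbh e v| <= \sum_(v in B) #|B :&: nbh e v|.
Proof.
move=> AB; rewrite [leqRHS](big_setID A) /= (setIidPr AB).
apply: leq_trans (leq_addr _ _); apply: leq_sum => v _.
by apply: subset_leq_card; apply: setSI.
Qed.

Lemma sum_nbh_pad (A B : {set T}) : A \subset B ->
  \sum_(v in B) #|B :&: nbh e v| <=
    \sum_(v in A) #|A :&: nbh e v| + 2 * (#|B :\: A| * #|T|).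
Proof.
move=> AB; rewrite (big_setID A) /= (setIidPr AB) mul2n -addnn addnA leq_add //.
  apply: (@leq_trans (\sum_(v in A) (#|A :&: nbh e v| + #|B :\: A|))).
    apply: leq_sum => v _; apply: leq_trans (leq_card_setU _ _).1.
    apply: subset_leq_card; apply/subsetP => u; rewrite !inE => /andP[-> ->].
    by rewrite andbT; case: (u \in A).
  by rewrite big_split /= leq_add2l sum_nat_const mulnC leq_mul2l max_card orbT.
rewrite -sum_nat_const; apply: leq_sum => v _; exact: max_card.
Qed.

(** A larger set contains a k-set. A smaller one is padded to a k-set by at most [b] vertices, which
    adds at most 2 b |T| to the degree sum; since 4 g b <= |T|, this accounts for at most half of
    |T|^2 / g, so doubling [g] compensates. *)
Lemma dense_of_nonsparse (k g b : nat) : k <= #|T| -> 4 * g * b <= #|T| ->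
  (forall U : {set T}, #|U| = k -> #|T| ^ 2 <= g * #|induced_edges e U|) ->
  forall Y : {set T}, k <= #|Y| + b ->
    #|T| ^ 2 <= g.*2 * \sum_(v in Y) #|Y :&: nbh e v|.
Proof.
move=> kT gb H Y kY.
have [kleY|Yltk] := leqP k #|Y|.
  have [U UY /H le] := exists_subset_card kleY.
  rewrite (leq_trans le) // leq_mul ?(leq_trans (card_induced_edges U)) //.
    by rewrite -addnn leq_addr.
  exact: sum_nbh_subset.
have [|W WY cW] := @exists_subset_card _ (~: Y) (k - #|Y|).
  by rewrite -(leq_add2l #|Y|) cardsC subnKC // ltnW.
have YU : Y \subset Y :|: W by apply: subsetUl.
have WE : (Y :|: W) :\: Y = W.
  rewrite setDUl setDv set0U; apply/setDidPl.
  by rewrite disjoints_subset.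
have cU : #|Y :|: W| = k.
  by rewrite -(cardsID Y) setIC (setIidPl YU) WE cW subnKC // ltnW.
have le := H _ cU.
have le2 := leq_trans (card_induced_edges _) (sum_nbh_pad YU).
rewrite WE cW in le2.
have le3 : 2 * ((k - #|Y|) * #|T|) <= 2 * (b * #|T|).
  by rewrite leq_mul2l leq_mul2r; apply/orP; right; apply/orP; right; move: kY; clear; lia.
have le4 : 4 * g * b * #|T| <= #|T| ^ 2 by rewrite expnS expn1 leq_mul2r gb orbT.
have le5 := leq_mul (leqnn g) (leq_trans le2 (leq_add (leqnn _) le3)).
move: (leq_trans le le5) le4; move: (\sum_(v in Y) _) (#|T| ^ 2); clear => s t.
by rewrite mulnDr; lia.
Qed.

End Dense.

Lemma min_degree_le (T : finType) (e : rel T) v : min_degree e <= degree e v.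
Proof.
rewrite /min_degree; have : v \in index_enum T by rewrite mem_index_enum.
elim: (index_enum T) => [//|x s IH]; rewrite inE big_cons.
by case/orP => [/eqP->|/IH]; rewrite geq_min ?leqnn // => ->; rewrite orbT.
Qed.

(** [M] depends on r and g, [d] on r, and [m] on all of these; [k0] then swallows every term without
    k, a or b. The assumptions on [a] and [b] make [a] at most k / (64 r g) and [b] about k r / (2
    g). *)
Lemma parameters_exist (r g : nat) : 2 < r -> r <= g ->
  exists M d m k0 : nat,
  [/\ 0 < M, (3 * r) ^ r < d, 0 < m,
      (g * r.*2 ^ (r - 3)) ^ r * (r * M) * d <= m &
  forall k a b, k0 <= k -> 64 * (r * r * g) * a <= k * r ->
    2 * g * b <= k * r < 2 * g * b + 2 * g ->
  [/\ b.*2 <= k, g.*2 <= k,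
   r * (3 * r * ((m * r + r * M + a) * M + k.*2)) + M * r * (a + r) +
    2 * (k * r) * r <= M * b,
   r * a + m * r * r + r + r * r <= b &
   3 * (a + 2 * (m * r + m) + r * r) <= 2 * k]].
Proof.
move=> r2 gr; have r0 : 0 < r by lia.
have g_gt0 : 0 < g by lia.
(* The factor 64 makes M b about 32 r^2 k, whereas the terms to be dominated that grow with k or a
   amount to at most 12 r^2 k. *)
pose M := 64 * r * g; pose d := ((3 * r) ^ r).+1.
pose m := ((g * r.*2 ^ (r - 3)) ^ r * (r * M) * d).+1.
pose K2 := m * r * r + r + r * r.
exists M, d, m.
have m0 : 0 < m by [].
have m_large : (g * r.*2 ^ (r - 3)) ^ r * (r * M) * d <= m by [].
have d_large : (3 * r) ^ r < d by [].
exists (3 * r * r * (m * r + r * M) * M + M * r * r + 64 * r * g +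
        2 * g * K2 + 2 * g + 6 * (m * r + m) + 3 * (r * r)).
clearbody m d; split=> //; first by rewrite /M !muln_gt0 r0 g_gt0.
move=> k a b kk Da' /andP[Hb1 Hb2].
have Da : 64 * (r * g * a) <= k.
  rewrite -(leq_pmul2r r0).
  by apply: leq_trans Da'; apply: eq_leq; lia.
have F1 : 2 * g + 64 * r * g + 3 * r * r * (m * r + r * M) * M + M * r * r <= k.
  by move: kk; clear; lia.
have F2 : 2 * g * K2 + 2 * g <= k by move: kk; clear; lia.
have F3 : 6 * (m * r + m) + 3 * (r * r) <= k by move: kk; clear; lia.
have rk : k <= r * k by rewrite leq_pmull.
have rrk : r * k <= r * (r * k) by rewrite leq_pmull.
clear kk; split.
- rewrite -(leq_pmul2r r0); have : b * r <= b * g by rewrite leq_mul2l gr orbT.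
  by move: Hb1; clear; lia.
- by move: F2; clear; lia.
- have ME : M = 64 * (r * g) by rewrite /M mulnA.
  have E1 : M * b = 32 * (r * (2 * g * b)) by rewrite ME; clear; lia.
  have E2 : r * (k * r) <= r * (2 * g * b) + 2 * (r * g).
    have := leq_mul (leqnn r) (ltnW Hb2); clear; lia.
  have E3 : 3 * r * r * a * M = 192 * (r * (r * (r * g * a))) by rewrite ME; clear; lia.
  have E4 : M * r * a = 64 * (r * (r * g * a)) by rewrite ME; clear; lia.
  have E5 : 64 * (r * (r * g * a)) <= r * k by rewrite mulnCA leq_mul2l Da orbT.
  have E6 : 64 * (r * (r * (r * g * a))) <= r * (r * k) by rewrite mulnCA leq_mul2l E5 orbT.
  have -> : r * (3 * r * ((m * r + r * M + a) * M + k.*2)) + M * r * (a + r) +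
      2 * (k * r) * r = 3 * r * r * (m * r + r * M) * M + 3 * r * r * a * M +
      6 * (r * (r * k)) + M * r * a + M * r * r + 2 * (r * (r * k)).
    by clear; lia.
  rewrite E1 E3 E4; move: E2 E5 E6 F1 rk rrk.
  by clear; lia.
- have H1 : 2 * g * (r * a) <= k by move: Da; clear; lia.
  have H2 : 3 * k <= k * r by rewrite mulnC leq_mul2l r2 orbT.
  rewrite -2!addnA addnA -addnA -/K2.
  have -> : r * a + (m * r * r + (r + r * r)) = r * a + K2 by rewrite /K2; lia.
  rewrite -ltnS -(ltn_pmul2l (_ : 0 < 2 * g)) ?muln_gt0 ?g_gt0 //.
  by move: H1 H2 Hb2 F2; rewrite mulnDr; clear; lia.
- have H1 : 3 * a <= k.
    have : a <= r * g * a by rewrite leq_pmull // muln_gt0 r0.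
    by move: Da; clear; lia.
  by move: H1 F3; clear; lia.
Qed.

Lemma local_max_suffices (R : realType) (r : nat) (gamma : R) : 2 < r ->
  (0 < gamma)%R ->
  exists2 alpha0 : R, (0 < alpha0)%R &
  forall alpha : R, (0 < alpha < alpha0)%R ->
  exists n0 m c0 d : nat, forall n, n0 < n -> r %| n ->
  forall e : rel 'I_n, symmetric e -> irreflexive e ->
  ((1 - r%:R^-1 - alpha) * n%:R <= (min_degree e)%:R :> R)%R ->
  ~ (exists U : {set 'I_n}, sparse_set e gamma (n %/ r) U) ->
  m * r <= n %/ r /\
  forall (X : nat -> nat -> 'I_n) (pi : nat -> 'I_n),
  (forall y : nat -> 'I_n,
     exists u : 'I_(n ^ r), forall i, i < r -> X u i = y i) ->
  {in [pred x | x < n] &, injective pi} ->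
  local_max r (n %/ r) (score e r (n %/ r) m (n ^ r) c0 d X) pi ->
  forall c, c < n %/ r -> full e r pi c.
Proof.
move=> r2 gamma0.
(* An integer above 1 / gamma, so that a k-set that is not sparse spans at least n^2 / g0 edges. *)
pose g0 := Num.bound gamma^-1.
have g0P : (1 <= g0%:R * gamma :> R)%R.
  have := archi_boundP (ltW (_ : (0 < gamma^-1)%R)); rewrite invr_gt0 => /(_ gamma0).
  by rewrite -/g0 -[X in (X < _)%R]mul1r ltr_pdivrMr // => /ltW.
(* The doubling is the one in [dense_of_nonsparse], and the summand r ensures r <= g for
   [parameters_exist]. *)
pose g := (g0 + r).*2.
have gr : r <= g by rewrite /g; clear; lia.
have [M [d [m [k0 [M0 d_large m0 m_large Hk0]]]]] := parameters_exist r2 gr.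
pose D := 64 * (r * r * g).
have D0 : 0 < D by rewrite /D /g; nia.
have r0 : 0 < r by lia.
(* For alpha < 1 / D the slack alpha n in the degrees is at most n / D, and its integer part is the
   [a] of the combinatorial argument. *)
exists (D%:R^-1)%R; first by rewrite invr_gt0 ltr0n.
move=> alpha /andP[alpha0 alphaD]; exists (k0.+1 * r), m, (r * M), d.
move=> n nn0 rn e esym eirr mindeg nonsparse.
pose k := n %/ r.
have nE : k * r = n by rewrite divnK.
have kk0 : k0 < k by rewrite -(ltn_pmul2r r0) nE (leq_ltn_trans _ nn0) // leq_mul2r leqnSn orbT.
pose a := (k * r) %/ D; pose b := (k * r) %/ (2 * g).
have [||b_small g_small M_large b_large k_large] := Hk0 k a b (ltnW kk0).
- by rewrite mulnC leq_divM.
- have g2 : 0 < 2 * g by move: gr r0; clear; lia.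
  by rewrite [2 * g * b]mulnC /b leq_divM /= addnC -mulSn ltn_ceil.
have cardT : #|'I_n| = k * r by rewrite card_ord nE.
have nonnbh v : #|~: nbh e v| <= k + a.
  have deg : ((1 - r%:R^-1 - alpha) * n%:R <= #|nbh e v|%:R :> R)%R.
    by apply: le_trans mindeg _; rewrite ler_nat; apply: min_degree_le.
  have cE : #|nbh e v| + #|~: nbh e v| = n by rewrite cardsC card_ord.
  have {}cE : (#|~: nbh e v|%:R = n%:R - #|nbh e v|%:R :> R)%R.
    have /(congr1 (fun x : nat => (x%:R : R)%R)) := cE.
    by rewrite natrD => <-; rewrite addrC addKr.
  have kE : (r%:R^-1 * n%:R = k%:R :> R)%R.
    by rewrite -nE natrM mulrC mulfK // pnatr_eq0 -lt0n.
  have le : (#|~: nbh e v|%:R <= k%:R + alpha * n%:R :> R)%R.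
    by rewrite cE; move: deg; rewrite !mulrBl mul1r kE; lra.
  have le2 : (alpha * n%:R <= D%:R^-1 * n%:R :> R)%R by rewrite ler_wpM2r // ltW.
  have [lek|ltk] := leqP #|~: nbh e v| k; first exact: leq_trans lek (leq_addr _ _).
  rewrite -leq_subLR leq_divRL; last exact: D0.
  rewrite nE -/D -(ler_nat R) natrM natrB ?(ltnW ltk) // -ler_pdivlMr ?ltr0n //.
  rewrite [X in (_ <= X)%R]mulrC lerBlDl.
  exact: le_trans le (lerD (lexx _) le2).
have dense : forall Y : {set 'I_n}, k <= #|Y| + b ->
    #|'I_n| ^ 2 <= g * \sum_(v in Y) #|Y :&: nbh e v|.
  apply: dense_of_nonsparse.
  - by rewrite card_ord leq_div.
  - have := leq_divM (k * r) (2 * g); rewrite -/b card_ord nE; apply: leq_trans.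
    by apply: eq_leq; rewrite /g; clear; lia.
  - move=> U cU; rewrite leqNgt; apply/negP => lt; apply: nonsparse; exists U.
    split=> //; rewrite ltNge; apply/negP => le.
    move: lt; rewrite ltnNge => /negP; apply.
    rewrite -(ler_nat R) natrX natrM natrD.
    have e0 : (0 <= #|induced_edges e U|%:R :> R)%R by [].
    have n2 : (0 <= #|'I_n|%:R ^+ 2 :> R)%R by rewrite exprn_ge0.
    have r0' : (0 <= r%:R :> R)%R by [].
    have := ler_wpM2l (ler0n R g0) le; rewrite mulrA.
    have := ler_wpM2r n2 g0P; rewrite mul1r.
    move: (mulr_ge0 r0' e0); nra.
have mk : m * r <= k.
  have H x y : 3 * (x + 2 * (m * r + m) + r * r) <= 2 * y -> m * r <= y by clear; lia.
  exact: H k_large.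
split=> // X pi X_onto inj max c ck.
have k0' : 0 < k by apply: leq_ltn_trans kk0.
apply: (local_max_full esym eirr r2 cardT k0' _ _ X_onto nonnbh dense b_small g_small M0 M_large b_large k_large d_large m_large m0 max) => //.
- by rewrite nE.
- by rewrite nE.
Qed.

Lemma input_mem_adjacent n (e : rel 'I_n) (i j : 'I_n) :
  input_mem e (i * n + j) = e i j.
Proof.
rewrite /input_mem; congr nat_of_bool; apply/existsP/idP.
  case=> i' /existsP[j' /andP[/eqP/block_index_inj[] // Ei Ej]].
  by rewrite (val_inj Ei) (val_inj Ej).
by move=> eij; exists i; apply/existsP; exists j; rewrite eqxx.
Qed.

Lemma program_correct (r m c0 d : nat) : 2 < r ->
  exists n1 c C : nat, 1 < c /\
  forall n, n1 < n -> r %| n -> m * r <= n %/ r ->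
  forall e : rel 'I_n, symmetric e ->
  (forall (X : nat -> nat -> 'I_n) (pi : nat -> 'I_n),
    (forall y : nat -> 'I_n,
       exists u : 'I_(n ^ r), forall i, i < r -> X u i = y i) ->
    {in [pred x | x < n] &, injective pi} ->
    local_max r (n %/ r) (score e r (n %/ r) m (n ^ r) c0 d X) pi ->
    forall c, c < n %/ r -> full e r pi c) ->
  finds_Kr_factor_within (word_length c n) (program r m c0 d) e r
    (C * n ^ (4 * r ^ 2)).
Proof.
move=> r2; have r0 : 0 < r by apply: ltn_trans r2.
have [C HC] := poly_program_time m c0 d r2.
have [D HD] := poly_max_score r m c0.
(* n ^ E exceeds the numbers of swap sequences, n^(2 r^2), the scores, of order n^(r+1), and the
   addresses, below n^3. Taking n above [D] hides the constant of the score in one more factor n;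
   the 2 added to the word length factor gives strictness and 1 < c. *)
pose E := 2 * (r * r) + r + 3.
exists (maxn 3 D), (E * degree_cmd (program r m c0 d)).+2, C.
split=> // n; rewrite gtn_max => /andP[n3 nD] rn mr e esym opt.
have n0 : 0 < n by apply: leq_trans n3.
have n1 : 1 < n by apply: leq_trans n3.
pose B := n ^ E.
have powB j : j <= E -> n ^ j <= B by move=> jE; rewrite leq_pexp2l.
have B_square : n * n + n + n <= B.
  apply: (@leq_trans (n ^ 3)); last by apply: powB; rewrite leq_addl.
  by rewrite !expnS expn0 muln1; move: n3; clear; nia.
have B_score : max_score r m c0 n <= B.
  apply: leq_trans (HD n n0) _; apply: (@leq_trans (n ^ r.+2)).
    by rewrite [n ^ r.+2]expnS leq_mul2r ltnW ?orbT.
  by apply: powB; rewrite /E; lia.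
have B_N : n ^ r <= B by apply: powB; rewrite /E; lia.
have B_swaps : n ^ (2 * (r * r)) <= B by apply: powB; rewrite /E; lia.
pose X u i : 'I_n := Ordinal (ltn_pmod (u %/ n ^ i) n0).
have X_digits u i : X u i = (u %/ n ^ i) %% n :> nat by [].
have := wp_program d n0 B_square r2 rn X_digits mr B_score B_N B_swaps
  (s := input_state e) erefl erefl (input_mem_adjacent e).
move=> [t [s [ex tT [rho [inj max out]]]]].
have B2 : 1 < B by rewrite (leq_trans n1) // -[leqLHS]expn1; apply: powB; rewrite /E; lia.
have bnd : bounded B (input_state e).
  split=> x /=; first by rewrite /input_regs; case: eqP => // _; apply: leq_trans B_square; apply: leq_addl.
  by apply: leq_trans (leq_b1 _) _; apply: ltnW.
have word : B ^ degree_cmd (program r m c0 d) <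
    2 ^ word_length (E * degree_cmd (program r m c0 d)).+2 n.
  set q := degree_cmd _.
  apply: (@leq_trans (n ^ (E * q).+2)); first by rewrite /B -expnM ltn_exp2l.
  rewrite /word_length [_.+2 * _]mulnC expnM leq_exp2r //.
  by have /andP[] := up_log_bounds (isT : 1 < 2) n1.
have [ex' _] := iexec_exec B2 ex bnd word.
exists t, s; split=> //; first exact: leq_trans tT (HC n n0).
apply: (output_is_factor esym rn r0 inj out).
apply: (opt X) => //.
  move=> y; have [u un Hu] := @digits_exist n r (fun i => y i) n0 (fun i => ltn_ord _).
  by exists (Ordinal un) => i ir; apply: val_inj; rewrite /= Hu.
move=> ps sps; rewrite (divnK rn) => pps.
have [u un <-] := swap_pairs_onto n0 sps pps.
exact: max.
Qed.

Local Open Scope ring_scope.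

Theorem theorem1p7 :
  forall (R : realType) (r : nat), (3 <= r)%N ->
  exists2 gamma0 : R, 0 < gamma0 &
  forall gamma : R, 0 < gamma < gamma0 ->
  exists2 alpha0 : R, 0 < alpha0 &
  forall alpha : R, 0 < alpha < alpha0 ->
  exists (n0 : nat) (p : cmd) (c C : nat), (1 < c)%N /\
  forall (n : nat), (n0 < n)%N -> (r %| n)%N ->
  forall (e : rel 'I_n), symmetric e -> irreflexive e ->
  (1 - r%:R^-1 - alpha) * n%:R <= (min_degree e)%:R :> R ->
  ~ (exists U : {set 'I_n}, sparse_set e gamma (n %/ r)%N U) ->
  finds_Kr_factor_within (word_length c n) p e r (C * n ^ (4 * r ^ 2))%N.
Proof.
move=> R r r2; exists 1 => // gamma /andP[gamma_gt0 _].
have [alpha0 alpha0_gt0 H] := local_max_suffices r2 gamma_gt0.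
exists alpha0 => // alpha /H[n0 [m [c0 [d {}H]]]].
have [n1 [c [C [c1 correct]]]] := program_correct m c0 d r2.
exists (maxn n0 n1), (program r m c0 d), c, C; split=> // n.
rewrite gtn_max => /andP[n0n n1n] rn e esym eirr mindeg nonsparse.
have [mr opt] := H n n0n rn e esym eirr mindeg nonsparse.
exact: correct.
Qed.
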